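(* For every integer $h\ge 1$ let $S_h\subset\mathbb{P}^{2^{h-1}-1}(\mathbb{C})$ be the (even pure) spinor variety, of dimension $\frac{h(h-1)}{2}$, and let $\sigma_k(S_h)$ denote its $k$-secant variety. (i) $\sigma_3(S_h)$ has the expected dimension, i.e. $$\dim_{\mathbb{C}}\sigma_3(S_h)=\min\left\{3\cdot\frac{h(h-1)}{2}+2,\ 2^{h-1}-1\right\},$$ except when $h\in\{7,8\}$. (ii) $S_7$ has a defective $3$-secant variety, and $S_8$ has defective $3$-secant and $4$-secant varieties. In particular $\dim_{\mathbb{C}}\sigma_3(S_7)=58$, $\dim_{\mathbb{C}}\sigma_3(S_8)=85$ and $\dim_{\mathbb{C}}\sigma_4(S_8)=111$.
   Context: Let $V$ be a complex vector space of dimension $2h$ with a non-degenerate quadratic form $Q$. The variety of maximal totally isotropic subspaces of $V$ has two isomorphic irreducible components, each embedded in the projectivization $\mathbb{P}^{2^{h-1}-1}(\mathbb{C})$ of a half-spin representation (the even or odd spinors) by sending a maximal isotropic subspace to its pure spinor; $S_h$ is one such component. Concretely, $S_h$ is the Zariski closure in $\mathbb{P}^{2^{h-1}-1}(\mathbb{C})$ of the image of the map $$U\mapsto \big(\mathrm{Pf}_K(U)\big)_{K\subseteq\{1,\dots,h\},\ |K|\text{ even}},$$ where $U$ ranges over skew symmetric $h\times h$ complex matrices and $\mathrm{Pf}_K(U)$ is the Pfaffian of the submatrix of $U$ with rows and columns indexed by $K$ (with $\mathrm{Pf}_\emptyset(U)=1$). For a projective variety $X\subseteq\mathbb{P}^N(\mathbb{C})$,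 the $k$-secant variety $\sigma_k(X)$ is the Zariski closure of the union of all linear spaces $\langle x_1,\dots,x_k\rangle$ spanned by $k$ points $x_1,\dots,x_k$ of $X$. If $X$ is non-degenerate (not contained in a hyperplane) of dimension $d$, then $\dim_{\mathbb{C}}\sigma_k(X)\le\min\{kd+k-1,N\}$; $\sigma_k(X)$ has the expected dimension if equality holds, and $X$ has a defective $k$-secant variety if the inequality is strict. *)

(* Defs.v *)
From mathcomp Require Import all_boot all_fingroup all_order all_algebra.
From mathcomp Require Import classical_sets reals.
From mathcomp Require Import complex mpoly.

Set Implicit Arguments.
Unset Strict Implicit.
Unset Printing Implicit Defensive.

Import GRing.Theory.
Local Open Scope ring_scope.
Local Open Scope classical_set_scope.

(* The projective space of dimension n - 1: lines through 0 in F^n. *)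
Definition proj (F : fieldType) (n : nat) :=
  {p : {vspace 'rV[F]_n} | \dim p == 1%N}.

Section ProjectiveVarieties.
Variables (F : fieldType) (n : nat).
Implicit Types (X Z A B : set (proj F n)) (k d e : nat).

Definition homogeneous_form (f : {mpoly F[n]}) : Prop := exists d : nat, f \is d.-homog.

Definition vanishes (f : {mpoly F[n]}) (p : proj F n) : Prop :=
  forall v : 'rV[F]_n, v \in val p -> f.@[v 0] = 0.

Definition zero_locus (S : set {mpoly F[n]}) : set (proj F n) :=
  [set p | forall f, S f -> vanishes f p].

Definition zariski_closed Z : Prop :=
  exists2 S : set {mpoly F[n]}, S `<=` homogeneous_form & Z = zero_locus S.

Definition zariski_closure A : set (proj F n) := smallest zariski_closed A.

Definition irreducible Z : Prop :=
  Z !=set0 /\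
  forall A B, zariski_closed A -> zariski_closed B ->
    Z `<=` A `|` B -> Z `<=` A \/ Z `<=` B.

Definition irreducible_chain X d (W : nat -> set (proj F n)) : Prop :=
  (forall i, (i <= d)%N ->
     [/\ zariski_closed (W i), irreducible (W i) & W i `<=` X]) /\
  (forall i, (i < d)%N -> W i `<` W i.+1).

(* For X closed, [has_dim X d] says that the Krull dimension of X is d. It is
   a relation because the empty set has no dimension in nat. *)
Definition has_dim X d : Prop :=
  (exists W, irreducible_chain X d W) /\
  (forall e W, irreducible_chain X e W -> (e <= d)%N).

Definition nondegenerate X : Prop :=
  forall H : {vspace 'rV[F]_n}, \dim H = n.-1 ->
    ~ (forall p, X p -> (val p <= H)%VS).

(* The k points may coincide; this does not change the union when X has at
   least k points, and it is what makes sense when X is a single point. *)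
Definition secant_variety k X : set (proj F n) :=
  zariski_closure
    [set p | exists2 x : 'I_k -> proj F n, (forall i, X (x i))
             & (val p <= \sum_(i < k) val (x i))%VS].

Definition expected_secant_dim k d : nat := minn (k * d + k - 1) n.-1.

Definition has_expected_secant_dim k X : Prop :=
  nondegenerate X /\
  exists2 d, has_dim X d & has_dim (secant_variety k X) (expected_secant_dim k d).

Definition defective_secant k X : Prop :=
  nondegenerate X /\
  exists d e, [/\ has_dim X d, has_dim (secant_variety k X) e
                & (e < expected_secant_dim k d)%N].

End ProjectiveVarieties.

(* For m even (the only case used) this is
   1 / (2^(m/2) (m/2)!) * \sum_s sgn(s) \prod_(i < m/2) A_(s(2i), s(2i+1)). *)
Definition pfaffian (F : fieldType) (m : nat) (A : 'M[F]_m) : F :=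
  ((2 ^ m./2 * (m./2)`!)%:R)^-1 *
  \sum_(s : 'S_m) (-1) ^+ s *
    \prod_(i < m) \prod_(j < m | ~~ odd i && (j == i.+1 :> nat)) A (s i) (s j).

Definition even_subset (h : nat) := {K : {set 'I_h} | ~~ odd #|K|}.

Definition num_even_subsets (h : nat) : nat := #|{: even_subset h}|.

(* [enum_val] lists the elements of K in increasing order. *)
Definition sub_pfaffian (F : fieldType) (h : nat) (U : 'M[F]_h)
    (K : {set 'I_h}) : F :=
  pfaffian (mxsub (@enum_val _ (mem K)) (@enum_val _ (mem K)) U).

Definition spinor_vector (F : fieldType) (h : nat) (U : 'M[F]_h) :
    'rV[F]_(num_even_subsets h) :=
  \row_i sub_pfaffian U (val (enum_val i)).

Definition spinor_variety (F : fieldType) (h : nat) :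
    set (proj F (num_even_subsets h)) :=
  zariski_closure
    [set p | exists2 U : 'M[F]_h, U^T = - U & val p = <[spinor_vector U]>%VS].

Arguments spinor_variety F h : clear implicits.

(* The ambient space of [spinor_variety F h] is P^(2^(h-1)-1). *)
Lemma num_even_subsetsE (h : nat) :
  (0 < h)%N -> num_even_subsets h = (2 ^ (h - 1))%N.
Proof.
case: h => // h _; rewrite subn1 /num_even_subsets /= card_sig.
pose f (K : {set 'I_h.+1}) := if ord0 \in K then K :\ ord0 else ord0 |: K.
have fK : involutive f.
  move=> K; rewrite /f; case: (boolP (ord0 \in K)) => K0.
    by rewrite !finset.inE eqxx /= finset.setD1K.
  by rewrite !finset.inE eqxx /= finset.setU1K.
have odd_f K : odd #|f K| = ~~ odd #|K|.
  rewrite /f; case: (boolP (ord0 \in K)) => K0; last by rewrite cardsU1 K0.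
  by rewrite [in RHS](cardsD1 ord0) K0 oddD /= negbK.
pose E := [pred K : {set 'I_h.+1} | ~~ odd #|K|].
have EC : #|E| = #|[predC E]|.
  rewrite -(card_image (inv_inj fK) E); apply: eq_card => K.
  apply/fintype.imageP/idP => [[L EL ->]|EK].
    by move: EL; rewrite !finset.inE odd_f negbK.
  by exists (f K); rewrite ?fK //; move: EK; rewrite !finset.inE odd_f.
apply: double_inj; rewrite -[RHS]mul2n -expnS -addnn {2}EC.
rewrite (cardC E) -[LHS]cardsT -finset.powersetT card_powerset cardsT card_ord.
by [].
Qed.

(* Main.v *)
(* A cone parametrized by polynomials has projective dimension one less than the
   maximal rank of its Jacobian.  For sums of [k] points of the spinor cone the
   rows of the Jacobian are the tangent vectors [v_i] and [e_a e_b v_i] (Terracini),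
   so explicit points bound the dimension of the secant variety from below.  If
   these vectors, and likewise the odd spinors [e_a v_i], are linearly independent
   for [h], then they are so for [h + 1] at the same points; this reduces [h >= 9]
   to [h = 9].

   In the defective cases the spin group and suitable one-parameter families move
   [k] general pure spinors to a normal form whose sum lies in a fixed small space
   [L]; that a neighbourhood is reached is checked infinitesimally at one tuple.
   Hence the secant cone lies in the closure of the orbit of [L], whose tangent
   spaces are spanned by [L] and by the vectors [q l] with [q] in the Lie algebra.
   Linear relations between the [q l] that hold for all [l] in [L] then bound the
   dimension from above.

   The group only occurs through the products of the elements [1 + t q] with [q]
   quadratic and [q^2 = 0]. *)

(* Dimension is a supremum over chains of irreducible closed sets, so neither bound is immediate
   from a rank. From above, each strict inclusion of a chain contributes one more function that is
   algebraically independent on the cone, and in characteristic zero independent functions have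
   independent differentials at a general parameter. From below, a chain of the right length comes
   from a flag of affine subspaces in the parameter space. Closed sets enter only through the
   polynomials vanishing on their cones, so everything runs over any [numFieldType], without
   topology or algebraic closure. At [h = 9] the [3 * 37 = 111] tangent vectors first become
   independent: for [h = 7] there are [66] in [64] coordinates, for [h = 8] there are [87] of rank
   at most [86]. The small space is a line for [h = 7], where triples have a dense orbit up to
   scale; for [h = 8] it is spanned by the exponentials of the multiples of one symplectic form, or
   by products over four blocks that split two such forms at once. Its dimension [1], [5], [16] and
   the [58], [81], [96] remaining quadratic directions add up to [59], [86], [112]. *)
Require Import Defs.
From mathcomp Require Import all_boot all_fingroup all_order all_algebra.
From mathcomp Require Import boolp classical_sets functions reals complex mpoly ring zify.

Set Implicit Arguments.
Unset Strict Implicit.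
Unset Printing Implicit Defensive.

Import Order.TTheory GRing.Theory Num.Theory.
Local Open Scope ring_scope.
Local Open Scope classical_set_scope.

(** * Polynomial relations and the Jacobian *)

Section PolynomialRelations.
Variable F : numFieldType.

Lemma mderivU (n : nat) (i j : 'I_n) : ('X_i : {mpoly F[n]})^`M(j) = (i == j)%:R.
Proof.
rewrite mderivX mnm1E; case: eqP => [->|_]; last by rewrite scale0r.
rewrite scale1r -mpolyX0; congr 'X_[_].
by apply/mnmP => l; rewrite mnmBE mnm0E subnn.
Qed.

Lemma mderiv_lin (n : nat) (c : 'I_n -> F) j :
  (\sum_i c i *: 'X_i : {mpoly F[n]})^`M(j) = (c j)%:MP.
Proof.
rewrite raddf_sum (bigD1 j) //= mderivZ mderivU eqxx big1 ?addr0 => [|i /negPf ni].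
  by rewrite -mul_mpolyC mulr1.
by rewrite mderivZ mderivU ni scaler0.
Qed.

(** The chain rule for an arbitrary derivation that kills the constants. It serves both for the
    derivative along a line, with values in [{poly F}], and for the partial derivatives of a
    substitution. *)
Lemma mmap_derivation (A : comNzRingType) (iota : {rmorphism F -> A})
    (delta : {additive A -> A}) (n : nat) (g : 'I_n -> A) (p : {mpoly F[n]}) :
  (forall a b, delta (a * b) = delta a * b + a * delta b) ->
  (forall c, delta (iota c) = 0) ->
  delta (mmap iota g p) = \sum_l mmap iota g p^`M(l) * delta (g l).
Proof.
move=> dM dC.
have d1 : delta 1 = 0 by rewrite -(rmorph1 iota) dC.
have dmul p1 p2 :
    delta (mmap iota g p1) = \sum_l mmap iota g p1^`M(l) * delta (g l) ->
    delta (mmap iota g p2) = \sum_l mmap iota g p2^`M(l) * delta (g l) ->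
    delta (mmap iota g (p1 * p2)) =
      \sum_l mmap iota g (p1 * p2)^`M(l) * delta (g l).
  move=> e1 e2; rewrite rmorphM dM e1 e2 mulr_suml mulr_sumr -big_split /=.
  by apply: eq_bigr => l _; rewrite mderivM rmorphD !rmorphM /=; ring.
have dX i : delta (mmap iota g 'X_i) =
    \sum_l mmap iota g ('X_i)^`M(l) * delta (g l).
  rewrite mmapX mmap1U (bigD1 i) //= big1 ?addr0 => [|l nli].
    by rewrite mderivU eqxx rmorph1 mul1r.
  by rewrite mderivU eq_sym (negPf nli) rmorph0 mul0r.
have dC' c : delta (mmap iota g c%:MP) =
    \sum_l mmap iota g (c%:MP)^`M(l) * delta (g l).
  rewrite mmapC dC big1 // => l _; by rewrite mderivC mmap0 mul0r.
elim/mpolyind: p => [|c m p _ _ IH]; first exact: (dC' 0).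
rewrite rmorphD raddfD IH /=.
under [RHS]eq_bigr do rewrite mderivD rmorphD mulrDl /=.
rewrite [RHS]big_split /=; congr (_ + _).
rewrite -mul_mpolyC; apply: (dmul); first exact: dC'.
rewrite mpolyXE_id; elim/big_rec: _ => [|i q _ IHq]; first exact: (dC' 1).
apply: (dmul) => //; elim: (m i) => [|k IHk]; first exact: (dC' 1).
by rewrite exprS; apply: (dmul).
Qed.

Lemma mderiv_eq0_const (n : nat) (p : {mpoly F[n]}) :
  (forall i, p^`M(i) = 0) -> p = (p@_0%MM)%:MP.
Proof.
move=> dp; apply/mpolyP => m; rewrite mcoeffC.
have [->|nm0] := eqVneq m 0%MM; first by rewrite mulr1.
rewrite mulr0; have [i mi] : exists i, (0 < m i)%N.
  apply/existsP; apply: contraNT nm0 => /existsPn m0; apply/eqP/mnmP => i.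
  by rewrite mnm0E; apply/eqP; rewrite -leqn0 leqNgt m0.
have := congr1 (mcoeff (m - U_(i))%MM) (dp i).
rewrite mcoeff_mderiv mcoeff0 submK ?lep1mP -?lt0n // => /eqP.
by rewrite mulrn_eq0 => /orP[|/eqP].
Qed.

Lemma msize_mderiv (n : nat) (p : {mpoly F[n]}) i :
  (msize p^`M(i) <= (msize p).-1)%N.
Proof.
rewrite msizeE; apply/bigmax_leqP_seq => m; rewrite mcoeff_msupp => + _.
rewrite mcoeff_mderiv mulrn_eq0 /= -mcoeff_msupp => /msize_mdeg_lt.
by rewrite mdegD mdeg1 addn1; case: (msize p).
Qed.

Lemma poly_eq0_eval (q : {poly F}) : (forall t, q.[t] = 0) -> q = 0.
Proof.
move=> q0; apply/eqP; apply: contraT => nq0.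
have /= := max_poly_roots nq0 (rs := [seq k%:R | k <- iota 0 (size q)]).
rewrite size_map size_iota ltnn; apply.
  by apply/allP => x _; rewrite rootE q0.
rewrite map_inj_uniq ?iota_uniq // => a b /eqP.
by rewrite eqr_nat => /eqP.
Qed.

Definition line_restrict (n : nat) (v w : 'I_n -> F) : {mpoly F[n]} -> {poly F} :=
  mmap polyC (fun j => (v j)%:P + (w j)%:P * 'X).

Lemma horner_line_restrict (n : nat) (v w : 'I_n -> F) (p : {mpoly F[n]}) t :
  (line_restrict v w p).[t] = p.@[fun j => v j + t * w j].
Proof.
rewrite /line_restrict /mmap mevalE horner_sum; apply: eq_bigr => m _.
rewrite hornerM hornerC; congr (_ * _); rewrite horner_prod.
by apply: eq_bigr => i _; rewrite !hornerE mulrC.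
Qed.

Lemma deriv_line_restrict (n : nat) (v w : 'I_n -> F) (p : {mpoly F[n]}) :
  (line_restrict v w p)^`() =
    \sum_l line_restrict v w p^`M(l) * (w l)%:P.
Proof.
rewrite [LHS](mmap_derivation (iota := polyC) (delta := @deriv F)).
- by apply: eq_bigr => l _ /=; rewrite derivD derivC derivM derivC derivX mul0r !add0r mulr1.
- exact: derivM.
- exact: derivC.
Qed.

(** Induction on [msize]: the restrictions to lines are zero, so the partial derivatives vanish
    everywhere too, and in characteristic zero a polynomial with zero gradient is constant. *)
Lemma mpoly_eq0_eval (n : nat) (p : {mpoly F[n]}) :
  (forall v, p.@[v] = 0) -> p = 0.
Proof.
have [k] := ubnP (msize p); elim: k p => // k IH p szp p0.
have dp0 i : p^`M(i) = 0.
  have [p1|p1] := leqP (msize p) 1%N.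
    by rewrite (msize1_polyC p1) mderivC.
  apply: IH => [|v].
    by apply: leq_ltn_trans (msize_mderiv p i) _; rewrite prednK // ltnW.
  have /(congr1 (fun q => q^`().[0])) :
      line_restrict v (fun j => (j == i)%:R) p = 0.
    by apply: poly_eq0_eval => t; rewrite horner_line_restrict p0.
  rewrite deriv_line_restrict deriv0 horner0 horner_sum (bigD1 i) //= eqxx.
  rewrite hornerM hornerC mulr1 horner_line_restrict big1 ?addr0.
    by move=> <-; apply: meval_eq => j; rewrite mul0r addr0.
  by move=> j nji; rewrite hornerM hornerC (negPf nji) mulr0.
by rewrite (mderiv_eq0_const dp0); have := p0 (fun=> 0);
  rewrite {1}(mderiv_eq0_const dp0) mevalC => ->; rewrite mpolyC0.
Qed.

Lemma mpoly_neq0_eval (n : nat) (p : {mpoly F[n]}) :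
  p != 0 -> exists v, p.@[v] != 0.
Proof.
move=> np0; apply/not_existsP => p0; move/eqP: np0; apply.
apply: mpoly_eq0_eval => v; apply/eqP; apply: contraT => nv.
by case: (p0 v).
Qed.

End PolynomialRelations.

Section AlgebraicIndependence.
Variable F : numFieldType.

Definition subst (k m : nat) (g : 'I_k -> {mpoly F[m]}) : {mpoly F[k]} -> {mpoly F[m]} :=
  mmap (@mpolyC m F) g.

Arguments subst : simpl never.

Lemma meval_subst (k m : nat) (g : 'I_k -> {mpoly F[m]}) p v :
  (subst g p).@[v] = p.@[fun l => (g l).@[v]].
Proof.
have -> : subst g p = p \mPo [tuple g l | l < k].
  rewrite /subst /comp_mpoly /mmap; apply: eq_bigr => mm _; congr (_ * _).
  by apply: eq_bigr => i _; rewrite tnth_mktuple.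
by rewrite comp_mpoly_meval; apply: meval_eq => l; rewrite tnth_mktuple.
Qed.

Lemma mpoly_ext (m : nat) (p q : {mpoly F[m]}) :
  (forall v, p.@[v] = q.@[v]) -> p = q.
Proof.
move=> pq; apply/eqP; rewrite -subr_eq0; apply/eqP; apply: mpoly_eq0_eval => v.
by rewrite mevalB pq subrr.
Qed.

Lemma subst_comp (k m n : nat) (g : 'I_k -> {mpoly F[m]}) (f : 'I_m -> {mpoly F[n]}) p :
  subst (fun l => subst f (g l)) p = subst f (subst g p).
Proof.
apply: mpoly_ext => v; rewrite !meval_subst; apply: meval_eq => l.
exact: meval_subst.
Qed.

Lemma mderiv_subst (k m : nat) (g : 'I_k -> {mpoly F[m]}) p i :
  (subst g p)^`M(i) = \sum_l subst g p^`M(l) * (g l)^`M(i).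
Proof.
by apply: (mmap_derivation (iota := @mpolyC m F) (delta := mderiv i));
  [exact: mderivM | exact: mderivC].
Qed.

Definition jac (k m : nat) (g : 'I_k -> {mpoly F[m]}) (a : 'I_m -> F) : 'M[F]_(m, k) :=
  \matrix_(i, l) (g l)^`M(i).@[a].

Lemma jac_subst (k m n : nat) (g : 'I_k -> {mpoly F[m]}) (p : 'I_n -> {mpoly F[k]}) a :
  jac (fun j => subst g (p j)) a = jac g a *m jac p (fun l => (g l).@[a]).
Proof.
apply/matrixP => i j; rewrite !mxE mderiv_subst raddf_sum /=.
apply: eq_bigr => l _; rewrite !mxE mevalM meval_subst mulrC.
by [].
Qed.

Definition indep_on (T : Type) (S : T -> Prop) (k : nat) (g : 'I_k -> T -> F) : Prop :=
  forall P : {mpoly F[k]}, (forall x, S x -> P.@[fun l => g l x] = 0) -> P = 0.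

Definition algindep (k m : nat) (g : 'I_k -> {mpoly F[m]}) : Prop :=
  forall P, subst g P = 0 -> P = 0.

Lemma msizeD_leq (n B : nat) (p q : {mpoly F[n]}) :
  (msize p <= B)%N -> (msize q <= B)%N -> (msize (p + q) <= B)%N.
Proof. by move=> pB qB; apply: leq_trans (msizeD_le _ _) _; rewrite geq_max pB. Qed.

Lemma msizeM_leq (n d e : nat) (p q : {mpoly F[n]}) :
  (msize p <= d.+1)%N -> (msize q <= e.+1)%N -> (msize (p * q) <= (d + e).+1)%N.
Proof.
have [->|np] := eqVneq p 0; first by rewrite mul0r msize0.
have [->|nq] := eqVneq q 0; first by rewrite mulr0 msize0.
by rewrite msizeM // => pd qe; move: (msize p) (msize q) pd qe; lia.
Qed.

(** Division by ['X_i]. The bound on the quotient [P1] is what lets inductions and minimal relations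
    pass to it. *)
Lemma mpoly_split (k : nat) (i : 'I_k.+1) (P : {mpoly F[k.+1]}) :
  exists P0 : {mpoly F[k]}, exists2 P1 : {mpoly F[k.+1]},
    P = subst (fun l => 'X_(lift i l)) P0 + 'X_i * P1 & (msize P1 <= (msize P).-1)%N.
Proof.
set B := (msize P).-1.
pose Q (p : {mpoly F[k.+1]}) := exists P0 : {mpoly F[k]},
  exists2 P1 : {mpoly F[k.+1]},
    p = subst (fun l => 'X_(lift i l)) P0 + 'X_i * P1 & (msize P1 <= B)%N.
rewrite -/(Q P) [P]mpolyE big_seq; elim/big_ind: _ => [|p q|m mP].
- by exists 0; exists 0; rewrite ?msize0 // /subst mmap0 mulr0 addr0.
- move=> [p0 [p1 -> p1B]] [q0 [q1 -> q1B]]; exists (p0 + q0); exists (p1 + q1).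
    by rewrite /subst mmapD mulrDr; ring.
  exact: msizeD_leq.
have mB : (mdeg m <= B)%N.
  by have := msize_mdeg_lt mP; rewrite /B; case: (msize P).
have [mi0|mi] := posnP (m i).
  exists (P@_m *: 'X_[[multinom m (lift i l) | l < k]]); exists 0; last by rewrite msize0.
  rewrite mulr0 addr0; apply: mpoly_ext => v; rewrite meval_subst !mevalZ !mevalX.
  congr (_ * _); rewrite (bigD1_ord i) //= mi0 expr0 mul1r.
  by apply: eq_bigr => l _; rewrite mevalXU mnmE.
exists 0; exists (P@_m *: 'X_[m - U_(i)]).
  rewrite /subst mmap0 add0r -scalerAr -mpolyXD addmC submK //.
  by rewrite lep1mP -lt0n.
apply: leq_trans (msizeZ_le _ _) _; rewrite msizeX.
have /(congr1 mdeg) : (m - U_(i) + U_(i))%MM = m by rewrite submK // lep1mP -lt0n.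
by rewrite mdegD mdeg1 addn1 => ->.
Qed.

(** Linear algebra on monomials: those with exponents below [s] in [k] variables go to polynomials
    with exponents below [B] in [m] variables, and there are more of the former than of the
    latter. *)
Lemma algdep_count (k m : nat) (g : 'I_k -> {mpoly F[m]}) :
  (m < k)%N -> exists2 P, P != 0 & subst g P = 0.
Proof.
move=> ltmk.
pose D := (\max_l msize (g l))%N.
(* As [B] is at most [(k * D + 1) * s], taking [s] larger than [(k * D + 1) ^ m] gives
   [B ^ m < s ^ m.+1], which is at most [s ^ k]. *)
pose s := ((k * D + 1) ^ m + 1)%N; pose B := (k * (s * D)).+1.
pose T1 := {ffun 'I_k -> 'I_s}; pose T2 := {ffun 'I_m -> 'I_B}.
pose mon1 (f : T1) := [multinom f l : nat | l < k].
pose mon2 (f : T2) := [multinom f l : nat | l < m].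
pose M := \matrix_(i < #|T1|, j < #|T2|)
  (subst g 'X_[mon1 (enum_val i)])@_(mon2 (enum_val j)).
have s0 : (0 < s)%N by rewrite /s addn1.
have lt21 : (#|T2| < #|T1|)%N.
  rewrite !card_ffun !card_ord.
  apply: (@leq_ltn_trans ((k * D + 1) ^ m * s ^ m)%N).
    rewrite -expnMn; have [->//|m0] := posnP m; rewrite leq_exp2r //.
    by rewrite /B mulnDl mul1n -mulnA (mulnC D) -addn1 leq_add2l.
  apply: (@leq_trans (s ^ m.+1)%N); last by rewrite leq_exp2l // /s !addn1 ltnS expn_gt0.
  by rewrite expnS ltn_pmul2r ?expn_gt0 ?s0 // /s [X in (_ < X)%N]addn1.
have kerM : kermx M != 0.
  rewrite -mxrank_eq0 mxrank_ker subn_eq0 -ltnNge.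
  exact: leq_ltn_trans (rank_leq_col M) lt21.
pose u := nz_row (kermx M).
have u0 : u != 0 by rewrite nz_row_eq0.
have uM : u *m M = 0 by apply/sub_kermxP; exact: nz_row_sub.
have mon1_inj : injective mon1.
  move=> f f' /mnmP ff'; apply/ffunP => l; apply: val_inj.
  by have := ff' l; rewrite !mnmE.
exists (\sum_i u 0 i *: 'X_[mon1 (enum_val i)]).
  apply: contraNneq u0 => P0; apply/eqP/rowP => i; rewrite mxE.
  have := congr1 (mcoeff (mon1 (enum_val i))) P0.
  rewrite mcoeff0 raddf_sum (bigD1 i) //= big1 ?addr0.
    by rewrite mcoeffZ mcoeffX eqxx mulr1.
  move=> j nji; rewrite mcoeffZ mcoeffX (_ : _ == _ = false) ?mulr0 //.
  by apply: contraNF nji => /eqP/mon1_inj/enum_val_inj ->.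
apply/mpolyP => mm; rewrite mcoeff0 /subst (raddf_sum (mmap _ _)) (raddf_sum (mcoeff mm)) /=.
under eq_bigr do rewrite mmapZ mul_mpolyC mcoeffZ.
have [mmB|] := boolP [forall l, mm l < B]%N.
  pose f2 : T2 := [ffun l => inord (mm l)].
  have Ef2 : mon2 f2 = mm.
    apply/mnmP => l; rewrite mnmE ffunE inordK //.
    exact: (forallP mmB).
  have := congr1 (fun A : 'rV_ _ => A 0 (enum_rank f2)) uM.
  rewrite !mxE => E0; rewrite -[RHS]E0.
  apply: eq_bigr => i _.
  by rewrite mxE enum_rankK Ef2.
rewrite negb_forall => /existsP[l]; rewrite -leqNgt => Bmm.
apply: big1 => i _; rewrite [_@__]memN_msupp_eq0 ?mulr0 //.
apply: msize_mdeg_ge; apply: leq_trans (leq_trans Bmm _); last first.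
  by rewrite mdegE (bigD1 l) //= leq_addr.
rewrite mmapX /mmap1 /B.
have -> : (k * (s * D) = \sum_(l < k) (s * D))%N.
  by rewrite sum_nat_const card_ord.
elim/big_rec2: _ => [|j d p _ pd]; first by rewrite msize1.
apply: (@leq_trans (s * D + d).+1); last by [].
apply: msizeM_leq => //.
have gD : (msize (g j) <= D.+1)%N.
  by apply: leqW; rewrite /D (leq_bigmax j).
rewrite mnmE; apply: (@leq_trans (enum_val i j * D).+1); last first.
  by rewrite ltnS leq_mul2r (ltnW (ltn_ord _)) orbT.
elim: (enum_val i j : nat) => [|e IHe]; first by rewrite msize1.
by rewrite exprS mulSn; apply: msizeM_leq.
Qed.

Lemma algindep_leq (k m : nat) (g : 'I_k -> {mpoly F[m]}) :
  algindep g -> (k <= m)%N.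
Proof.
move=> ig; rewrite leqNgt; apply/negP => /(algdep_count g)[P P0 /ig P1].
by rewrite P1 eqxx in P0.
Qed.

(** Minimality is with respect to [msize], which differentiation and division by a variable lower: a
    derivative or quotient of [P] that is again a relation must vanish. *)
Lemma minimal_relation (k m : nat) (g : 'I_k -> {mpoly F[m]}) :
  ~ algindep g ->
  exists P, [/\ P != 0, subst g P = 0 &
    forall Q, (msize Q < msize P)%N -> subst g Q = 0 -> Q = 0].
Proof.
move=> nalg.
have ex : exists s, `[<exists P, [/\ P != 0, subst g P = 0 & msize P = s]>].
  apply: contrapT => H; apply: nalg => P P0; apply/eqP; apply: contraT => nP.
  by case: H; exists (msize P); apply/asboolP; exists P.
case: (ex_minnP ex) => s /asboolP[P [nP P0 sP]] smin; exists P; split=> // Q.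
rewrite sP => sQ Q0; apply/eqP; apply: contraT => nQ.
have := smin (msize Q) (introT (asboolP _) _); rewrite leqNgt sQ.
by apply; exists Q.
Qed.

(* A minimal relation [P] would give the nontrivial syzygy [(dP/dX_l)(g)]
   of the rows of the Jacobian. *)
Lemma jac_algindep (k m : nat) (g : 'I_k -> {mpoly F[m]}) a
    (A : 'M[F]_(k, m)) :
  A *m jac g a = 1%:M -> algindep g.
Proof.
move=> AJ; apply: contrapT => /minimal_relation[P [nP P0 Pmin]].
pose J : 'M[{mpoly F[m]}]_(k, k) := map_mx (@mpolyC m F) A *m
  \matrix_(i, l) (g l)^`M(i).
(* The determinant takes the value [1] at [a], so it is a nonzero polynomial, and multiplying by the
   adjugate replaces inverting [J]. *)
have detJ : \det J != 0.
  apply/eqP => /(congr1 (meval a)); rewrite meval0 -det_map_mx.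
  have -> : map_mx (meval a) J = 1%:M.
    rewrite -AJ /J map_mxM -map_mx_comp; congr (_ *m _).
      by apply/matrixP => i j; rewrite !mxE /= mevalC.
    by apply/matrixP => i j; rewrite !mxE.
  by rewrite det1 => /eqP; rewrite oner_eq0.
pose c : 'cV_k := \col_l subst g P^`M(l).
have Jc : J *m c = 0.
  rewrite /J -mulmxA; set Mc := _ *m c; suff -> : Mc = 0 by rewrite mulmx0.
  apply/colP => i; rewrite !mxE.
  have := congr1 (mderiv i) P0; rewrite mderiv_subst mderiv0 => e0; rewrite -[RHS]e0.
  by apply: eq_bigr => l _; rewrite !mxE mulrC.
have c0 l : subst g P^`M(l) = 0.
  have : \adj J *m (J *m c) = 0 by rewrite Jc mulmx0.
  rewrite mulmxA mul_adj_mx mul_scalar_mx => /colP/(_ l); rewrite !mxE => /eqP.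
  by rewrite mulf_eq0 (negPf detJ) => /eqP.
have dP0 l : P^`M(l) = 0.
  have [P1|P1] := leqP (msize P) 1%N; first by rewrite (msize1_polyC P1) mderivC.
  apply: Pmin => //; apply: leq_ltn_trans (msize_mderiv P l) _.
  by rewrite prednK // ltnW.
move: nP P0; rewrite (mderiv_eq0_const dP0) /subst mmapC => nP /eqP.
by rewrite mpolyC_eq0 => /eqP E; rewrite E mpolyC0 eqxx in nP.
Qed.

Definition extend_var (k m : nat) (g : 'I_k -> {mpoly F[m]}) (i : 'I_m) (l : 'I_k.+1) :
    {mpoly F[m]} :=
  if unlift ord_max l is Some l' then g l' else 'X_i.

Lemma meval_split (k : nat) (i : 'I_k.+1) (P0 : {mpoly F[k]}) (P1 : {mpoly F[k.+1]}) v :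
  (subst (fun l => 'X_(lift i l)) P0 + 'X_i * P1).@[v] =
  P0.@[fun l => v (lift i l)] + v i * P1.@[v].
Proof.
rewrite mevalD mevalM mevalXU meval_subst; congr (_ + _).
by apply: meval_eq => l; rewrite mevalXU.
Qed.

(* Char 0: a polynomial whose derivative in one variable vanishes does not
   involve that variable. *)
Lemma mderiv_eq0_drop (k : nat) (i : 'I_k.+1) (P : {mpoly F[k.+1]}) :
  P^`M(i) = 0 -> exists P0 : {mpoly F[k]}, P = subst (fun l => 'X_(lift i l)) P0.
Proof.
have [B] := ubnP (msize P); elim: B P => // B IH P sP dP.
have [P0 [P1 EP sP1]] := mpoly_split i P; exists P0.
suff P10 : P1 = 0 by rewrite EP P10 mulr0 addr0.
have d0 : (subst (fun l => 'X_(lift i l)) P0)^`M(i) = 0.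
  rewrite mderiv_subst big1 // => l _; rewrite mderivX mnm1E eq_sym.
  by rewrite (negPf (neq_lift _ _)) scale0r mulr0.
have dX : ('X_i)^`M(i) = 1 :> {mpoly F[k.+1]}.
  rewrite mderivX mnm1E eqxx scale1r -mpolyX0; congr 'X_[_].
  by apply/mnmP => j; rewrite mnmBE mnm0E subnn.
have e : P1 + 'X_i * P1^`M(i) = 0.
  by move: dP; rewrite {1}EP mderivD d0 add0r mderivM dX mul1r.
have [//|nP1] := eqVneq P1 0.
have c0 mm : P1@_mm *+ (mm i).+1 = 0.
  have := congr1 (mcoeff mm) e; rewrite mcoeffD mcoeff0.
  have [mi0|mi] := posnP (mm i).
    rewrite ['X_i * _]mulrC.
    rewrite (_ : (P1^`M(i) * 'X_i)@_mm = 0) ?addr0 ?mi0 //.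
    rewrite mcoeffMr big1 // => j /eqP Ej; rewrite mcoeffX.
    case: eqP => [Ej1|]; last by rewrite mulr0.
    have := congr1 (fun m0 : 'X_{1..k.+1} => m0 i) Ej; rewrite mnmDE mi0 -Ej1.
    by rewrite mnm1E eqxx ?addn1 ?add1n.
  have Em : mm = (mm - U_(i) + U_(i))%MM by rewrite submK // lep1mP -lt0n.
  suff -> : ('X_i * P1^`M(i))@_mm = P1@_mm *+ mm i by rewrite -mulrS.
  rewrite mulrC [X in _@_X]Em addmC mcoeffMX mcoeff_mderiv -Em.
  by rewrite mnmBE mnm1E eqxx subn1 prednK.
apply/mpolyP => mm; rewrite mcoeff0; apply/eqP.
by have /eqP := c0 mm; rewrite mulrn_eq0.
Qed.

(** Converse of [jac_algindep] at a general point, by induction on [m - k]. If a variable can be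
    adjoined to [g] independently, the larger Jacobian settles the smaller one. Otherwise each
    ['X_i] is algebraic over [g], and differentiating its minimal relation puts the [i]-th unit
    vector into the row space of the transposed Jacobian; its rank is then [m], which forces
    [k = m]. *)
Theorem algindep_jac (k m : nat) (g : 'I_k -> {mpoly F[m]}) :
  algindep g -> exists2 D, D != 0 &
    forall a, D.@[a] != 0 -> row_free (jac g a)^T.
Proof.
have [d] := ubnP (m - k); elim: d k g => // d IH k g md ig.
have [[i ii]|noext] := pselect (exists i, algindep (extend_var g i)).
  have km : (k < m)%N by have := algindep_leq ii.
  have [D nD HD] : exists2 D, D != 0 &
      forall a, D.@[a] != 0 -> row_free (jac (extend_var g i) a)^T.
    by apply: IH ii; move: md km; lia.
  exists D => // a /HD; rewrite -!kermx_eq0 => /eqP ker0.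
  apply/rowV0P => u /sub_kermxP uJ.
  pose w := \row_l (if unlift ord_max l is Some l' then u 0 l' else 0) : 'rV_k.+1.
  have : (w <= kermx (jac (extend_var g i) a)^T)%MS.
    apply/sub_kermxP; apply/rowP => j; move/rowP/(_ j): uJ; rewrite !mxE => e0; rewrite -[RHS]e0.
    rewrite (bigD1_ord ord_max) //= !mxE unlift_none mul0r add0r.
    by apply: eq_bigr => l _; rewrite !mxE /extend_var liftK.
  rewrite ker0 submx0 => /eqP/rowP w0; apply/rowP => l.
  by have := w0 (lift ord_max l); rewrite !mxE liftK.
have ex i : exists2 D : {mpoly F[m]}, D != 0 & forall a, D.@[a] != 0 ->
    ((delta_mx 0 i : 'rV[F]_m) <= (jac g a)^T)%MS.
  have /minimal_relation[P [nP P0 Pmin]] : ~ algindep (extend_var g i).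
    by move=> H; apply: noext; exists i.
  (* If this vanished, minimality would make the derivative itself zero; then [P] would not involve
     the adjoined variable and would be a relation on [g] alone. *)
  exists (subst (extend_var g i) P^`M(ord_max)).
    apply: contraNneq nP => dP0; have dP : P^`M(ord_max) = 0.
      have [P1|P1] := leqP (msize P) 1%N.
        by rewrite (msize1_polyC P1) mderivC.
      apply: Pmin => //; apply: leq_ltn_trans (msize_mderiv _ _) _.
      by rewrite prednK // ltnW.
    have [Q EQ] := mderiv_eq0_drop dP; rewrite EQ.
    suff -> : Q = 0 by rewrite /subst mmap0.
    apply: ig; rewrite -P0 EQ; apply: mpoly_ext => v; rewrite !meval_subst.
    by apply: meval_eq => l; rewrite mevalXU /extend_var liftK.
  move=> a; set D := subst _ _ => nD.
  pose c : 'rV_k := \row_l - ((subst (extend_var g i) P^`M(lift ord_max l)).@[a] / D.@[a]).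
  apply/submxP; exists c; apply/rowP => j; rewrite !mxE.
  have := congr1 (fun q => q^`M(j).@[a]) P0; rewrite mderiv0 meval0.
  rewrite mderiv_subst (bigD1_ord ord_max) //= mevalD mevalM -/D [X in _ + X]raddf_sum /=.
  have -> : extend_var g i ord_max = 'X_i by rewrite /extend_var unlift_none.
  move=> e.
  rewrite -[LHS]/((j == i)%:R) eq_sym.
  have Ej : (i == j)%:R = ('X_i : {mpoly F[m]})^`M(j).@[a].
    by rewrite mderivU rmorph_nat.
  rewrite Ej; apply: (mulfI nD); move/eqP: e; rewrite addr_eq0 => /eqP ->.
  rewrite mulr_sumr -sumrN; apply: eq_bigr => l _; rewrite !mxE.
  have -> : extend_var g i (lift ord_max l) = g l by rewrite /extend_var liftK.
  rewrite mevalM.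
  by field.
pose D i := s2val (cid2 (ex i)).
have nD i : D i != 0 by rewrite /D; case: cid2.
have HD i a : (D i).@[a] != 0 -> ((delta_mx 0 i : 'rV[F]_m) <= (jac g a)^T)%MS.
  by rewrite /D; case: cid2 => D' /= _; apply.
exists (\prod_i D i) => [|a].
  by apply/prodf_neq0 => i _; exact: nD.
rewrite rmorph_prod /= => /prodf_neq0 Da.
have full : row_full (jac g a)^T.
  rewrite -sub1mx; apply/row_subP => i; rewrite row1.
  by apply: HD; apply: Da.
have := algindep_leq ig; rewrite /row_free => km.
move: full; rewrite /row_full => /eqP rk; rewrite eqn_leq rank_leq_row /=.
by rewrite rk.
Qed.

End AlgebraicIndependence.

(** * Cones and dimension *)

Section Cones.
Variables (F : numFieldType) (n : nat).
Implicit Types (C D : set 'rV[F]_n) (f g : {mpoly F[n]}) (p : proj F n) (X W : set (proj F n)).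

Definition vanish_on f C : Prop := forall v, C v -> f.@[v 0] = 0.

(* The affine Zariski closure. *)
Definition acl C : set 'rV[F]_n := [set v | forall f, vanish_on f C -> f.@[v 0] = 0].

Lemma sub_acl C : C `<=` acl C.
Proof. by move=> v Cv f; apply. Qed.

Lemma acl_sub C D : C `<=` acl D -> acl C `<=` acl D.
Proof. by move=> CD v Cv f fD; apply: Cv => w /CD; apply. Qed.

Lemma acl_mono C D : C `<=` D -> acl C `<=` acl D.
Proof. by move=> CD; apply: acl_sub => v /CD; exact: sub_acl. Qed.

Definition scaling C : Prop := forall c v, C v -> C (c *: v).

Lemma poly_eq0_nz (q : {poly F}) : (forall t, t != 0 -> q.[t] = 0) -> q = 0.
Proof.
move=> q0; have : q * 'X = 0.
  apply: poly_eq0_eval => t; rewrite hornerM hornerX.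
  by have [->|/q0 ->] := eqVneq t 0; rewrite ?mulr0 ?mul0r.
by move/eqP; rewrite mulf_eq0 polyX_eq0 orbF => /eqP.
Qed.

Lemma meval_scale f c (v : 'rV[F]_n) :
  f.@[(c *: v) 0] = (line_restrict (fun=> 0) (v 0) f).[c].
Proof.
by rewrite horner_line_restrict; apply: meval_eq => j; rewrite mxE add0r.
Qed.

Lemma meval_dhomog f d c (v : 'I_n -> F) :
  f \is d.-homog -> f.@[fun j => c * v j] = c ^+ d * f.@[v].
Proof.
move/dhomogP => fd; rewrite !mevalE mulr_sumr big_seq [RHS]big_seq.
apply: eq_bigr => m /fd md; rewrite mulrCA; congr (_ * _).
have -> : c ^+ d = \prod_(i < n) c ^+ m i.
  by rewrite prodrXr -md /= mdegE.
by rewrite -big_split /=; apply: eq_bigr => i _; rewrite exprMn.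
Qed.

(** On the ray through [v] the homogeneous parts of [f] are the coefficients of a polynomial in the
    scale that has every scalar as a root. *)
Lemma vanish_pihomog f C d : scaling C -> vanish_on f C ->
  vanish_on (pihomog mdeg d f) C.
Proof.
move=> sC f0 v Cv; set k := (maxn d.+1 (msize f)).
pose q : {poly F} := \poly_(e < k) (pihomog mdeg e f).@[v 0].
have q0 : q = 0.
  apply: poly_eq0_eval => t; rewrite -[RHS](f0 _ (sC t v Cv)).
  rewrite [in RHS](pihomog_partitionE (mf := mdeg) (k := k) (p := f)) ?leq_maxr //.
  rewrite horner_poly raddf_sum /=; apply: eq_bigr => e _.
  rewrite mulrC -(meval_dhomog _ _ (pihomogP _ _ _)).
  by apply: meval_eq => j; rewrite mxE.
have := congr1 (fun r : {poly F} => r`_d) q0.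
by rewrite coef_poly coef0 leq_maxl.
Qed.

Definition lines_of C : set (proj F n) :=
  [set p | exists2 v, C v & val p = <[v]>%VS].

Definition pz C : set (proj F n) := zariski_closure (lines_of C).

Lemma zariski_closureE (A : set (proj F n)) :
  zariski_closure A = zero_locus [set f | homogeneous_form f /\
                                   forall p, A p -> vanishes f p].
Proof.
apply/seteqP; split=> [p Ap f [hf fA]|p zp Z [[S hS ->] AZ] f Sf].
  apply: (Ap (zero_locus [set f])) => //; split.
    by exists [set f] => // g ->.
  by move=> q Aq g ->; apply: fA.
by apply: zp; split=> [|q Aq]; [exact: hS | exact: AZ].
Qed.

Lemma zariski_closure_closed (A : set (proj F n)) : zariski_closed (zariski_closure A).
Proof.
by rewrite zariski_closureE; exists [set f | homogeneous_form f /\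
  forall p, A p -> vanishes f p] => // f [].
Qed.

Lemma closed_pz C : zariski_closed (pz C).
Proof. exact: zariski_closure_closed. Qed.

Lemma proj_gen p : exists2 v, v != 0 & val p = <[v]>%VS.
Proof.
have /eqP d1 := valP p; exists (vpick (val p)).
  by rewrite vpick0 -dimv_eq0 d1.
apply/esym/eqP; rewrite eqEdim -memvE memv_pick d1 dim_vline.
by rewrite vpick0 -dimv_eq0 d1.
Qed.

Lemma line_point (v : 'rV[F]_n) : v != 0 -> exists p : proj F n, val p = <[v]>%VS.
Proof.
move=> nv; have d1 : \dim <[v]> == 1%N by rewrite dim_vline nv.
by exists (exist (fun q : {vspace 'rV[F]_n} => \dim q == 1%N) _ d1).
Qed.

(** Passage between projective and affine closures through homogeneous parts. The origin is not a
    point of the projective space; the value of a form there is recovered along the ray through a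
    nonzero element of [C]. *)
Lemma pzP C p : scaling C -> (exists2 v, C v & v != 0) ->
  pz C p <-> (forall v, v \in val p -> acl C v).
Proof.
move=> sC [w Cw nw]; rewrite /pz zariski_closureE; split=> [zp v vp f f0|ap f [[d fd] fC] v vp].
  have fd d : (pihomog mdeg d f).@[v 0] = 0.
    apply: zp vp; split=> [|q [u Cu Eq] x].
      by exists d; exact: pihomogP.
    rewrite Eq => /vlineP[c ->].
    exact: (@vanish_pihomog f C d sC f0 _ (sC _ _ Cu)).
  rewrite [f](pihomog_partitionE (mf := mdeg) (leqnn _)) raddf_sum /=.
  by rewrite big1.
apply: (ap v vp) => u Cu.
have fnz (x : 'rV[F]_n) : C x -> x != 0 -> f.@[x 0] = 0.
  move=> Cx /line_point[q Eq]; apply: (fC q); first by exists x.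
  by rewrite Eq memv_line.
have [->|] := eqVneq u 0; last exact: fnz.
rewrite -(scale0r w) meval_scale.
suff -> : line_restrict (fun=> 0) (w 0) f = 0 by rewrite horner0.
apply: poly_eq0_nz => t nt; rewrite -meval_scale fnz //; first exact: sC.
by rewrite scaler_eq0 negb_or nt.
Qed.

Definition cone X : set 'rV[F]_n := [set v | exists2 p, X p & v \in val p].

Lemma scaling_line p : scaling [set v | v \in val p].
Proof. by move=> c v /= vp; rewrite memvZ. Qed.

Lemma closed_vanish f : zariski_closed [set p | vanishes f p].
Proof.
exists [set pihomog mdeg d f | d in setT].
  by move=> _ [d _ <-]; exists d; exact: pihomogP.
apply/seteqP; split=> [p fp _ [d _ <-] v vp|p fp v vp].
  exact: (@vanish_pihomog f _ d (@scaling_line p) fp v vp).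
rewrite [f](pihomog_partitionE (mf := mdeg) (leqnn _)) raddf_sum /= big1 // => d _.
by apply: fp vp; exists (d : nat).
Qed.

(** Primality of the vanishing ideal: on each line one of the two factors vanishes identically, so
    their zero sets cover [W]. *)
Lemma irreducible_prime W f g : irreducible W ->
  (forall v, cone W v -> f.@[v 0] * g.@[v 0] = 0) ->
  vanish_on f (cone W) \/ vanish_on g (cone W).
Proof.
move=> [_ irr] fg.
have [p Wp|Wf|Wg] := irr _ _ (closed_vanish f) (closed_vanish g).
- have [w _ Ep] := proj_gen p.
  have : line_restrict (fun=> 0) (w 0) f * line_restrict (fun=> 0) (w 0) g = 0.
    apply: poly_eq0_eval => t; rewrite hornerM -!meval_scale; apply: fg.
    by exists p => //; rewrite Ep memvZ ?memv_line.
  move/eqP; rewrite mulf_eq0 => /orP[]/eqP z0; [left|right] => v;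
    by rewrite Ep => /vlineP[c ->]; rewrite meval_scale z0 horner0.
- by left => v [p Wp vp]; exact: Wf vp.
- by right => v [p Wp vp]; exact: Wg vp.
Qed.

(** A coordinate that is nonzero at some point of the first member starts the list, and each strict
    inclusion adds a form that vanishes on the smaller set but not on the larger one. In a relation,
    the part free of the new form vanishes by restriction to the smaller set, and primality cancels
    the form from the rest, which leaves a smaller relation. *)
Lemma irreducible_chain_indep X e (W : nat -> set (proj F n)) :
  irreducible_chain X e W ->
  exists g : 'I_e.+1 -> {mpoly F[n]}, indep_on (cone (W e)) (fun l v => (g l).@[v 0]).
Proof.
elim: e => [|e IH] [Wi Wlt].
  have [_ [[p Wp] _] _] := Wi 0%N (leqnn _).
  have [w nw Ep] := proj_gen p.
  have [j nj] : exists j, w 0 j != 0 by apply/rV0Pn.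
  exists (fun=> 'X_j) => P P0; apply: mpoly_ext => v; rewrite meval0.
  rewrite -(P0 ((v ord0 / w 0 j) *: w)).
    apply: meval_eq => l; rewrite mevalXU mxE divfK //; congr v.
    by apply: val_inj; case: l => [[]].
  by exists p => //; rewrite Ep memvZ ?memv_line.
have [|g Hg] := IH.
  by split=> i ie; [apply: Wi; apply: leqW | apply: Wlt; apply: leqW].
have [subW [p W1p nWp]] : W e `<=` W e.+1 /\ exists2 p, W e.+1 p & ~ W e p.
  have /properW sW := Wlt e (leqnn _); split=> //.
  apply: contrapT => H; have [_ nsub] := Wlt e (leqnn _); apply: nsub => p W1p.
  by apply: contrapT => nW; apply: H; exists p.
have [[S hS EW] _ _] := Wi e (leqnSn _).
have [f Sf [v vp fv]] : exists2 f, S f & exists2 v, v \in val p & f.@[v 0] != 0.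
  apply: contrapT => H; apply: nWp; rewrite EW => f Sf v vp; apply/eqP.
  by apply: contraT => fv; case: H; exists f => //; exists v.
have fW : vanish_on f (cone (W e)) by move=> u [q]; rewrite EW => zq uq; exact: zq uq.
pose g' (l : 'I_e.+2) := if unlift ord_max l is Some l' then g l' else f.
have gl l : g' (lift ord_max l) = g l by rewrite /g' liftK.
have gm : g' ord_max = f by rewrite /g' unlift_none.
exists g' => P; have [B] := ubnP (msize P); elim: B P => // B IHB P sP P0.
have [P1 [P2 EP sP2]] := mpoly_split ord_max P.
have P10 : P1 = 0.
  apply: Hg => u Wu; have [q Wq uq] := Wu.
  have := P0 u (ex_intro2 _ _ q (subW _ Wq) uq).
  rewrite EP meval_split gm fW // mul0r addr0 => <-.
  by apply: meval_eq => l; rewrite gl.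
have [->//|nP] := eqVneq P 0.
rewrite EP P10 /subst mmap0 add0r; suff -> : P2 = 0 by rewrite mulr0.
apply: IHB.
  by apply: leq_ltn_trans sP2 _; rewrite prednK ?msize_poly_gt0 // lt0n msize_poly_eq0.
have [_ irrW _] := Wi e.+1 (leqnn _).
have [|f0|] := irreducible_prime (f := f) (g := subst g' P2) irrW.
- move=> u Wu; have := P0 u Wu; rewrite EP P10 /subst mmap0 add0r mevalM mevalXU gm.
  by rewrite -/(subst g' P2) meval_subst.
- by case/eqP: fv; apply: f0; exists p.
- by move=> H u Wu; rewrite -meval_subst; exact: H.
Qed.

Section Parametrized.
Variables (m : nat) (chi : 'I_n -> {mpoly F[m]}).

Definition param_at (a : 'I_m -> F) : 'rV[F]_n := \row_j (chi j).@[a].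

Definition im : set 'rV[F]_n := [set param_at a | a in setT].

Lemma meval_subst_param f a : (subst chi f).@[a] = f.@[param_at a 0].
Proof. by rewrite meval_subst; apply: meval_eq => j; rewrite mxE. Qed.

Lemma subst_eq0_vanish f : subst chi f = 0 -> vanish_on f im.
Proof. by move=> f0 _ [a _ <-]; rewrite -meval_subst_param f0 meval0. Qed.

Lemma im_indep_subst k (g : 'I_k -> {mpoly F[n]}) D :
  D `<=` acl im -> indep_on D (fun l v => (g l).@[v 0]) ->
  algindep (fun l => subst chi (g l)).
Proof.
move=> Dim indg P P0; apply: indg => v /Dim va.
have := va (subst g P); rewrite meval_subst; apply; apply: subst_eq0_vanish.
by rewrite -subst_comp.
Qed.

(** The functions attached to the chain stay independent after composition with [chi], so at some
    parameter their differentials are independent; these factor through [jac chi]. *)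
Lemma chain_leq_rank X r :
  cone X `<=` acl im -> (forall a, (\rank (jac chi a) <= r.+1)%N) ->
  forall e (W : nat -> set (proj F n)), irreducible_chain X e W -> (e <= r)%N.
Proof.
move=> Xim rk e W ch; have [Wi _] := ch.
have [g indg] := irreducible_chain_indep ch.
have sub : cone (W e) `<=` acl im.
  move=> v [p Wp vp]; apply: Xim; exists p => //.
  by have [_ _] := Wi e (leqnn _); apply.
have [D /mpoly_neq0_eval[a Da] /(_ a Da)] := algindep_jac (im_indep_subst sub indg).
rewrite jac_subst trmx_mul /row_free => /eqP rke.
rewrite -ltnS; apply: leq_trans (rk a); rewrite -[X in (_ <= X)%N]mxrank_tr -rke.
exact: mxrankM_maxr.
Qed.

(** The pullback to the parameters lands in a domain: if neither closed set contained the image, two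
    nonzero pullbacks would have product zero. *)
Lemma irreducible_pz_im : scaling im -> (exists2 v, im v & v != 0) ->
  irreducible (pz im).
Proof.
move=> sI nz; split.
  have [v Iv /line_point[p Ep]] := nz; exists p.
  by apply/pzP => // w; rewrite Ep => /vlineP[c ->]; apply: sub_acl; apply: sI.
move=> A B [SA hA EA] [SB hB EB] sub.
have key (S : set {mpoly F[n]}) : ~ (pz im `<=` zero_locus S) ->
    exists2 f, S f & subst chi f <> 0.
  move=> nsub; apply: contrapT => H; apply: nsub => p /(pzP _ sI nz) pI f Sf v /pI.
  apply; apply: subst_eq0_vanish.
  by apply: contrapT => nf; apply: H; exists f.
apply: contrapT => /not_orP[]; rewrite {1}EA {1}EB => /key[f Sf nf] /key[g Sg ng].
suff : subst chi f * subst chi g = 0.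
  by move/eqP; rewrite mulf_eq0 => /orP[]/eqP.
have [w [a0 _ Ew] nw] := nz.
have [j nj] : exists j, w 0 j != 0 by apply/rV0Pn.
(* The factor [chi j] takes care of the parameters with zero image, which define no point of the
   projective space. *)
suff : chi j * (subst chi f * subst chi g) = 0.
  move/eqP; rewrite mulf_eq0 => /orP[/eqP chij|/eqP//].
  by case/eqP: nj; rewrite -Ew mxE chij meval0.
apply: mpoly_ext => a; rewrite meval0 !mevalM !meval_subst_param.
have [->|nja] := eqVneq (chi j).@[a] 0; first by rewrite mul0r.
have na : param_at a != 0 by apply/rV0Pn; exists j; rewrite mxE.
have [p Ep] := line_point na; have ap : param_at a \in val p by rewrite Ep memv_line.
have /sub[] : pz im p.
  by apply/pzP => // v; rewrite Ep => /vlineP[c ->]; apply: sub_acl; apply: sI; exists a.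
- by rewrite EA => /(_ f Sf _ ap) ->; rewrite !(mul0r,mulr0).
- by rewrite EB => /(_ g Sg _ ap) ->; rewrite !(mul0r,mulr0).
Qed.

End Parametrized.

End Cones.

(** * Chains in parametrized cones, and secant cones *)

Section Dimension.
Variables (F : numFieldType) (n : nat).
Implicit Types (C D : set 'rV[F]_n).

Lemma scaling_acl C : scaling C -> scaling (acl C).
Proof.
move=> sC c v Cv f fC.
pose fc : {mpoly F[n]} := subst (fun j => c *: 'X_j) f.
have E w : fc.@[w] = f.@[fun j => c * w j].
  by rewrite meval_subst; apply: meval_eq => j; rewrite mevalZ mevalXU.
have := Cv fc; rewrite E => H.
rewrite (meval_eq (v2 := fun j => c * v 0 j)); last by move=> j; rewrite mxE.
apply: H => w Cw; rewrite E -[RHS](fC _ (sC c _ Cw)).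
by apply: meval_eq => j; rewrite mxE.
Qed.

Lemma acl_nonzero C v : acl C v -> v != 0 -> exists2 w, C w & w != 0.
Proof.
move=> Cv; apply: contraPP => H; apply/negP; rewrite negbK; apply/eqP/rowP => j.
rewrite mxE; have := Cv 'X_j; rewrite mevalXU; apply=> w Cw; rewrite mevalXU.
have [->|nw] := eqVneq w 0; first by rewrite mxE.
by case: H; exists w.
Qed.

Section Flag.
Variables (m : nat) (chi : 'I_n -> {mpoly F[m]}) (a : 'I_m -> F) (A : nat -> 'I_m -> F).

(** The cone over the image of the affine subspace through [a] in the first [i] directions [A s];
    the variable ['X_ord0] is the scale. *)
Definition flag (i : nat) (j : 'I_n) : {mpoly F[i.+1]} :=
  'X_ord0 * subst (fun l => (a l)%:MP + \sum_(s < i) A s l *: 'X_(lift ord0 s)) (chi j).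

Lemma param_at_flag i x :
  param_at (flag i) x =
  x ord0 *: param_at chi (fun l => a l + \sum_(s < i) A s l * x (lift ord0 s)).
Proof.
apply/rowP => j; rewrite !mxE mevalM mevalXU meval_subst; congr (_ * _).
apply: meval_eq => l; rewrite mevalD mevalC raddf_sum /=; congr (_ + _).
by apply: eq_bigr => s _; rewrite mevalZ mevalXU.
Qed.

Lemma scaling_flag i : scaling (im (flag i)).
Proof.
move=> c _ [x _ <-]; exists (fun l => if l == ord0 then c * x l else x l) => //.
by rewrite !param_at_flag scalerA.
Qed.

Lemma im_flagS i : im (flag i) `<=` im (flag i.+1).
Proof.
move=> _ [x _ <-].
exists (fun l => if unlift ord_max l is Some l' then x l' else 0) => //.
rewrite !param_at_flag; symmetry; congr (_ *: param_at chi _).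
  have -> : ord0 = lift ord_max (ord0 : 'I_i.+1) by apply: val_inj.
  by rewrite liftK; congr x; apply: val_inj.
apply: funext => l; rewrite big_ord_recr /=.
have -> : lift ord0 (ord_max : 'I_i.+1) = ord_max by apply: val_inj.
rewrite unlift_none mulr0 addr0; congr (_ + _); apply: eq_bigr => s _.
have -> : lift ord0 (widen_ord (leqnSn i) s) = lift ord_max (lift ord0 s).
  by apply: val_inj; rewrite /= /bump /= leqNgt ltnS (ltn_ord s).
by rewrite liftK.
Qed.

Definition flag_base (i : nat) (l : 'I_i.+1) : F := (l == ord0)%:R.

Lemma jac_flag i (s : 'I_i.+1) j :
  jac (flag i) (@flag_base i) s j =
  if unlift ord0 s is Some s' then \sum_l A s' l * jac chi a l j
  else (chi j).@[a].
Proof.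
have base0 l : a l + \sum_(s0 < i) A s0 l * flag_base (lift ord0 s0) = a l.
  by rewrite big1 ?addr0 // => s0 _; rewrite /flag_base mulr0.
have ev p : (subst (fun l => (a l)%:MP + \sum_(s0 < i) A s0 l *: 'X_(lift ord0 s0)) p).@[@flag_base i]
    = p.@[a].
  rewrite meval_subst; apply: meval_eq => l; rewrite mevalD mevalC raddf_sum /=.
  rewrite -[RHS]base0; congr (_ + _).
  by apply: eq_bigr => s0 _; rewrite mevalZ mevalXU.
rewrite mxE mderivM mevalD !mevalM ev mevalXU {2}/flag_base eqxx mul1r.
rewrite mderivU rmorph_nat.
case: unliftP => [s' ->|->]; last first.
  rewrite eqxx mul1r mderiv_subst raddf_sum /= big1 ?addr0 // => l _.
  rewrite mderivD mderivC add0r raddf_sum /= mevalM [X in _ * X]raddf_sum /= big1 ?mulr0 // => s0 _.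
  by rewrite mderivZ mderivU /= scaler0 meval0.
rewrite (negPf (neq_lift _ _)) !mul0r add0r mderiv_subst raddf_sum /=.
apply: eq_bigr => l _; rewrite mxE mevalM ev mulrC; congr (_ * _).
rewrite mderivD mderivC add0r (raddf_sum (mderiv _)) (raddf_sum (meval _)) /=.
rewrite (bigD1 s') //= big1 ?addr0.
  by rewrite mderivZ mderivU eqxx mevalZ meval1 mulr1.
move=> s0 ns; by rewrite mderivZ mderivU (inj_eq lift_inj) (negPf ns) scaler0 meval0.
Qed.

End Flag.

(** A complement of [u] in the row space of [J] still has rank at least [r], since [u] accounts for
    at most one dimension. *)
Lemma row_free_extend m r (u : 'rV[F]_n) (J : 'M[F]_(m, n)) :
  u != 0 -> (r < \rank J)%N ->
  exists A : 'M[F]_(r, m), row_free (col_mx u (A *m J)).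
Proof.
move=> nu rJ; have ru : \rank u = 1%N by rewrite rank_rV nu.
have rD : (r <= \rank (J :\: u)%MS)%N.
  have := mxrank_cap_compl J u; have := mxrankS (capmxSr J u); rewrite ru.
  by move: rJ; lia.
pose B : 'M_(r, n) := rowsub (widen_ord rD) (row_base (J :\: u)%MS).
have BD : (B <= J :\: u)%MS.
  by rewrite -(eq_row_base (J :\: u)%MS) /B rowsub_sub.
have /submxP[A EB] : (B <= J)%MS := submx_trans BD (diffmxSl _ _).
exists A; rewrite -EB /row_free -addsmxE.
have cap0 : (u :&: B :=: (0 : 'M_n))%MS.
  apply/eqmxP; rewrite sub0mx andbT -(capmx_diff J u) capmxC.
  exact: capmxS.
have := mxrank_sum_cap u B; rewrite cap0 mxrank0 addn0 => ->.
rewrite ru; suff /eqP -> : row_free B by [].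
have rf : row_free (row_base (J :\: u)%MS) by rewrite /row_free eq_row_base.
have -> : B = rowsub (widen_ord rD) 1%:M *m row_base (J :\: u)%MS.
  by rewrite mul_rowsub_mx mul1mx.
rewrite /row_free mxrankMfree //; apply/eqP.
have : row_free (rowsub (widen_ord rD) (1%:M : 'M[F]_(\rank (J :\: u)%MS))).
  apply/row_freeP; exists (rowsub (widen_ord rD) 1%:M)^T.
  apply/matrixP => i j; rewrite !mxE (bigD1 (widen_ord rD i)) //= big1 ?addr0.
    by rewrite !mxE eqxx mul1r eq_sym -!val_eqE /= eq_sym.
  by move=> k nk; rewrite !mxE eq_sym (negPf nk) mul0r.
by rewrite /row_free => /eqP.
Qed.

(** The members are the closures of the cones over the steps of a flag. At the base point the
    Jacobian of step [i.+1] has [i.+2] independent rows, the point itself and [i.+1] tangent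
    directions. That step therefore carries [i.+2] independent functions, too many for the [i.+1]
    variables of step [i], and the inclusion is strict. *)
Lemma exists_chain C m (chi : 'I_n -> {mpoly F[m]}) a r :
  scaling C -> im chi `<=` acl C -> param_at chi a != 0 ->
  (r < \rank (jac chi a))%N ->
  exists W, irreducible_chain (pz C) r W.
Proof.
move=> sC chiC nz rk.
have [A /row_freeP[B MB]] := row_free_extend nz rk.
pose An s l := if insub s is Some s' then A s' l else 0 : F.
pose fl i := flag chi a An i.
have fl_nz i : exists2 v, im (fl i) v & v != 0.
  exists (param_at (fl i) (@flag_base i)); first by exists (@flag_base i).
  rewrite param_at_flag /flag_base eqxx scale1r.
  rewrite (_ : (fun l => _) = a) //; apply: funext => l.
  by rewrite big1 ?addr0 // => s _; rewrite mulr0.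
have fl_irr i : irreducible (pz (im (fl i))).
  by apply: irreducible_pz_im => //; exact: scaling_flag.
have flC i : im (fl i) `<=` acl C.
  move=> _ [x _ <-]; rewrite param_at_flag; apply: scaling_acl => //.
  by apply: chiC; eexists.
have nzC : exists2 w, C w & w != 0.
  by apply: acl_nonzero nz; apply: chiC; exists a.
have pz_sub i : pz (im (fl i)) `<=` pz C.
  move=> p /(pzP _ (@scaling_flag _ chi a An _) (fl_nz i)) pi.
  by apply/pzP => // v /pi; apply: acl_sub.
have pzS i : pz (im (fl i)) `<=` pz (im (fl i.+1)).
  move=> p /(pzP _ (@scaling_flag _ chi a An _) (fl_nz i)) pi.
  apply/(pzP _ (@scaling_flag _ chi a An _) (fl_nz _)) => v /pi.
  exact: (acl_mono (@im_flagS _ chi a An i)).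
exists (fun i => pz (im (fl i))); split=> [i _|i ir].
  by split; [exact: closed_pz | exact: fl_irr | exact: pz_sub].
split=> [|sub]; first exact: pzS.
have ir2 : (i.+2 <= 1 + r)%N by [].
pose y (t : 'I_i.+2) : {mpoly F[n]} := \sum_j B j (widen_ord ir2 t) *: 'X_j.
have dy t j v : (y t)^`M(j).@[v] = B j (widen_ord ir2 t).
  by rewrite mderiv_lin mevalC.
have ind : algindep (fun t => subst (fl i.+1) (y t)).
  apply: (@jac_algindep _ _ _ _ (@flag_base i.+1) 1%:M).
  rewrite mul1mx jac_subst; apply/matrixP => s t.
  rewrite !mxE; under eq_bigr do rewrite [jac y _ _ _]mxE dy.
  have := congr1 (fun M : 'M_(1 + r) => M (widen_ord ir2 s) (widen_ord ir2 t)) MB.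
  rewrite !mxE => E; transitivity ((widen_ord ir2 s == widen_ord ir2 t)%:R : F); last by [].
  rewrite -E; apply: eq_bigr => j _; congr (_ * _); rewrite jac_flag.
  case: unliftP => [s' Es|Es]; last first.
    have -> : widen_ord ir2 s = lshift r ord0 by apply: val_inj; rewrite Es.
    by rewrite col_mxEu mxE.
  have s'r : (s' < r)%N by apply: leq_trans (ltn_ord s') _.
  have -> : widen_ord ir2 s = rshift 1 (Ordinal s'r).
    by apply: val_inj; rewrite Es.
  rewrite col_mxEd mxE; apply: eq_bigr => l _; rewrite /An insubT.
  by congr (A _ _ * _); apply: val_inj.
have [P nP P0] := algdep_count (fun t => subst (fl i) (y t)) (ltnSn i.+1).
case/eqP: nP; apply: ind; apply: mpoly_ext => x; rewrite meval0.
have Py0 : vanish_on (subst y P) (im (fl i)).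
  by apply: subst_eq0_vanish; rewrite -subst_comp.
have : acl (im (fl i)) (param_at (fl i.+1) x).
  have [->|npx] := eqVneq (param_at (fl i.+1) x) 0.
    rewrite -(scale0r (param_at (fl i) (@flag_base i))); apply: sub_acl.
    by apply: scaling_flag; exists (@flag_base i).
  have [p Ep] := line_point npx.
  have /sub/(pzP _ (@scaling_flag _ chi a An _) (fl_nz i)) : pz (im (fl i.+1)) p.
    apply/(pzP _ (@scaling_flag _ chi a An _) (fl_nz _)) => v; rewrite Ep => /vlineP[c ->].
    by apply: sub_acl; apply: scaling_flag; exists x.
  by apply; rewrite Ep memv_line.
by move=> /(_ _ Py0); rewrite subst_comp => <-; rewrite meval_subst_param.
Qed.

(** Two parametrizations, because the bounds have different sources: [chi1] stays inside the closed
    cone and bounds from below, the closed image of [chi2] contains the cone and bounds from above.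
    In the defective cases [chi2] is an orbit map. *)
Theorem has_dim_pz C m1 (chi1 : 'I_n -> {mpoly F[m1]}) a m2 (chi2 : 'I_n -> {mpoly F[m2]}) r :
  scaling C -> im chi1 `<=` acl C -> param_at chi1 a != 0 ->
  (r < \rank (jac chi1 a))%N ->
  C `<=` acl (im chi2) -> (forall b, (\rank (jac chi2 b) <= r.+1)%N) ->
  has_dim (pz C) r.
Proof.
move=> sC chi1C nz rk1 Cchi2 rk2; split; first exact: exists_chain rk1.
apply: chain_leq_rank rk2 => v [p /pzP pC vp]; apply: acl_sub Cchi2 _ _.
apply: pC => //; apply: acl_nonzero nz; apply: chi1C; by exists a.
Qed.

Lemma affine_subst m (M : 'M[F]_(n, m)) (u : 'rV[F]_m) (f : {mpoly F[m]}) :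
  {g : {mpoly F[n]} | forall v : 'rV[F]_n, g.@[v 0] = f.@[(v *m M + u) 0]}.
Proof.
exists (subst (fun l => \sum_j M j l *: 'X_j + (u 0 l)%:MP) f) => v.
rewrite meval_subst; apply: meval_eq => l; rewrite mevalD mevalC !mxE raddf_sum /=.
by congr (_ + _); apply: eq_bigr => j _; rewrite mevalZ mevalXU mulrC.
Qed.

Definition sum_set m k (E : 'I_k -> 'M[F]_(n, m)) C : set 'rV[F]_m :=
  [set v | exists2 w : 'I_k -> 'rV[F]_n, (forall i, C (w i)) & v = \sum_i w i *m E i].

(** The summands pass to the closure one at a time: with the others fixed, the sum is an affine
    function of a single summand. *)
Lemma acl_sum m k (E : 'I_k -> 'M[F]_(n, m)) C (w : 'I_k -> 'rV[F]_n) :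
  (forall i, acl C (w i)) -> acl (sum_set E C) (\sum_i w i *m E i).
Proof.
suff H (j : nat) : (j <= k)%N -> forall w : 'I_k -> 'rV[F]_n,
    (forall i : 'I_k, if (i < j)%N then acl C (w i) else C (w i)) ->
    acl (sum_set E C) (\sum_i w i *m E i).
  by move=> Cw; apply: (H k) => // i; rewrite ltn_ord.
elim: j => [_|j IH jk] {}w Cw; first by apply: sub_acl; exists w.
move=> f fS; pose jo := Ordinal jk; rewrite (bigD1 jo) //=.
set u := \sum_(i | _) _; have [fu E_fu] := affine_subst (E jo) u f.
have := Cw jo; rewrite /= ltnS leqnn => /(_ fu); rewrite E_fu; apply=> v Cv.
rewrite E_fu; pose w' i := if i == jo then v else w i.
have -> : v *m E jo + u = \sum_i w' i *m E i.
  rewrite (bigD1 jo) //= /w' eqxx; congr (_ + _).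
  by apply: eq_bigr => i /negPf ->.
apply: IH fS => [|i]; first exact: ltnW.
rewrite /w'; case: eqP => [->|/eqP nij]; first by rewrite ltnn.
have := Cw i; rewrite ltnS leq_eqVlt.
by have -> : (i == j :> nat) = false by apply: contraNF nij => /eqP ij; apply/eqP/val_inj.
Qed.

Lemma secant_pz C k : (0 < k)%N -> scaling C -> (exists2 v, C v & v != 0) ->
  secant_variety k (pz C) =
  pz [set v | exists2 w : 'I_k -> 'rV[F]_n, (forall i, C (w i)) & v = \sum_i w i].
Proof.
move=> k0 sC nzC; set S := [set v | _].
have sS : scaling S.
  move=> c v [w Cw ->]; exists (fun i => c *: w i) => [i|]; first exact: sC.
  by rewrite scaler_sumr.
have C0 : C 0 by have [v Cv _] := nzC; rewrite -(scale0r v); exact: sC.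
have CS : C `<=` S.
  move=> v Cv; exists (fun i : 'I_k => if i == Ordinal k0 then v else 0) => [i|].
    by case: ifP.
  by rewrite (bigD1 (Ordinal k0)) //= big1 ?addr0 // => i /negPf ->.
have nzS : exists2 v, S v & v != 0 by have [v Cv nv] := nzC; exists v => //; exact: CS.
have ES : S = sum_set (fun _ : 'I_k => 1%:M) C.
  apply: funext => v; apply: propext; split=> -[w Cw ->]; exists w => //;
    by apply: eq_bigr => i _; rewrite mulmx1.
have aclS (w : 'I_k -> 'rV[F]_n) : (forall i, acl C (w i)) -> acl S (\sum_i w i).
  move=> Cw; have := acl_sum (E := fun _ : 'I_k => 1%:M) Cw; rewrite ES.
  by under eq_bigr do rewrite mulmx1.
rewrite /secant_variety; apply/seteqP; split.
  apply: smallest_sub; first exact: closed_pz.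
  move=> p [x Xx px]; apply/pzP => // v vp.
  have /memv_sumP[w wx ->] := subvP px v vp.
  by apply: aclS => i; apply: (pzP _ sC nzC).1 (Xx i) _ (wx i _).
apply: smallest_sub; first exact: zariski_closure_closed.
move=> p [v [w Cw Ev] Ep]; apply: sub_gen_smallest => /=.
have [u Cu nu] := nzC.
have pt x : x != 0 -> C x -> exists2 q, pz C q & val q = <[x]>%VS.
  by move=> /line_point[q Eq] Cx; exists q => //; apply: sub_gen_smallest; exists x.
(* A zero summand defines no point, but it lies on every line, so the point of [u] stands in for
   it. *)
have pts i : exists q, pz C q /\ w i \in val q.
  have [wi0|nwi] := eqVneq (w i) 0.
    by have [q Cq _] := pt u nu Cu; exists q; rewrite wi0 mem0v.
  by have [q Cq Eq] := pt _ nwi (Cw i); exists q; rewrite Eq memv_line.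
exists (fun i => projT1 (cid (pts i))) => [i|]; first by case: (projT2 (cid (pts i))).
rewrite Ep Ev -memvE; apply: memv_sumr => i _.
by case: (projT2 (cid (pts i))).
Qed.

(* If some [f] vanished on [im psi] but not on [im phi], the [m] independent
   coordinates of [psi] together with [f] would satisfy a relation on [im phi],
   which restricts to a relation between the coordinates alone. *)
Lemma dense_by_rank m l (phi : 'I_n -> {mpoly F[m]}) (psi : 'I_n -> {mpoly F[l]}) a :
  im psi `<=` acl (im phi) -> (m <= \rank (jac psi a))%N -> im phi `<=` acl (im psi).
Proof.
move=> sub rk.
have [A [B AJB]] : exists (A : 'M[F]_(m, l)) (B : 'M[F]_(n, m)),
    A *m jac psi a *m B = 1%:M.
  exists (pid_mx m *m invmx (col_ebase (jac psi a))).
  exists (invmx (row_ebase (jac psi a)) *m pid_mx m).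
  rewrite -{2}(mulmx_ebase (jac psi a)) !mulmxA mulmxKV ?col_ebase_unit //.
  rewrite mulmxK ?row_ebase_unit // !mul_pid_mx.
  have ml : (m <= l)%N := leq_trans rk (rank_leq_row _).
  have mn : (m <= n)%N := leq_trans rk (rank_leq_col _).
  set q := minn _ _; have -> : q = m by rewrite /q; lia.
  exact: pid_mx_1.
pose y (t : 'I_m) : {mpoly F[n]} := \sum_j B j t *: 'X_j.
have dy v : jac y v = B.
  by apply/matrixP => j t; rewrite mxE mderiv_lin mevalC.
have ind : algindep (fun t => subst psi (y t)).
  by apply: (@jac_algindep _ _ _ _ a A); rewrite jac_subst dy mulmxA.
move=> v phiv f fpsi; have [f0|nf] := eqVneq (subst phi f) 0.
  exact: subst_eq0_vanish f0 v phiv.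
pose g (t : 'I_m.+1) : {mpoly F[n]} :=
  if unlift ord0 t is Some t' then y t' else f.
have /minimal_relation[P [nP P0 Pmin]] : ~ algindep (fun t => subst phi (g t)).
  by move/algindep_leq; rewrite ltnn.
have [P1 [P2 EP sP2]] := mpoly_split ord0 P.
have gP : vanish_on (subst g P) (im phi).
  by apply: subst_eq0_vanish; rewrite -subst_comp.
have P10 : P1 = 0.
  apply: ind; apply: mpoly_ext => c; rewrite meval0.
  have : (subst g P).@[param_at psi c 0] = 0.
    by apply: (sub (param_at psi c)) gP; exists c.
  rewrite meval_subst EP meval_split.
  have -> : (g ord0).@[param_at psi c 0] = 0.
    by rewrite /g unlift_none; apply: fpsi; exists c.
  rewrite mul0r addr0 meval_subst => H; rewrite -[RHS]H.
  by apply: meval_eq => t; rewrite meval_subst_param /g liftK.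
have : P2 = 0.
  have [sP|sP] := ltnP (msize P2) (msize P); last first.
    by case/eqP: nP; apply/eqP; rewrite -msize_poly_eq0; move: sP2 sP; lia.
  apply: Pmin sP _; have : subst phi (g ord0) * subst (fun t => subst phi (g t)) P2 = 0.
    rewrite -[RHS]P0 EP P10; apply: mpoly_ext => c.
    by rewrite mevalM !meval_subst meval_split meval0 add0r meval_subst.
  move/eqP; rewrite mulf_eq0 {1}/g unlift_none (negPf nf) /= => /eqP.
  by [].
move=> P20; case/eqP: nP; rewrite EP P10 P20 mulr0 addr0.
by rewrite /subst mmap0.
Qed.

End Dimension.

(** * Clifford operators *)

(* Subsets of [nat] are boolean functions, so that one Clifford algebra serves
   all [h]; [cl true j] is the exterior product by [e_j] and [cl false j] the
   contraction by its dual. *)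
Notation spin A := ((nat -> bool) -> A).

Definition tog (j : nat) (K : nat -> bool) : nat -> bool := fun i => K i (+) (i == j).

(** The sign of moving [e_j] into its place past the smaller elements of [K]. *)
Definition par (j : nat) (K : nat -> bool) : bool := odd (count K (iota 0 j)).

Definition sg (A : zmodType) (b : bool) (x : A) : A := if b then - x else x.

Definition cl (A : zmodType) (g : bool * nat) (v : spin A) : spin A :=
  fun K => if K g.2 == g.1 then sg (par g.2 K) (v (tog g.2 K)) else 0.

Definition op (A : zmodType) (q : seq (bool * nat)) (v : spin A) : spin A :=
  foldr (@cl A) v q.
Arguments op : simpl never.

Definition scl (A : pzRingType) (c : A) (v : spin A) : spin A := fun K => c * v K.

Lemma togK j : involutive (tog j).
Proof. by move=> K; apply: funext => i; rewrite /tog -addbA addbb addbF. Qed.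

Lemma togC i j K : tog i (tog j K) = tog j (tog i K).
Proof. by apply: funext => k; rewrite /tog addbAC. Qed.

Lemma parS j K : par j.+1 K = par j K (+) K j.
Proof.
by rewrite /par -addn1 iotaD count_cat oddD /= add0n addn0; case: (K j).
Qed.

Lemma par_tog i j K : par i (tog j K) = par i K (+) (j < i)%N.
Proof.
elim: i => [//|i IH]; rewrite !parS IH /tog ltnS.
by case: (par i K); case: (K i); case: (ltngtP j i).
Qed.

Section Clifford.
Variable A : zmodType.
Implicit Types (u v : spin A) (x y z g : bool * nat) (q : seq (bool * nat)).

Lemma sgN b (a : A) : sg (~~ b) a = - sg b a.
Proof. by case: b; rewrite /= ?opprK. Qed.

Lemma sg_add b c (a : A) : sg b (sg c a) = sg (b (+) c) a.
Proof. by case: b; case: c; rewrite /= ?opprK. Qed.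

Lemma sg0 b : sg b (0 : A) = 0.
Proof. by case: b; rewrite /= ?oppr0. Qed.

Lemma sgD b (a c : A) : sg b (a + c) = sg b a + sg b c.
Proof. by case: b; rewrite /= ?opprD. Qed.

Lemma clD g u v : cl g (u + v) = cl g u + cl g v.
Proof. by apply: funext => K; rewrite /cl !fctE; case: ifP => // _; rewrite ?addr0 ?sgD. Qed.

Lemma clN g u : cl g (- u) = - cl g u.
Proof.
by apply: funext => K; rewrite /cl !fctE; case: ifP => _; rewrite ?oppr0 //; case: par.
Qed.

Lemma cl0 g : cl g (0 : spin A) = 0.
Proof. by apply: funext => K; rewrite /cl; case: ifP => // _; exact: sg0. Qed.

Definition pairing x y : bool := (x.2 == y.2) && (x.1 != y.1).

Lemma clC x y v : cl x (cl y v) = (if pairing x y then v else 0) - cl y (cl x v).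
Proof.
case: x y => [d i] [c j]; apply: funext => K; rewrite /cl /pairing !fctE /=.
have [<-|nij] := eqVneq i j.
  rewrite /tog eqxx addbT !par_tog ltnn addbF.
  have := togK i K; rewrite /tog => ->.
  have z : (0 : spin A) K = 0 by [].
  by case: (K i); case: d; case: c; rewrite /= ?sg_add ?addbb /= ?z ?sg0
    ?subr0 ?subrr ?addrK.
rewrite /= [X in X + _](_ : _ = 0) // add0r.
have ti : tog i K j = K j by rewrite /tog eq_sym (negPf nij) addbF.
have tj : tog j K i = K i by rewrite /tog (negPf nij) addbF.
rewrite ti tj; case: (K i == d); case: (K j == c); rewrite ?sg0 ?oppr0 //.
rewrite !sg_add !par_tog togC -sgN; congr (sg _ _).
by case: (par i K); case: (par j K); case: ltngtP nij => // ->; rewrite eqxx.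
Qed.

Lemma cl_sq x v : cl x (cl x v) = 0.
Proof.
apply: funext => K; rewrite /cl /tog eqxx addbT.
by case: (K x.2); case: x.1; rewrite ?sg0.
Qed.

Lemma opD q u v : op q (u + v) = op q u + op q v.
Proof. by rewrite /op; elim: q => //= x q ->; rewrite clD. Qed.

Lemma opN q u : op q (- u) = - op q u.
Proof. by rewrite /op; elim: q => //= x q ->; rewrite clN. Qed.

Lemma op0 q : op q (0 : spin A) = 0.
Proof. by rewrite /op; elim: q => //= x q ->; rewrite cl0. Qed.

Lemma op_sum q (I : Type) (r : seq I) (P : pred I) (f : I -> spin A) :
  op q (\sum_(i <- r | P i) f i) = \sum_(i <- r | P i) op q (f i).
Proof.
elim: r => [|i r IH]; first by rewrite !big_nil op0.
by rewrite !big_cons; case: (P i); rewrite ?opD IH.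
Qed.

End Clifford.

Lemma op_morph (A B : zmodType) (f : {additive A -> B}) q (v : spin A) :
  (fun K => f (op q v K)) = op q (fun K => f (v K)).
Proof.
rewrite /op; elim: q => //= x q <-; apply: funext => K; rewrite /cl; case: ifP => _.
  by case: par; rewrite /= ?raddfN.
by rewrite raddf0.
Qed.

Section Scaling.
Variable A : comPzRingType.
Implicit Types (u v : spin A) (c : A) (q : seq (bool * nat)).

Lemma sclD c u v : scl c (u + v) = scl c u + scl c v.
Proof. by apply: funext => K; rewrite /scl !fctE mulrDr. Qed.

Lemma scl_addl c d u : scl (c + d) u = scl c u + scl d u.
Proof. by apply: funext => K; rewrite /scl !fctE mulrDl. Qed.

Lemma sclA c d u : scl c (scl d u) = scl (c * d) u.
Proof. by apply: funext => K; rewrite /scl mulrA. Qed.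

Lemma scl1 u : scl 1 u = u.
Proof. by apply: funext => K; rewrite /scl mul1r. Qed.

Lemma scl0 u : scl 0 u = 0.
Proof. by apply: funext => K; rewrite /scl mul0r. Qed.

Lemma sclr0 c : scl c (0 : spin A) = 0.
Proof. by apply: funext => K; rewrite /scl mulr0. Qed.

Lemma sclrN c u : scl c (- u) = - scl c u.
Proof. by apply: funext => K; rewrite /scl !fctE mulrN. Qed.

Lemma sclNr c u : scl (- c) u = - scl c u.
Proof. by apply: funext => K; rewrite /scl !fctE mulNr. Qed.

Lemma clZ x c u : cl x (scl c u) = scl c (cl x u).
Proof.
apply: funext => K; rewrite /cl /scl; case: ifP => _; last by rewrite mulr0.
by case: par; rewrite /= ?mulrN.
Qed.

Lemma opZ q c u : op q (scl c u) = scl c (op q u).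
Proof. by rewrite /op; elim: q => //= x q ->; rewrite clZ. Qed.

Lemma scl_sum c (I : Type) (r : seq I) (P : pred I) (f : I -> spin A) :
  scl c (\sum_(i <- r | P i) f i) = \sum_(i <- r | P i) scl c (f i).
Proof.
elim: r => [|i r IH]; first by rewrite !big_nil sclr0.
by rewrite !big_cons; case: (P i); rewrite ?sclD IH.
Qed.

Lemma spin_sumE (I : Type) (r : seq I) (P : pred I) (f : I -> spin A) K :
  (\sum_(i <- r | P i) f i) K = \sum_(i <- r | P i) f i K.
Proof.
elim: r => [|i r IH]; first by rewrite !big_nil.
by rewrite !big_cons; case: (P i); rewrite ?fctE IH.
Qed.

Definition ee (p : nat * nat) : seq (bool * nat) := [:: (true, p.1); (true, p.2)].

Lemma eeC p p' u : op (ee p) (op (ee p') u) = op (ee p') (op (ee p) u).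
Proof.
have anti i j v : cl (true, i) (cl (true, j) v) = - cl (true, j) (cl (true, i) v) :> spin A.
  by rewrite clC /pairing /= andbF sub0r.
rewrite /op /ee /=; rewrite (anti p.2 p'.1) !clN (anti p.1 p'.1) (anti p.2 p'.2).
by rewrite !clN (anti p.1 p'.2) !clN !opprK.
Qed.

Lemma ee_sq p u : op (ee p) (op (ee p) u) = 0.
Proof.
rewrite /op /ee /= (clC _ (true, p.1)) /pairing /= andbF sub0r !clN.
by rewrite cl_sq oppr0.
Qed.

Definition vac (h : nat) : spin A := fun K => if has K (iota 0 h) then 0 else 1.

(** The operators [e_a e_b] commute and have square zero, so this product of factors
    [1 + x_ab e_a e_b] is the exponential of the two-form [x]; applied to the vacuum it has the
    sub-Pfaffians as coordinates. *)
Definition expps (ps : seq (nat * nat)) (x : nat * nat -> A) (v : spin A) : spin A :=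
  foldr (fun p u => u + scl (x p) (op (ee p) u)) v ps.

Definition om (ps : seq (nat * nat)) (x : nat * nat -> A) (v : spin A) : spin A :=
  \sum_(p <- ps) scl (x p) (op (ee p) v).

Lemma ee_expps p ps x u : op (ee p) (expps ps x u) = expps ps x (op (ee p) u).
Proof. by elim: ps => //= p' ps IH; rewrite opD opZ eeC IH. Qed.

Lemma ee_om p ps x u : op (ee p) (om ps x u) = om ps x (op (ee p) u).
Proof.
rewrite /om op_sum; apply: eq_bigr => p' _; by rewrite opZ eeC.
Qed.

Lemma omD ps x u v : om ps x (u + v) = om ps x u + om ps x v.
Proof.
by rewrite /om -big_split /=; apply: eq_bigr => p _; rewrite opD sclD.
Qed.

Lemma omZ ps x c u : om ps x (scl c u) = scl c (om ps x u).
Proof.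
rewrite /om scl_sum; apply: eq_bigr => p _; by rewrite opZ !sclA mulrC.
Qed.

(** Binomial formula for two commuting summands of which one has square zero: only its powers zero
    and one survive. *)
Lemma iter_om_cons p ps x n u :
  iter n (om (p :: ps) x) u =
  iter n (om ps x) u + scl (n%:R * x p) (op (ee p) (iter n.-1 (om ps x) u)).
Proof.
elim: n => [|n IH]; first by rewrite mul0r scl0 addr0.
have omc v : om (p :: ps) x v = scl (x p) (op (ee p) v) + om ps x v.
  by rewrite /om big_cons.
rewrite !iterS {}IH omc opD opZ ee_sq sclr0 addr0.
rewrite omD omZ -ee_om addrC -addrA; congr (_ + _).
case: n => [|n] /=; first by rewrite mul0r scl0 add0r mul1r.
by rewrite -scl_addl; congr (scl _ _); rewrite (mulrS 1 n.+1); ring.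
Qed.

End Scaling.

Definition prs (h : nat) : seq (nat * nat) := [seq (a, b) | b <- iota 0 h, a <- iota 0 b].

Lemma mem_prs h a b : ((a, b) \in prs h) = (a < b < h)%N.
Proof.
apply/allpairsPdep/idP => [[b' [a' []]]|/andP[ab bh]].
  by rewrite !mem_iota !add0n /= => b'h a'b' [-> ->]; rewrite a'b'.
by exists b, a; rewrite !mem_iota !add0n.
Qed.

Lemma uniq_prs h : uniq (prs h).
Proof.
apply: allpairs_uniq_dep => [|b _|]; rewrite ?iota_uniq //.
by move=> [b a] [b' a'] _ _ [-> ->].
Qed.

Lemma prsS h : prs h.+1 = prs h ++ [seq (a, h) | a <- iota 0 h].
Proof. by rewrite /prs -addn1 iotaD map_cat flatten_cat /= cats0. Qed.

Lemma size_prs h : size (prs h) = 'C(h, 2).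
Proof.
elim: h => // h IH; rewrite prsS size_cat IH size_map size_iota binS bin1.
by rewrite addnC.
Qed.

Section Pfaffian.
Variable F : numFieldType.

Definition crd (h : nat) (K : nat -> bool) : nat := count K (iota 0 h).

Lemma crd_tog h a (K : nat -> bool) : (a < h)%N -> K a -> crd h K = (crd h (tog a K)).+1.
Proof.
rewrite /crd; elim: h => // h IH; rewrite ltnS => ah Ka.
rewrite -addn1 iotaD !count_cat /= add0n !addn0.
have [Ea|na] := eqVneq a h.
  rewrite -Ea Ka /tog eqxx Ka /= addn0 addn1; congr _.+1; apply: eq_in_count => i.
  by rewrite mem_iota add0n /= => ia; rewrite (ltn_eqF ia) addbF.
rewrite IH //; last by rewrite ltn_neqAle na.
by rewrite /tog eq_sym (negPf na) addbF.
Qed.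

Lemma ee_ext h p (u w : spin F) (K : nat -> bool) : (p.1 < h)%N -> (p.2 < h)%N ->
  (forall K', (crd h K').+2 = crd h K -> u K' = w K') ->
  op (ee p) u K = op (ee p) w K.
Proof.
move=> ph1 ph2 uw; rewrite /op /ee /= /cl /=; case: ifP => // /eqP K1.
case: ifP => // /eqP K2; rewrite uw //.
by rewrite (crd_tog ph1 K1) (crd_tog ph2 K2).
Qed.

(** In degree [2n] the exponential of a two-form is its [n]-th divided power. *)
Lemma expps_om h ps (x : nat * nat -> F) K n : all (fun p => (p.1 < h)%N && (p.2 < h)%N) ps ->
  crd h K = n.*2 ->
  n`!%:R * expps ps x (vac _ h) K = iter n (om ps x) (vac _ h) K.
Proof.
elim: ps n K => [|p ps IH] n K /=.
  move=> _ Kn; case: n Kn => [|n] Kn; first by rewrite mul1r.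
  have -> : vac _ h K = 0.
    by rewrite /vac has_count -/(crd h K) Kn.
  by rewrite mulr0 iterS /om big_nil.
case/andP => /andP[p1 p2] psh Kn; rewrite iter_om_cons !fctE mulrDr IH //.
congr (_ + _); rewrite /scl.
have [n0|n0] := posnP n.
  rewrite n0 !mul0r (_ : op _ _ K = 0) ?mulr0 // /op /= /cl /=.
  case: eqP => // K1; have := crd_tog p1 K1; by rewrite Kn n0.
case: n n0 Kn => // n _ Kn; rewrite factS natrM /=.
have -> : op (ee p) (iter n (om ps x) (vac _ h)) K =
          n`!%:R * op (ee p) (expps ps x (vac _ h)) K.
  transitivity (op (ee p) (scl n`!%:R (expps ps x (vac _ h))) K); last by rewrite opZ.
  apply: (@ee_ext h) => // K' KK; rewrite /scl IH //.
  by move: KK; rewrite Kn doubleS => -[].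
by ring.
Qed.

(** With all ordered pairs, iterating matches the sum over all permutations in the Pfaffian term by
    term; the price is a factor [2] per iteration. *)
Definition om2 (h : nat) (U : nat -> nat -> F) (v : spin F) : spin F :=
  \sum_(a <- iota 0 h) \sum_(b <- iota 0 h) scl (U a b) (op (ee (a, b)) v).

Lemma om2E h U v : (forall a b, U b a = - U a b) ->
  om2 h U v = scl 2%:R (om (prs h) (fun p => U p.1 p.2) v).
Proof.
move=> Us; have U0 a : U a a = 0.
  by apply/eqP; rewrite -[_ == 0]orFb -(mulrn_eq0 _ 2) mulr2n {1}(Us a a) addNr eqxx.
have sw a b : scl (U b a) (op (ee (b, a)) v) = scl (U a b) (op (ee (a, b)) v).
  by rewrite Us /op /ee /= clC /pairing /= andbF sub0r sclrN sclNr opprK.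
rewrite /om2 /om; elim: h => [|h IH].
  by rewrite !big_nil sclr0.
rewrite prsS -addn1 iotaD !big_cat /= add0n.
rewrite big_seq1 big_cat /= big_seq1 U0 scl0 addr0.
under eq_bigr do rewrite big_cat /= big_seq1.
rewrite big_split /= IH sclD -addrA; congr (_ + _).
rewrite big_map /=.
rewrite [X in scl _ X](_ : _ = \sum_(b <- iota 0 h) scl (U h b) (op (ee (h, b)) v)); last first.
  by apply: eq_bigr => a _; rewrite sw.
rewrite (_ : \sum_(i <- iota 0 h) scl (U i h) _ =
    \sum_(b <- iota 0 h) scl (U h b) (op (ee (h, b)) v)); last first.
  by apply: eq_bigr => a _; rewrite sw.
by rewrite (natrD _ 1 1) scl_addl scl1.
Qed.

End Pfaffian.

(** * Pfaffians *)

Section PfaffianExpansion.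
Variable F : numFieldType.

Definition pair_prod (m : nat) (f : 'I_m -> 'I_m -> F) : F :=
  \prod_(i < m) \prod_(j < m | ~~ odd i && (j == i.+1 :> nat)) f i j.

Lemma pair_prodS m (f : 'I_m.+2 -> 'I_m.+2 -> F) :
  pair_prod f = f ord0 (lift ord0 ord0) *
    pair_prod (fun i j => f (lift ord0 (lift ord0 i)) (lift ord0 (lift ord0 j))).
Proof.
rewrite /pair_prod 2!big_ord_recl /=; congr (_ * _).
  rewrite big_mkcond 2!big_ord_recl /= mul1r big1 ?mulr1 //.
rewrite big_pred0_eq mul1r.
apply: eq_bigr => i _; rewrite big_mkcond 2!big_ord_recl /= /bump /= ?add1n /= ?negbK.
rewrite !andbF !mul1r [RHS]big_mkcond; apply: eq_bigr => j _.
by rewrite /bump /= ?add1n ?eqSS.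
Qed.

Definition pf_sum (m : nat) (A : 'I_m -> 'I_m -> F) : F :=
  \sum_(s : 'S_m) (-1) ^+ s * pair_prod (fun i j => A (s i) (s j)).

Lemma sum_lift_perm (n : nat) (G : 'S_n.+1 -> F) :
  \sum_s G s = \sum_(j < n.+1) \sum_(s : 'S_n) G (lift_perm ord0 j s).
Proof.
rewrite pair_big /=; apply: reindex.
apply: onW_bij; apply: inj_card_bij => [[j s] [j' s'] /= E|].
  have Ej : j = j'.
    by have := congr1 (fun t : 'S_n.+1 => t ord0) E; rewrite !lift_perm_id.
  congr (_, _) => //; apply/permP => i.
  have := congr1 (fun t : 'S_n.+1 => t (lift ord0 i)) E.
  by rewrite !lift_perm_lift Ej => /lift_inj.
by rewrite card_prod !card_Sn card_ord factS.
Qed.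

(** Permutations are sorted by the images of the first two indices. The sign, with [j] counted after
    the removal of [i], is the one that two successive removals from a set produce through [par]. *)
Lemma pf_sumS m (A : 'I_m.+2 -> 'I_m.+2 -> F) :
  pf_sum A = \sum_(i < m.+2) \sum_(j < m.+1) (-1) ^+ i * (-1) ^+ j * A i (lift i j) *
    pf_sum (fun k l => A (lift i (lift j k)) (lift i (lift j l))).
Proof.
rewrite /pf_sum sum_lift_perm; apply: eq_bigr => i _.
rewrite sum_lift_perm; apply: eq_bigr => j _.
rewrite mulr_sumr; apply: eq_bigr => s _.
rewrite pair_prodS !lift_perm_lift !lift_perm_id !odd_lift_perm /=.
rewrite [pair_prod _](_ : _ = pair_prod (fun k l =>
  A (lift i (lift j (s k))) (lift i (lift j (s l))))).
  rewrite signr_addb signr_addb signr_odd signr_odd.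
  move: ((-1) ^+ i) ((-1) ^+ j) ((-1) ^+ s) (A _ _) (pair_prod _) => a b c d e.
  by ring.
by apply: eq_bigr => k _; apply: eq_bigr => l _; rewrite !lift_perm_lift.
Qed.

Definition set_of_map (m : nat) (kappa : 'I_m -> nat) : nat -> bool :=
  fun i => [exists t, kappa t == i].

Section Increasing.
Variables (m : nat) (kappa : 'I_m -> nat).
Hypothesis incr : {homo kappa : i j / (i < j)%N}.

Lemma incr_mono : {mono kappa : i j / (i < j)%N}.
Proof.
move=> i j; have [ij|ji|/val_inj ->] := ltngtP i j; last by rewrite ltnn.
  exact: incr.
by apply/negbTE; rewrite -leqNgt ltnW // incr.
Qed.

Lemma incr_inj : injective kappa.
Proof.
move=> i j E; have := incr_mono i j; have := incr_mono j i.
by rewrite E ltnn; case: (ltngtP i j) => // /val_inj.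
Qed.

Lemma set_of_map_in t : set_of_map kappa (kappa t).
Proof. by apply/existsP; exists t. Qed.

Lemma perm_set_of_map h : (forall t, kappa t < h)%N ->
  perm_eq [seq i <- iota 0 h | set_of_map kappa i] [seq kappa t | t <- enum 'I_m].
Proof.
move=> kh; apply: uniq_perm; first by rewrite filter_uniq ?iota_uniq.
  by rewrite map_inj_uniq ?enum_uniq //; exact: incr_inj.
move=> i; rewrite mem_filter mem_iota add0n /=; apply/andP/mapP.
  by move=> [/existsP[t /eqP <-] _]; exists t; rewrite ?mem_enum.
by move=> [t _ ->]; rewrite set_of_map_in kh.
Qed.

Lemma sum_set_of_map h (f : nat -> F) : (forall t, kappa t < h)%N ->
  \sum_(a <- iota 0 h) (if set_of_map kappa a then f a else 0) = \sum_t f (kappa t).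
Proof.
move=> kh; rewrite -big_mkcond -big_filter (perm_big _ (perm_set_of_map kh)).
by rewrite big_map big_enum.
Qed.

Lemma par_set_of_map j : par (kappa j) (set_of_map kappa) = odd j.
Proof.
rewrite /par -size_filter; congr odd.
pose s := [seq kappa t | t : 'I_m <- enum 'I_m & (t < j)%N].
have -> : size [seq i <- iota 0 (kappa j) | set_of_map kappa i] = size s.
  apply: perm_size; apply: uniq_perm; first by rewrite filter_uniq ?iota_uniq.
    by rewrite map_inj_uniq; [exact: filter_uniq (enum_uniq _) | exact: incr_inj].
  move=> i; rewrite mem_filter mem_iota add0n /=; apply/andP/mapP.
    move=> [/existsP[t /eqP <-] tj]; exists t => //.
    by rewrite mem_filter mem_enum andbT -incr_mono.
  move=> [t]; rewrite mem_filter mem_enum andbT => tj ->.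
  by rewrite set_of_map_in incr_mono.
rewrite size_map size_filter -sum1_count big_enum_cond /=.
by rewrite -(big_ord_widen _ (fun=> 1%N) (ltnW (ltn_ord j))) sum1_card card_ord.
Qed.

End Increasing.

Lemma tog_set_of_map m (kappa : 'I_m.+1 -> nat) j : {homo kappa : i j / (i < j)%N} ->
  tog (kappa j) (set_of_map kappa) = set_of_map (kappa \o lift j).
Proof.
move=> incr; apply: funext => i; rewrite /tog /set_of_map.
have [->|ni] := eqVneq i (kappa j).
  rewrite addbT; apply/negP/existsP => [|[t /eqP /(incr_inj incr) /eqP]].
    by case; apply/existsP; exists j.
  by rewrite eq_sym (negPf (neq_lift _ _)).
rewrite addbF; apply/existsP/existsP => [[t /eqP Et]|[t /eqP <-]]; last by exists (lift j t).
case: (unliftP j t) => [t' E|E]; first by exists t'; rewrite /= -E Et.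
by rewrite -Et E eqxx in ni.
Qed.

Lemma lift_mono n (j : 'I_n.+1) (s t : 'I_n) : (s < t)%N -> (lift j s < lift j t)%N.
Proof. by rewrite /= /bump; lia. Qed.

Lemma sg_sign b (x : F) : sg b x = (-1) ^+ b * x.
Proof. by case: b; rewrite /= ?expr1 ?mulN1r ?expr0 ?mul1r. Qed.

(** One application of the two-form removes the elements in positions [i] and [j] with the signs of
    [pf_sumS], so both sides obey the same recursion. *)
Lemma iter_om2_pf n h (U : nat -> nat -> F) (kappa : 'I_(n.*2) -> nat) :
  {homo kappa : i j / (i < j)%N} -> (forall t, kappa t < h)%N ->
  iter n (om2 h U) (vac _ h) (set_of_map kappa) =
  pf_sum (fun i j => U (kappa i) (kappa j)).
Proof.
elim: n kappa => [|n IH] kappa incr kh.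
  rewrite /= /pf_sum (bigD1 1%g) //= big1 => [|s /eqP []].
    rewrite /pair_prod big_ord0 odd_perm1 mulr1 addr0 /vac; case: hasP => // -[i _].
    by move/existsP => [[]].
  by apply/permP => -[].
rewrite iterS {1}/om2 -[n.+1.*2]/(n.*2.+2) in kappa incr kh *.
rewrite pf_sumS spin_sumE.
under eq_bigr do rewrite spin_sumE.
pose g a b := U a b * (if tog a (set_of_map kappa) b then
   sg (par a (set_of_map kappa)) (sg (par b (tog a (set_of_map kappa)))
     (iter n (om2 h U) (vac _ h) (tog b (tog a (set_of_map kappa))))) else 0).
transitivity (\sum_(a <- iota 0 h) if set_of_map kappa a then
    \sum_(b <- iota 0 h) g a b else 0).
  apply: eq_bigr => a _; rewrite /scl /op /= /cl /=; case: set_of_map => /=; last first.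
    by rewrite big1 // => b _; rewrite mulr0.
  apply: eq_bigr => b _; rewrite /g; case: (tog a _ b) => //=.
  by rewrite sg0.
rewrite (sum_set_of_map incr) //; apply: eq_bigr => i _.
have incr' : {homo kappa \o lift i : s t / (s < t)%N}.
  by move=> s t st; apply: incr; exact: lift_mono.
transitivity (\sum_(b <- iota 0 h) (if set_of_map (kappa \o lift i) b then
   U (kappa i) b * sg (par (kappa i) (set_of_map kappa))
     (sg (par b (set_of_map (kappa \o lift i)))
     (iter n (om2 h U) (vac _ h) (tog b (set_of_map (kappa \o lift i))))) else 0)).
  apply: eq_bigr => b _; rewrite /g (tog_set_of_map _ incr).
  by case: ifP; rewrite ?mulr0.
rewrite (sum_set_of_map incr') => [|t]; last exact: kh.
apply: eq_bigr => j _; rewrite (par_set_of_map incr) (par_set_of_map incr').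
have -> : tog ((kappa \o lift i) j) (set_of_map (kappa \o lift i)) =
          set_of_map ((kappa \o lift i) \o lift j) by rewrite tog_set_of_map.
rewrite IH => [|s t st|t]; last exact: kh.
  rewrite !sg_sign signr_odd signr_odd /=.
  move: ((-1) ^+ i) ((-1) ^+ j) (U _ _) (pf_sum _) => a b c d.
  by ring.
by apply: incr'; exact: lift_mono.
Qed.

Definition mem_nat (h : nat) (K : {set 'I_h}) : nat -> bool :=
  fun i => if insub i is Some t then t \in K else false.

Lemma enum_val_incr h (K : {set 'I_h}) :
  {homo (fun t => val (@enum_val _ (mem K) t)) : i j / (i < j)%N}.
Proof.
move=> i j ij /=; have lt_tr : transitive (fun a b : 'I_h => (a < b)%N).
  by move=> a b c; exact: ltn_trans.
have : sorted (fun a b : 'I_h => (a < b)%N) (enum K).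
  rewrite {1}/enum_mem -enumT; apply: sorted_filter => //.
  have := iota_ltn_sorted 0 h; rewrite -val_enum_ord sorted_map.
  by [].
rewrite /enum_val => so; have iK := ltn_ord i; rewrite [X in (i < X)%N]cardE in iK.
have jK := ltn_ord j; rewrite [X in (j < X)%N]cardE in jK.
rewrite (set_nth_default (enum_default i) (enum_default j)) //.
exact: (sorted_ltn_nth lt_tr).
Qed.

Lemma set_of_enum_val h (K : {set 'I_h}) :
  set_of_map (fun t => val (@enum_val _ (mem K) t)) = mem_nat K.
Proof.
apply: funext => i; rewrite /set_of_map /mem_nat; case: insubP => [u _ <-|nh].
  apply/existsP/idP => [[t /eqP /val_inj <-]|uK]; first exact: enum_valP.
  by exists (enum_rank_in uK u); rewrite enum_rankK_in.
apply/negbTE/existsP => -[t /eqP ti].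
by rewrite -ti (ltn_ord _) in nh.
Qed.

Lemma iter_om2 n h (U : nat -> nat -> F) v : (forall a b, U b a = - U a b) ->
  iter n (om2 h U) v = scl (2 ^+ n) (iter n (om (prs h) (fun p => U p.1 p.2)) v).
Proof.
move=> Us; elim: n => [|n IH]; first by rewrite /= scl1.
by rewrite !iterS IH om2E // omZ !sclA exprS.
Qed.

(** The denominator of the Pfaffian has two sources: the power of [2] comes from the ordered pairs
    in [om2], the factorial from the divided power in the exponential. *)
Lemma sub_pfaffianE h (U : 'M[F]_h) (u : nat -> nat -> F) (K : {set 'I_h}) :
  (forall i j : 'I_h, U i j = u i j) -> (forall a b, u b a = - u a b) -> ~~ odd #|K| ->
  sub_pfaffian U K = expps (prs h) (fun p => u p.1 p.2) (vac _ h) (mem_nat K).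
Proof.
move=> Uu us evK.
have : exists n, #|K| = n.*2.
  by exists #|K|./2; rewrite -[LHS]odd_double_half (negPf evK).
case=> n Kn.
have cK : crd h (mem_nat K) = n.*2.
  rewrite -Kn /crd -size_filter -(set_of_enum_val K).
  rewrite (perm_size (perm_set_of_map (@enum_val_incr h K) _)) => [|t]; last exact: ltn_ord.
  by rewrite size_map size_enum_ord.
have nz : (2 ^ n * n`!)%:R != 0 :> F by rewrite pnatr_eq0 -lt0n muln_gt0 expn_gt0 fact_gt0.
have key : pf_sum (fun i j : 'I_#|K| => u (enum_val i) (enum_val j)) =
    (2 ^ n * n`!)%:R * expps (prs h) (fun p => u p.1 p.2) (vac _ h) (mem_nat K).
  rewrite natrM -mulrA (@expps_om _ h _ _ _ n) //; last first.
    apply/allP => -[a b]; rewrite mem_prs /= => /andP[ab bh].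
    by rewrite bh (ltn_trans ab bh).
  have -> : forall x, (2 ^ n)%:R * iter n (om (prs h) (fun p => u p.1 p.2)) (vac _ h) x =
      iter n (om2 h u) (vac F h) x by move=> x; rewrite iter_om2 // /scl natrX.
  have incr := @enum_val_incr h K; rewrite -(set_of_enum_val K).
  have kh t : (val (@enum_val _ (mem K) t) < h)%N by exact: ltn_ord.
  move: (@enum_val _ (mem K)) incr kh; rewrite Kn => ev incr kh.
  by rewrite iter_om2_pf.
rewrite /sub_pfaffian /pfaffian.
have -> : #|K|./2 = n by rewrite Kn doubleK.
apply: (mulfI nz); rewrite -key mulVKf //.
apply: eq_bigr => s _; congr (_ * _); rewrite /pair_prod.
by apply: eq_bigr => i _; apply: eq_bigr => j _; rewrite mxE Uu.
Qed.

End PfaffianExpansion.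

(** * The spinor cone and its secants *)

Lemma expps_ext (A : comPzRingType) (ps : seq (nat * nat)) (x y : nat * nat -> A) v :
  {in ps, x =1 y} -> expps ps x v = expps ps y v.
Proof.
elim: ps => //= p ps IH xy; rewrite IH ?xy ?mem_head // => q qps.
by apply: xy; rewrite inE qps orbT.
Qed.

Lemma expps_morph (A B : comPzRingType) (f : {rmorphism A -> B}) ps x (v : spin A) :
  (fun K => f (expps ps x v K)) = expps ps (fun p => f (x p)) (fun K => f (v K)).
Proof.
elim: ps => //= p ps <-; rewrite -op_morph; apply: funext => K.
by rewrite !fctE /scl rmorphD rmorphM.
Qed.

Lemma vac_morph (A B : comPzRingType) (f : {rmorphism A -> B}) h :
  (fun K => f (vac A h K)) = vac B h.
Proof. by apply: funext => K; rewrite /vac; case: ifP; rewrite ?rmorph0 ?rmorph1. Qed.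

Lemma op_deriv (A : comPzRingType) (delta : {additive A -> A}) q (v : spin A) K :
  delta (op q v K) = op q (fun K => delta (v K)) K.
Proof. by have := op_morph delta q v => /(congr1 (fun f => f K)). Qed.

Lemma expps_deriv (A : comPzRingType) (delta : {additive A -> A}) ps x (v : spin A) :
  (forall a b, delta (a * b) = delta a * b + a * delta b) ->
  (forall K, delta (v K) = 0) ->
  (fun K => delta (expps ps x v K)) =
  \sum_(p <- ps) scl (delta (x p)) (op (ee p) (expps ps x v)).
Proof.
move=> dM dv; elim: ps => [|p ps IH].
  by rewrite big_nil; apply: funext => K; rewrite /= dv.
rewrite big_cons /=; set u := expps ps x v in IH *.
have -> : (fun K => delta ((u + scl (x p) (op (ee p) u)) K)) =
    (fun K => delta (u K)) + scl (delta (x p)) (op (ee p) u) +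
    scl (x p) (op (ee p) (fun K => delta (u K))).
  apply: funext => K; rewrite !fctE raddfD /scl dM op_deriv /=.
  by rewrite addrA.
rewrite IH opD opZ ee_sq sclr0 addr0 op_sum scl_sum.
rewrite addrAC addrC -big_split /=; congr (_ + _); apply: eq_bigr => p' _.
by rewrite !opD !opZ sclD eeC !sclA [x p * _]mulrC.
Qed.

Section SpinorVariety.
Variables (F : numFieldType) (h : nat).

Definition key (j : 'I_(num_even_subsets h)) : nat -> bool :=
  mem_nat (val (enum_val j : even_subset h)).

Definition rv (v : spin F) : 'rV[F]_(num_even_subsets h) := \row_j v (key j).

Lemma rvD u v : rv (u + v) = rv u + rv v.
Proof. by apply/rowP => j; rewrite !mxE. Qed.

Lemma rvZ c v : rv (scl c v) = c *: rv v.
Proof. by apply/rowP => j; rewrite !mxE. Qed.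

Lemma rv_sum (I : Type) (r : seq I) (P : pred I) (f : I -> spin F) :
  rv (\sum_(i <- r | P i) f i) = \sum_(i <- r | P i) rv (f i).
Proof.
by apply/rowP => j; rewrite !mxE spin_sumE summxE; apply: eq_bigr => i _; rewrite mxE.
Qed.

Definition pure (A : comPzRingType) (x : nat * nat -> A) : spin A :=
  expps (prs h) x (vac A h).

Definition spinor_cone : set 'rV[F]_(num_even_subsets h) :=
  [set rv (scl c.1 (pure c.2)) | c in [set: F * (nat * nat -> F)]].

Lemma scaling_spinor_cone : scaling spinor_cone.
Proof.
by move=> c _ [[d x] _ <-]; exists (c * d, x) => //=; rewrite -rvZ sclA.
Qed.

Lemma pure_vac (A : comPzRingType) (x : nat * nat -> A) : pure x (fun=> false) = 1.
Proof.
rewrite /pure; elim: (prs h) => [|p ps IH] /=.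
  rewrite /vac; case: hasP => // -[]; by [].
by rewrite fctE IH /scl /op /= /cl /= mulr0 addr0.
Qed.

Lemma spinor_vectorE (U : 'M[F]_h) (u : nat -> nat -> F) :
  (forall i j : 'I_h, U i j = u i j) -> (forall a b, u b a = - u a b) ->
  spinor_vector U = rv (pure (fun p => u p.1 p.2)).
Proof.
move=> Uu us; apply/rowP => j; rewrite !mxE (sub_pfaffianE Uu us) //.
exact: (valP (enum_val j)).
Qed.

Lemma spinor_variety_pz : spinor_variety F h = pz spinor_cone.
Proof.
rewrite /spinor_variety /pz; congr zariski_closure; apply/seteqP; split=> p.
  move=> [U Us Ep].
  pose u a b : F := if insub a is Some i then
    (if insub b is Some j then U i j else 0) else 0.
  exists (spinor_vector U) => //.
  have Uu (i j : 'I_h) : U i j = u i j.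
    by rewrite /u !valK.
  have us a b : u b a = - u a b.
    rewrite /u; case: (insub a) => [i|]; case: (insub b) => [j|]; rewrite ?oppr0 //.
    by move/matrixP/(_ i j): Us; rewrite !mxE.
  exists (1, fun p => u p.1 p.2) => //=.
  by rewrite scl1 (spinor_vectorE Uu us).
move=> [_ [[c x] _ <-] Ep] /=; rewrite rvZ in Ep.
have nc : c != 0.
  apply/eqP => c0; have := valP p; rewrite Ep /= c0 scale0r dim_vline eqxx.
  by [].
pose u a b : F := if (a < b)%N then x (a, b) else if (b < a)%N then - x (b, a) else 0.
have us a b : u b a = - u a b.
  by rewrite /u; case: ltngtP; rewrite ?opprK ?oppr0.
exists (\matrix_(i, j) u i j).
  by apply/matrixP => i j; rewrite !mxE us.
rewrite (@spinor_vectorE _ u) => [|i j|//]; last by rewrite mxE.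
rewrite Ep; have -> : pure (fun p => u p.1 p.2) = pure x.
  by apply: expps_ext => -[a b]; rewrite mem_prs /u /= => /andP[-> _].
apply/eqP; rewrite eqEsubv -!memvE memvZ ?memv_line //=.
by rewrite -[X in X \in _](scalerK nc) memvZ // memv_line.
Qed.

Lemma key_exists (K : nat -> bool) : (forall i, K i -> (i < h)%N) -> ~~ odd (crd h K) ->
  exists j, key j = K.
Proof.
move=> Kh ev; pose S : {set 'I_h} := finset (fun i : 'I_h => K i).
have KS : mem_nat S = K.
  apply: funext => i; rewrite /mem_nat; case: insubP => [u _ <-|]; first by rewrite finset.inE.
  by move/negP => nh; apply/esym/negbTE/negP => /Kh.
have cS : #|S| = crd h K.
  rewrite /crd -size_filter -[in RHS]KS -(set_of_enum_val S).
  rewrite (perm_size (perm_set_of_map (@enum_val_incr h S) _)) => [|t]; last exact: ltn_ord.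
  by rewrite size_map size_enum_ord.
have evS : ~~ odd #|S| by rewrite cS.
exists (enum_rank (Sub S evS : even_subset h)).
by rewrite /key enum_rankK SubK.
Qed.

Lemma key_lt j i : key j i -> (i < h)%N.
Proof. by rewrite /key /mem_nat; case: insubP. Qed.

Lemma key_even j : ~~ odd (crd h (key j)).
Proof.
rewrite /crd -size_filter /key -(set_of_enum_val _).
rewrite (perm_size (perm_set_of_map (@enum_val_incr h _) _)) => [|t]; last exact: ltn_ord.
rewrite size_map size_enum_ord; exact: (valP (enum_val j)).
Qed.

End SpinorVariety.

Arguments spinor_cone : clear implicits.

Section SecantFamily.
Variables (F : numFieldType) (h k : nat).

(** For each point, slot [ord0] is the scale of the spinor, and slot [t.+1] is the coefficient at
    pair number [t] of [prs h]. *)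
Definition par_type : finType := ('I_k * 'I_('C(h, 2)).+1)%type.

Definition pvar (i : 'I_k) (p : nat * nat) : par_type := (i, inord (index p (prs h)).+1).

Definition secant_sum (A : comPzRingType) (y : par_type -> A) : spin A :=
  \sum_(i < k) scl (y (i, ord0)) (pure h (fun p => y (pvar i p))).

Lemma secant_sum_morph (A B : comPzRingType) (f : {rmorphism A -> B}) y K :
  f (secant_sum y K) = secant_sum (fun t => f (y t)) K.
Proof.
rewrite /secant_sum !spin_sumE rmorph_sum; apply: eq_bigr => i _.
rewrite /scl rmorphM; congr (_ * _).
by have := expps_morph f (prs h) (fun p => y (pvar i p)) (vac A h) =>
  /(congr1 (fun g => g K)); rewrite vac_morph.
Qed.

Definition chi (j : 'I_(num_even_subsets h)) : {mpoly F[#|par_type|]} :=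
  secant_sum (fun t => 'X_(enum_rank t)) (key j).

Lemma param_at_chi a :
  param_at chi a = rv h (secant_sum (fun t => a (enum_rank t))).
Proof.
apply/rowP => j; rewrite !mxE (secant_sum_morph (meval a)); congr (secant_sum _ _).
by apply: funext => t; rewrite /= mevalXU.
Qed.

Definition tangent (A : comPzRingType) (y : par_type -> A) (t : par_type) : spin A :=
  if t.2 == ord0 then pure h (fun p => y (pvar t.1 p))
  else scl (y (t.1, ord0)) (op (ee (nth (0, 0)%N (prs h) t.2.-1))
         (pure h (fun p => y (pvar t.1 p)))).

Lemma pvar_nth i (t : 'I_('C(h, 2)).+1) : t != ord0 ->
  pvar i (nth (0, 0)%N (prs h) t.-1) = (i, t).
Proof.
rewrite -val_eqE /= => t0; have tp : (t.-1 < size (prs h))%N.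
  by rewrite size_prs; case: t t0 => [[|t]] //=.
congr (_, _); apply: val_inj; rewrite index_uniq ?uniq_prs // prednK ?lt0n //.
by rewrite /= inordK.
Qed.

Lemma pvar_in i p : p \in prs h -> pvar i p != (i, ord0).
Proof.
move=> ps; rewrite xpair_eqE eqxx /= -val_eqE /= inordK // ltnS -(size_prs h).
by rewrite index_mem.
Qed.

Lemma jac_chi a t j :
  jac chi a (enum_rank t) j = tangent (fun s => a (enum_rank s)) t (key j).
Proof.
rewrite mxE /chi /secant_sum spin_sumE (raddf_sum (mderiv _)) (raddf_sum (meval _)) /=.
pose A : comNzRingType := {mpoly F[#|par_type|]}.
pose y (s : par_type) : A := 'X_(enum_rank s).
have dy s : mderiv (enum_rank t) (y s) = (s == t)%:R.
  by rewrite mderivU (inj_eq enum_rank_inj).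
have ev s : (y s).@[a] = a (enum_rank s) by rewrite mevalXU.
have evp i K : (pure h (fun p => y (pvar i p)) K).@[a] =
    pure h (fun p => a (enum_rank (pvar i p))) K.
  have := expps_morph (meval a) (prs h) (fun p => y (pvar i p)) (vac A h).
  move/(congr1 (fun g => g K)) => /= ->; rewrite (vac_morph (meval a)).
  by congr (expps _ _ _ _); apply: funext => p; rewrite ev.
have dpure i : (fun K => mderiv (enum_rank t) (pure h (fun p => y (pvar i p)) K)) =
   \sum_(p <- prs h) scl ((pvar i p == t)%:R) (op (ee p) (pure h (fun p => y (pvar i p)))).
  rewrite /pure (expps_deriv (delta := mderiv (enum_rank t))).
  - by apply: eq_bigr => p _; rewrite /= dy.
  - exact: mderivM.
  - by move=> K; rewrite /vac; case: ifP => _; [exact: mderiv0 | exact: (mderivC _ 1)].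
have term i :
    (mderiv (enum_rank t) (scl (y (i, ord0)) (pure h (fun p => y (pvar i p))) (key j))).@[a] =
    if i == t.1 then tangent (fun s => a (enum_rank s)) t (key j) else 0.
  rewrite /scl mderivM dy mevalD !mevalM ev evp.
  have -> := congr1 (fun g => g (key j)) (dpure i).
  rewrite spin_sumE raddf_sum /= /tangent.
  have [it|nit] := eqVneq i t.1; last first.
    rewrite (_ : (i, ord0) == t = false); last by apply: contraNF nit => /eqP <-.
    rewrite meval0 mul0r add0r big1 ?mulr0 // => p _; rewrite /scl.
    rewrite (_ : pvar i p == t = false) ?mul0r ?meval0 //.
    by apply: contraNF nit => /eqP <-.
  case: t dy it {dpure} => t1 t2 /= dy ->.
  rewrite xpair_eqE eqxx /= eq_sym; have [->|t20] := eqVneq t2 ord0.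
    rewrite meval1 mul1r big_seq big1 ?mulr0 ?addr0 // => p pin.
    by rewrite /scl (negPf (pvar_in t1 pin)) mul0r meval0.
  rewrite meval0 mul0r add0r /scl; congr (_ * _).
  have tp : (t2.-1 < size (prs h))%N.
    by rewrite size_prs; move: t20; rewrite -val_eqE; case: t2 {dy} => [[|s]].
  rewrite (bigD1_seq (nth (0, 0)%N (prs h) t2.-1)) ?uniq_prs ?mem_nth //=.
  rewrite pvar_nth // eqxx mul1r big_seq_cond big1 ?addr0.
    have := op_morph (meval a) (ee (nth (0, 0)%N (prs h) t2.-1)) (pure h (fun p => y (pvar t1 p))).
    move/(congr1 (fun g => g (key j))) => /= ->.
    by congr (op _ _ _); apply: funext => K; rewrite evp.
  move=> p /andP[pin np]; rewrite (_ : pvar t1 p == _ = false) ?mul0r ?meval0 //.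
  apply/negP => /eqP /(congr1 (fun s : par_type => val s.2)) /=.
  rewrite inordK ?ltnS -?(size_prs h) ?index_mem // => E.
  by case/eqP: np; rewrite -E /= nth_index.
under eq_bigr do rewrite term.
by rewrite -big_mkcond big_pred1_eq.
Qed.

Lemma spinor_cone_params (w : 'I_k -> 'rV[F]_(num_even_subsets h)) :
  (forall i, spinor_cone F h (w i)) -> exists a : 'I_#|par_type| -> F, forall i,
    w i = rv h (scl (a (enum_rank (i, ord0))) (pure h (fun p => a (enum_rank (pvar i p))))).
Proof.
move=> Cw; pose c i := s2val (cid2 (Cw i)).
have Ec i : rv h (scl (c i).1 (pure h (c i).2)) = w i by rewrite /c; case: cid2.
exists (fun t => let: (i, s) := enum_val t in
  if s == ord0 then (c i).1 else (c i).2 (nth (0, 0)%N (prs h) s.-1)) => i.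
rewrite -Ec enum_rankK eqxx; congr (rv _ (scl _ _)).
apply: expps_ext => p pin; rewrite enum_rankK /pvar.
have := pvar_in i pin; rewrite xpair_eqE eqxx /= => /negPf ->.
by rewrite inordK ?ltnS -?(size_prs h) ?index_mem //= nth_index.
Qed.

Lemma im_chi : im chi =
  [set v | exists2 w : 'I_k -> 'rV[F]_(num_even_subsets h),
     (forall i, spinor_cone F h (w i)) & v = \sum_i w i].
Proof.
apply/seteqP; split=> [_ [a _ <-]|v [w Cw ->]].
  rewrite param_at_chi /secant_sum rv_sum.
  exists (fun i => rv h (scl (a (enum_rank (i, ord0)))
    (pure h (fun p => a (enum_rank (pvar i p)))))) => // i.
  by exists (a (enum_rank (i, ord0)), fun p => a (enum_rank (pvar i p))).
have [a Ea] := spinor_cone_params Cw; exists a => //.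
by rewrite param_at_chi /secant_sum rv_sum; apply: eq_bigr => i _; rewrite Ea.
Qed.

End SecantFamily.

(** * The Lie algebra action *)

Section Words.
Variables (A : comPzRingType) (T : Type).
Implicit Types (W : seq (T * seq (bool * nat))) (y : T -> A) (u v : spin A).

(** Each letter acts as [1 + y q]. Letters carry labels so that several of them can share one
    parameter. *)
Definition actw W y v : spin A :=
  foldr (fun tq u => u + scl (y tq.1) (op tq.2 u)) v W.

Lemma actwD W y u v : actw W y (u + v) = actw W y u + actw W y v.
Proof.
elim: W => //= tq W ->; rewrite opD sclD; set a := actw W y u; set b := actw W y v.
by rewrite addrACA.
Qed.

Lemma actwZ W y c v : actw W y (scl c v) = scl c (actw W y v).
Proof.
by elim: W => //= tq W ->; rewrite opZ sclD !sclA [c * _]mulrC.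
Qed.

Lemma actw_cat W1 W2 y v : actw (W1 ++ W2) y v = actw W1 y (actw W2 y v).
Proof. by rewrite /actw foldr_cat. Qed.

Fixpoint dact W (y dy : T -> A) (v dv : spin A) : spin A :=
  if W is tq :: W' then
    dact W' y dy v dv + scl (dy tq.1) (op tq.2 (actw W' y v)) +
    scl (y tq.1) (op tq.2 (dact W' y dy v dv))
  else dv.

Lemma actw_deriv (delta : {additive A -> A}) W y v :
  (forall a b, delta (a * b) = delta a * b + a * delta b) ->
  (fun K => delta (actw W y v K)) =
  dact W y (fun t => delta (y t)) v (fun K => delta (v K)).
Proof.
move=> dM; elim: W => //= tq W <-; apply: funext => K.
by rewrite !fctE raddfD /scl dM op_deriv addrA.
Qed.

Lemma dact0 W (dy : T -> A) v dv :
  dact W (fun=> 0) dy v dv = dv + \sum_(tq <- W) scl (dy tq.1) (op tq.2 v).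
Proof.
have act0 W' : actw W' (fun=> 0) v = v by elim: W' => //= tq W' ->; rewrite scl0 addr0.
elim: W => [|tq W IH]; first by rewrite big_nil addr0.
by rewrite /= act0 scl0 addr0 IH big_cons -addrA [X in _ + X]addrC.
Qed.

End Words.

Lemma actw_morph (A B : comPzRingType) (T : Type) (f : {rmorphism A -> B})
    (W : seq (T * seq (bool * nat))) (y : T -> A) (v : spin A) :
  (fun K => f (actw W y v K)) = actw W (fun t => f (y t)) (fun K => f (v K)).
Proof.
elim: W => //= tq W <-; rewrite -op_morph; apply: funext => K.
by rewrite !fctE /scl rmorphD rmorphM.
Qed.

Lemma dact_morph (A B : comPzRingType) (T : Type) (f : {rmorphism A -> B})
    (W : seq (T * seq (bool * nat))) (y dy : T -> A) (v dv : spin A) :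
  (fun K => f (dact W y dy v dv K)) =
  dact W (fun t => f (y t)) (fun t => f (dy t)) (fun K => f (v K)) (fun K => f (dv K)).
Proof.
elim: W => //= tq W <-; rewrite -(actw_morph f) -!op_morph; apply: funext => K.
by rewrite !fctE /scl !rmorphD !rmorphM.
Qed.

Definition nilquad (h : nat) (q : seq (bool * nat)) : bool :=
  if q is [:: x; y] then [&& x.2 < h, y.2 < h & ~~ pairing x y]%N else false.

Section Lie.
Variables (F : numFieldType) (h : nat).
Implicit Types (u v : spin F) (x y z w : bool * nat) (X Y : spin F -> spin F).

(** The scalars together with the orthogonal Lie algebra in its spin representation. *)
Inductive lie : (spin F -> spin F) -> Prop :=
| lie_id : lie id
| lie_quad x y : (x.2 < h)%N -> (y.2 < h)%N -> lie (op [:: x; y])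
| lie_add X Y : lie X -> lie Y -> lie (fun v => X v + Y v)
| lie_scl c X : lie X -> lie (fun v => scl c (X v)).

Lemma lieD X u v : lie X -> X (u + v) = X u + X v.
Proof.
move=> lX; elim: lX u v => [//|x y _ _|Z Y _ IX _ IY|c Z _ IX] u v; first exact: opD.
  by rewrite IX IY addrACA.
by rewrite IX sclD.
Qed.

Lemma lieZ X c v : lie X -> X (scl c v) = scl c (X v).
Proof.
move=> lX; elim: lX v => [//|x y _ _|Z Y _ IX _ IY|d Z _ IX] v; first exact: opZ.
  by rewrite IX IY sclD.
by rewrite IX !sclA mulrC.
Qed.

Lemma lie_eq X Y : X =1 Y -> lie X -> lie Y.
Proof. by move=> /funext ->. Qed.

Lemma lie_opp X : lie X -> lie (fun v => - X v).
Proof.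
move=> /(lie_scl (-1)); apply: lie_eq => v.
by rewrite sclNr scl1.
Qed.

Lemma lie0 : lie (fun=> 0).
Proof. by apply: lie_eq (lie_scl 0 lie_id) => v; rewrite scl0. Qed.

Lemma lie_if (b : bool) X : lie X -> lie (fun v => if b then X v else 0).
Proof. by case: b => // _; exact: lie0. Qed.

Lemma quad_bracket x y z w v :
  op [:: x; y] (op [:: z; w] v) - op [:: z; w] (op [:: x; y] v) =
  (if pairing y z then op [:: x; w] v else 0) - (if pairing y w then op [:: x; z] v else 0)
  + ((if pairing x z then op [:: w; y] v else 0) - (if pairing x w then op [:: z; y] v else 0)).
Proof.
have if_cl b a u : cl a (if b then u else 0) = if b then cl a u else 0.
  by case: b; rewrite ?cl0.
rewrite /op /=; rewrite (clC y z) clD clN if_cl (clC y w) clD clN if_cl clD clN if_cl.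
rewrite (clC x z (cl w (cl y v))) (clC x w (cl y v)) clD clN if_cl.
case: (pairing y z); case: (pairing y w); case: (pairing x z); case: (pairing x w);
  by apply: funext => K; rewrite !fctE /=; ring.
Qed.

Lemma lie_bracket X Y : lie X -> lie Y -> lie (fun v => X (Y v) - Y (X v)).
Proof.
move=> lX lY; elim: lX => [|x y xh yh|X1 X2 lX1 I1 lX2 I2|c X1 lX1 I1].
- by apply: lie_eq lie0 => v; rewrite subrr.
- elim: lY => [|z w zh wh|Y1 Y2 _ I1 _ I2|c Y1 lY1 I1].
  + by apply: lie_eq lie0 => v; rewrite subrr.
  + apply: lie_eq (fun v => esym (quad_bracket x y z w v)) _.
    by apply: lie_add; apply: lie_add; do ?apply: lie_opp; apply: lie_if; apply: lie_quad.
  + by apply: lie_eq (lie_add I1 I2) => v; rewrite opD opprD addrACA.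
  + by apply: lie_eq (lie_scl c I1) => v; rewrite opZ sclD sclrN.
- by apply: lie_eq (lie_add I1 I2) => v; rewrite (lieD _ _ lY) opprD addrACA.
- by apply: lie_eq (lie_scl c I1) => v; rewrite (lieZ _ _ lY) sclD sclrN.
Qed.

Lemma pairingC x y : pairing x y = pairing y x.
Proof. by rewrite /pairing (eq_sym x.2) (eq_sym x.1). Qed.

Lemma nilp_sq q v : nilquad h q -> op q (op q v) = 0.
Proof.
case: q => [|x [|y [|z q]]] //= /and3P[_ _ npair].
by rewrite /op /= (clC y x) pairingC (negPf npair) sub0r !clN cl_sq oppr0.
Qed.

Lemma nilp_lie q : nilquad h q -> lie (op q).
Proof. by case: q => [|x [|y [|z q]]] //= /and3P[xh yh _]; apply: lie_quad. Qed.

(* Conjugation by [1 + t q], whose inverse is [1 - t q] as [q^2 = 0]. *)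
Lemma lie_conj q t X : nilquad h q -> lie X ->
  exists2 X', lie X' & forall v, X (v + scl t (op q v)) = X' v + scl t (op q (X' v)).
Proof.
move=> nq lX; have lq := nilp_lie nq.
have l1 := lie_bracket lX lq; have l2 := lie_bracket l1 lq.
pose X' v := X (v + scl t (op q v)) - scl t (op q (X (v + scl t (op q v)))).
exists X' => [|v]; last first.
  by rewrite /X' opD opN opZ nilp_sq // sclr0 oppr0 addr0 subrK.
(* Because [q^2 = 0], the double bracket [[[X, q], q]] is [- 2 q X q]; so [(1 - t q) X (1 + t q)] is
   a combination of [X] and its first two brackets with [q]. *)
have E v : X v + scl t (X (op q v) - op q (X v)) + scl (t ^+ 2 / 2%:R)
    (X (op q (op q v)) - op q (X (op q v)) - op q (X (op q v) - op q (X v))) = X' v.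
  have X0 : X 0 = 0 by have := lieZ 0 0 lX; rewrite !scl0.
  rewrite nilp_sq // X0 sub0r.
  rewrite opD opN nilp_sq // oppr0 addr0 /X' (lieD _ _ lX) (lieZ _ _ lX) opD opZ.
  apply: funext => K; rewrite !fctE /scl /= ?fctE.
  by field.
apply: lie_eq E _; apply: lie_add; last exact: lie_scl.
by apply: lie_add => //; exact: lie_scl.
Qed.

Lemma lie_actw (T : Type) (W : seq (T * seq (bool * nat))) (y : T -> F) X :
  all (fun tq => nilquad h tq.2) W -> lie X ->
  exists2 X', lie X' & forall v, X (actw W y v) = actw W y (X' v).
Proof.
elim: W X => [|tq W IH] X /=; first by exists X.
case/andP => nq nW lX; have [X1 lX1 E1] := lie_conj (y tq.1) nq lX.
have [X2 lX2 E2] := IH X1 nW lX1; exists X2 => // v.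
by rewrite E1 E2.
Qed.

Lemma dact_lie (T : Type) (W : seq (T * seq (bool * nat))) (y dy : T -> F) :
  all (fun tq => nilquad h tq.2) W ->
  exists2 X, lie X & forall v dv, dact W y dy v dv = actw W y (X v + dv).
Proof.
elim: W => [|tq W IH] /=.
  by exists (fun=> 0) => [|v dv]; [exact: lie0 | rewrite add0r].
case/andP => nq nW; have [X1 lX1 E1] := IH nW.
have [X2 lX2 E2] := lie_actw y nW (nilp_lie nq).
exists (fun v => X1 v + scl (dy tq.1) (X2 v)) => [|v dv].
  by apply: lie_add => //; exact: lie_scl.
have -> : actw W y (X1 v + scl (dy tq.1) (X2 v) + dv) =
    actw W y (X1 v + dv) + scl (dy tq.1) (op tq.2 (actw W y v)).
  by rewrite addrAC actwD actwZ -E2.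
by rewrite E1 opD opZ nilp_sq // sclr0 addr0.
Qed.

End Lie.

Section GradedMatrices.
Variables (F : numFieldType) (h : nat).
Local Notation n := (num_even_subsets h).

Lemma odd_crd_tog a (K : nat -> bool) : (a < h)%N -> odd (crd h (tog a K)) = ~~ odd (crd h K).
Proof.
move=> ah; case Ka: (K a); first by rewrite (crd_tog ah Ka) /= negbK.
have : tog a K a by rewrite /tog eqxx addbT Ka.
by move/(crd_tog ah); rewrite togK => ->.
Qed.

Lemma quad_mat x y : (x.2 < h)%N -> (y.2 < h)%N ->
  exists M : 'M[F]_n, forall u, rv h (op [:: x; y] u) = rv h u *m M.
Proof.
move=> xh yh.
have ex (j : 'I_n) : exists j' : 'I_n, key j' = tog y.2 (tog x.2 (key j)).
  apply: key_exists => [i|]; last by rewrite !odd_crd_tog // negbK key_even.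
  rewrite /tog; have [->//|_] := eqVneq i y.2; have [->//|_] := eqVneq i x.2.
  by rewrite !addbF; exact: key_lt.
pose jj j := projT1 (cid (ex j)).
have Ej j : key (jj j) = tog y.2 (tog x.2 (key j)) := projT2 (cid (ex j)).
pose c (j : 'I_n) : F :=
  if (key j x.2 == x.1) && (tog x.2 (key j) y.2 == y.1)
  then sg (par x.2 (key j)) (sg (par y.2 (tog x.2 (key j))) 1) else 0.
exists (\matrix_(i, j) (if i == jj j then c j else 0)) => u.
apply/rowP => j; rewrite !mxE (bigD1 (jj j)) //= big1 ?addr0 => [|i ni]; last first.
  by rewrite !mxE (negPf ni) mulr0.
rewrite !mxE eqxx Ej /op /= /cl /c; case: (_ == x.1) => /=; last by rewrite mulr0.
case: ifP => _; last by rewrite sg0 mulr0.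
by case: (par x.2 _); case: (par y.2 _); rewrite /= ?opprK ?mulrN1 ?mulr1 ?opprK.
Qed.

Lemma actw_mat (T : Type) (W : seq (T * seq (bool * nat))) (y : T -> F) :
  all (fun tq => nilquad h tq.2) W ->
  exists M : 'M[F]_n, forall u, rv h (actw W y u) = rv h u *m M.
Proof.
elim: W => [|[t q] W IH] /=; first by exists 1%:M => u; rewrite mulmx1.
case/andP=> nq /IH[M EM].
have [N EN] : exists N : 'M[F]_n, forall u, rv h (op q u) = rv h u *m N.
  by case: q nq => [|x [|z [|? ?]]] //= /and3P[xh zh _]; exact: quad_mat.
exists (M + y t *: (M *m N)) => u.
by rewrite rvD rvZ EN EM mulmxDr -scalemxAr mulmxA.
Qed.

Lemma lie_span (k : nat) (N : 'M[F]_(k, n)) v X :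
  (rv h v <= N)%MS ->
  (forall x y, (x.2 < h)%N -> (y.2 < h)%N -> (rv h (op [:: x; y] v) <= N)%MS) ->
  lie h X -> (rv h (X v) <= N)%MS.
Proof.
move=> vN qN; elim => [//|x y xh yh|X1 X2 _ I1 _ I2|c X1 _ I1]; first exact: qN.
  by rewrite rvD addmx_sub.
by rewrite rvZ scalemx_sub.
Qed.

End GradedMatrices.

(** * Invariance of the closed spinor cone under the group *)

Section Flow.
Variables (F : numFieldType) (n : nat) (C : set 'rV[F]_n) (M : 'M[F]_n).
Hypothesis M_sq : forall v, C v -> v *m M *m M = 0.
Hypothesis M_tangent : forall f, vanish_on f C -> forall v, C v ->
  \sum_j f^`M(j).@[v 0] * (v *m M) 0 j = 0.

Lemma deriv_eq0_const (p : {poly F}) : p^`() = 0 -> p = (p.[0])%:P.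
Proof.
move=> dp; apply/polyP => -[|i]; rewrite coefC /= ?horner_coef0 //.
have := congr1 (fun q : {poly F} => q`_i) dp; rewrite coef_deriv coef0 => /eqP.
by rewrite mulrn_eq0 => /eqP.
Qed.

(* [g] is the derivative of [f] along the linear vector field [M]; as
   [exp (t M) = 1 + t M] on [C], all [t]-derivatives of [f (exp (t M) v)] vanish
   at [t = 0]. *)
Lemma flow_vanish f v : vanish_on f C -> C v ->
  line_restrict (v 0) ((v *m M) 0) f = 0.
Proof.
move=> + Cv; have [B] := ubnP (size (line_restrict (v 0) ((v *m M) 0) f)).
elim: B f => // B IH f sf f0; set P := line_restrict _ _ f in sf *.
pose g : {mpoly F[n]} := \sum_j f^`M(j) * \sum_i M i j *: 'X_i.
have g0 : vanish_on g C.
  move=> w Cw; rewrite -[RHS](M_tangent f0 Cw) raddf_sum /=.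
  apply: eq_bigr => j _; rewrite mevalM; congr (_ * _); rewrite raddf_sum mxE /=.
  by apply: eq_bigr => i _; rewrite mevalZ mevalXU mulrC.
have dP : P^`() = line_restrict (v 0) ((v *m M) 0) g.
  rewrite deriv_line_restrict /line_restrict raddf_sum /=; apply: eq_bigr => j _.
  rewrite rmorphM /=; congr (_ * _).
  rewrite -!/(line_restrict _ _ _).
  have vMM : (v *m M *m M) 0 j = 0 by rewrite M_sq // mxE.
  rewrite /line_restrict raddf_sum /=.
  under eq_bigr do rewrite mmapZ mmapX mmap1U mulrDr mulrA -!polyCM.
  rewrite big_split /= -mulr_suml -!raddf_sum /=.
  have -> : \sum_i M i j * (v *m M) 0 i = 0.
    by rewrite -[RHS]vMM mxE; apply: eq_bigr => i _; rewrite mulrC.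
  rewrite mul0r addr0 mxE; congr (_%:P).
  by apply: eq_bigr => i _; rewrite mulrC.
have dP0 : P^`() = 0.
  have [P0|nP0] := eqVneq P 0; first by rewrite P0 deriv0.
  rewrite dP; apply: IH g0; rewrite -dP; apply: leq_trans (lt_size_deriv nP0) _.
  by rewrite -ltnS.
rewrite (deriv_eq0_const dP0) horner_line_restrict.
rewrite (meval_eq (v2 := v 0)); first by rewrite f0.
by move=> j; rewrite mul0r addr0.
Qed.

Lemma acl_flow v t : acl C v -> acl C (v + t *: (v *m M)).
Proof.
move=> Cv f f0; have [g Eg] := affine_subst (1%:M + t *: M) 0 f.
have E w : w + t *: (w *m M) = w *m (1%:M + t *: M) + 0.
  by rewrite addr0 mulmxDr mulmx1 scalemxAr.
rewrite E -Eg; apply: Cv => w Cw; rewrite Eg -E.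
have := congr1 (fun p : {poly F} => p.[t]) (flow_vanish f0 Cw).
rewrite horner0 horner_line_restrict => E0; rewrite -[RHS]E0.
by apply: meval_eq => j; rewrite !mxE.
Qed.

End Flow.

Section Tangency.
Variables (F : numFieldType) (h : nat).
Local Notation n := (num_even_subsets h).
Implicit Types (u v : spin F).

Lemma expps_add (ps : seq (nat * nat)) (x : nat * nat -> F) p s v :
  uniq ps -> p \in ps ->
  expps ps (fun p' => x p' + s * (p' == p)%:R) v =
  expps ps x v + scl s (op (ee p) (expps ps x v)).
Proof.
elim: ps => //= p0 ps IH /andP[np0 uq]; rewrite inE => /predU1P[->|pin].
  rewrite eqxx mulr1 (expps_ext (y := x)) => [|q qin]; last first.
    by case: eqP => [Eqp|_]; rewrite ?mulr0 ?addr0 //; rewrite -Eqp qin in np0.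
  set u := expps ps x v; rewrite scl_addl opD opZ ee_sq sclr0 addr0.
  by rewrite addrA.
have -> : (p0 == p) = false by apply: contraNF np0 => /eqP ->.
rewrite mulr0 addr0 IH //; set u := expps ps x v.
rewrite !opD !opZ !sclD !sclA (eeC p0 p) [x p0 * s]mulrC.
by rewrite addrACA.
Qed.

(** The vectors that annihilate a pure spinor form a maximal isotropic subspace, which for the
    exponential of a two-form is a graph over the contractions; hence each contraction acts on it as
    an exterior product. *)
Lemma contract_pure (ps : seq (nat * nat)) (x : nat * nat -> F) (k : nat) :
  (k < h)%N -> all (fun p => (p.1 < h)%N && (p.2 < h)%N) ps ->
  exists f : nat -> F, cl (false, k) (expps ps x (vac F h)) =
    \sum_(a <- iota 0 h) scl (f a) (cl (true, a) (expps ps x (vac F h))).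
Proof.
move=> kh; elim: ps => [_|[i j] ps IH] /=.
  exists (fun=> 0); rewrite big1 => [|a _]; last exact: scl0.
  apply: funext => K; rewrite /cl /vac /=; case: eqP => // Kk.
  case: hasP => [_|[]]; first by rewrite sg0.
  by exists k; rewrite ?mem_iota //= /tog eqxx Kk.
case/andP => /andP[/= ih jh] /IH[f Ef]; set u := expps ps x (vac F h) in Ef *.
pose d (a b : nat) : F := (a == b)%:R.
have sumd c (g : nat -> spin F) : (c < h)%N ->
    \sum_(a <- iota 0 h) scl (d a c) (g a) = g c.
  move=> ch; rewrite (bigD1_seq c) ?iota_uniq ?mem_iota //= /d eqxx scl1.
  by rewrite big1 ?addr0 // => a /negPf ->; rewrite scl0.
(* Commuting the contraction past [x e_i e_j] leaves [x (d_ki e_j - d_kj e_i)], the contraction of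
   the new summand of the two-form. *)
exists (fun a => f a + x (i, j) * (d k i * d a j - d k j * d a i)).
set u' := u + _.
have ee0 a u0 : (a == i) || (a == j) -> cl (true, a) (op (ee (i, j)) u0) = 0 :> spin F.
  rewrite /op /ee /=; case/orP => /eqP ->; first exact: cl_sq.
  by rewrite clC /pairing /= andbF sub0r cl_sq cl0 oppr0.
have eC a : cl (true, a) (op (ee (i, j)) u) = op (ee (i, j)) (cl (true, a) u).
  rewrite /op /ee /= (clC (true, a) (true, i)) (clC (true, a) (true, j)) /pairing /=.
  by rewrite !andbF !sub0r !clN opprK.
have -> : cl (false, k) u' = cl (false, k) u + scl (x (i, j)) (op (ee (i, j)) (cl (false, k) u))
    + scl (x (i, j)) (scl (d k i) (cl (true, j) u) - scl (d k j) (cl (true, i) u)).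
  rewrite /u' clD clZ -addrA -sclD; congr (_ + scl _ _).
  have cl_if (b : bool) (w : spin F) c :
      cl (true, c) (if b then w else 0) = if b then cl (true, c) w else 0.
    by case: b; rewrite ?cl0.
  rewrite /op /ee /= (clC (false, k) (true, i)) (clC (false, k) (true, j)) /pairing /= !andbT.
  rewrite clD clN cl_if opprD opprK addrA addrC; congr (_ + _).
  by rewrite /d; case: eqP; case: eqP; rewrite ?scl1 ?scl0 ?subr0.
rewrite Ef op_sum scl_sum -big_split /=.
have e' a : cl (true, a) u' = cl (true, a) u + scl (x (i, j)) (op (ee (i, j)) (cl (true, a) u)).
  by rewrite /u' clD clZ eC.
under [RHS]eq_bigr do rewrite scl_addl.
rewrite [RHS]big_split /=; congr (_ + _).
  by apply: eq_bigr => a _; rewrite e' sclD opZ !sclA mulrC.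
under eq_bigr do rewrite -sclA.
rewrite -scl_sum; congr (scl _ _).
have eu a : (a == i) || (a == j) -> cl (true, a) u' = cl (true, a) u.
  by move=> aij; rewrite /u' clD clZ ee0 // sclr0 addr0.
have -> : \sum_(a <- iota 0 h) scl (d k i * d a j - d k j * d a i) (cl (true, a) u') =
    \sum_(a <- iota 0 h) scl (d a j) (scl (d k i) (cl (true, a) u')) -
    \sum_(a <- iota 0 h) scl (d a i) (scl (d k j) (cl (true, a) u')).
  rewrite -sumrB; apply: eq_bigr => a _.
  by rewrite !sclA scl_addl sclNr [d a j * _]mulrC [d a i * _]mulrC.
by rewrite !sumd // !eu ?eqxx ?orbT.
Qed.

(** Contractions are turned into exterior products by [contract_pure], after a Clifford commutator
    that only adds multiples of the point [V]. The remaining vectors [V] and [e_i e_j V] are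
    directions of straight lines inside the cone. *)
Lemma cone_tangent (f : {mpoly F[n]}) (x : nat * nat -> F) (c : F) a b :
  vanish_on f (spinor_cone F h) -> (a.2 < h)%N -> (b.2 < h)%N ->
  \sum_j f^`M(j).@[rv h (scl c (pure h x)) 0] *
    rv h (op [:: a; b] (scl c (pure h x))) 0 j = 0.
Proof.
move=> f0; set V := scl c (pure h x).
pose dl (u : spin F) := \sum_j f^`M(j).@[rv h V 0] * rv h u 0 j.
have dlD u v : dl (u + v) = dl u + dl v.
  by rewrite -big_split; apply: eq_bigr => j _; rewrite /= !mxE -mulrDr.
have dlZ d u : dl (scl d u) = d * dl u.
  by rewrite mulr_sumr; apply: eq_bigr => j _; rewrite !mxE mulrCA.
have dl0 : dl 0 = 0 by rewrite -(scl0 0) dlZ mul0r.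
have dlN u : dl (- u) = - dl u.
  by rewrite -(scl1 (- u)) sclrN -sclNr dlZ mulN1r.
have dl_sum (r : seq nat) (g : nat -> spin F) : (forall i, i \in r -> dl (g i) = 0) ->
    dl (\sum_(i <- r) g i) = 0.
  elim: r => [|i r IH] gi; first by rewrite big_nil.
  rewrite big_cons dlD gi ?mem_head // IH ?addr0 // => l lr.
  by apply: gi; rewrite inE lr orbT.
have line u : (forall s, spinor_cone F h (rv h (V + scl s u))) -> dl u = 0.
  move=> Cu; have : line_restrict (rv h V 0) (rv h u 0) f = 0.
    apply: poly_eq0_eval => s; rewrite horner_line_restrict -[RHS](f0 _ (Cu s)).
    by apply: meval_eq => j; rewrite !mxE.
  move/(congr1 (fun p : {poly F} => p^`().[0])); rewrite deriv0 horner0.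
  rewrite deriv_line_restrict horner_sum => E; rewrite -[RHS]E.
  apply: eq_bigr => j _; rewrite hornerM hornerC horner_line_restrict; congr (_ * _).
  by apply: meval_eq => l; rewrite mul0r addr0.
have dV : dl V = 0.
  apply: line => s; exists (c + s * c, x) => //=.
  by rewrite scl_addl /V sclA.
have dee_prs p : p \in prs h -> dl (op (ee p) V) = 0.
  move=> pin; apply: line => s; exists (c, fun p' => x p' + s * (p' == p)%:R) => //=.
  rewrite /pure expps_add ?uniq_prs // sclD -/(pure h x) -/V; congr (rv _ (_ + _)).
  by rewrite /V opZ !sclA mulrC.
have anti i j : op (ee (i, j)) V = - op (ee (j, i)) V.
  by rewrite /op /ee /= clC /pairing /= andbF sub0r.
have dee i j : (i < h)%N -> (j < h)%N -> dl (cl (true, i) (cl (true, j) V)) = 0.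
  move=> ih jh; rewrite -[cl _ _]/(op (ee (i, j)) V); case: (ltngtP i j) => [ij|ji|->].
  - by apply: dee_prs; rewrite mem_prs ij.
  - by rewrite anti dlN dee_prs ?oppr0 // mem_prs ji.
  - by rewrite /op /ee /= cl_sq.
have contr k : (k < h)%N -> exists g : nat -> F,
    cl (false, k) V = \sum_(a <- iota 0 h) scl (g a) (cl (true, a) V).
  move=> kh; have [|g Eg] := @contract_pure (prs h) x k kh.
    apply/allP => -[i j]; rewrite mem_prs /= => /andP[ij jh].
    by rewrite jh (ltn_trans ij jh).
  exists g; rewrite /V clZ /pure Eg scl_sum; apply: eq_bigr => i _.
  by rewrite clZ !sclA mulrC.
have dei i k : (i < h)%N -> (k < h)%N -> dl (cl (true, i) (cl (false, k) V)) = 0.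
  move=> ih kh; have [g ->] := contr k kh.
  rewrite -[cl _ _]/(op [:: (true, i)] _) op_sum; apply: dl_sum => l.
  by rewrite mem_iota => lh; rewrite opZ dlZ dee ?mulr0.
have die k i : (k < h)%N -> (i < h)%N -> dl (cl (false, k) (cl (true, i) V)) = 0.
  move=> kh ih; rewrite clC dlD dlN dei // oppr0 addr0.
  by case: ifP.
case: a => [[] i] /=; case: b => [[] k] /= ih kh; rewrite -/(dl _) /op /=.
- exact: dee.
- exact: dei.
- exact: die.
have [g ->] := contr k kh.
rewrite -[cl _ _]/(op [:: (false, i)] _) op_sum; apply: dl_sum => l.
by rewrite mem_iota => lh; rewrite opZ dlZ die ?mulr0.
Qed.

(** The closure appears because an element [1 + s q] with contractions can move a point out of the
    parametrized cell. *)
Lemma acl_op q s v : nilquad h q -> acl (spinor_cone F h) (rv h v) ->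
  acl (spinor_cone F h) (rv h (v + scl s (op q v))).
Proof.
move=> nq; have sq (u : spin F) := nilp_sq u nq.
case: q nq sq => [|a [|b [|? ?]]] //= /and3P[ah bh nab] sq.
have [M EM] := quad_mat F ah bh.
rewrite rvD rvZ EM; apply: acl_flow => [w [[c x] _ <-]|f f0 w [[c x] _ <-]] /=.
  by rewrite -!EM sq; apply/rowP => j; rewrite !mxE.
by rewrite -EM; exact: cone_tangent.
Qed.

(** The empty word is the identity operator; a letter with it rescales by [1 + y]. *)
Definition okq (q : seq (bool * nat)) : bool := (q == [::]) || nilquad h q.

Lemma acl_actw (T : Type) (W : seq (T * seq (bool * nat))) (y : T -> F) v :
  all (fun tq => okq tq.2) W -> acl (spinor_cone F h) (rv h v) ->
  acl (spinor_cone F h) (rv h (actw W y v)).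
Proof.
move=> + Cv; elim: W => //= tq W IH /andP[/orP[/eqP q0|nq] /IH Cu]; last exact: acl_op.
rewrite q0 /op /= -[X in X + _]scl1 -scl_addl rvZ.
apply: scaling_acl => //; exact: scaling_spinor_cone.
Qed.

End Tangency.

(** * Orbits *)

Section WordPolynomials.
Variables (F : numFieldType) (h : nat) (T : finType).
Local Notation n := (num_even_subsets h).
Local Notation A := {mpoly F[#|T|]}.

Definition cst_spin (v : spin F) : spin A := fun K => (v K)%:MP.

Definition var (t : T) : A := 'X_(enum_rank t).

Lemma meval_var a t : (var t).@[a] = a (enum_rank t).
Proof. exact: mevalXU. Qed.

Lemma mderiv_var s t : (var t)^`M(enum_rank s) = (s == t)%:R.
Proof.
by rewrite mderivU (inj_eq enum_rank_inj) eq_sym.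
Qed.

Lemma meval_actw (W : seq (T * seq (bool * nat))) (v : spin A) a K :
  (actw W var v K).@[a] = actw W (fun t => a (enum_rank t)) (fun K => (v K).@[a]) K.
Proof.
have /(congr1 (fun g => g K)) /= -> := actw_morph (meval a) W var v.
by congr (actw _ _ _ K); apply: funext => t; rewrite meval_var.
Qed.

Lemma mderiv_actw (W : seq (T * seq (bool * nat))) (v : spin A) a s K :
  ((actw W var v K)^`M(enum_rank s)).@[a] =
  dact W (fun t => a (enum_rank t)) (fun t => (s == t)%:R)
    (fun K => (v K).@[a]) (fun K => ((v K)^`M(enum_rank s)).@[a]) K.
Proof.
have /(congr1 (fun g => g K)) /= -> :=
  @actw_deriv _ _ (mderiv (enum_rank s)) W var v (@mderivM _ _ _).
have /(congr1 (fun g => g K)) /= -> := dact_morph (meval a) W var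
  (fun t => (var t)^`M(enum_rank s)) v (fun K => (v K)^`M(enum_rank s)).
congr (dact _ _ _ _ _ K); apply: funext => t; first by rewrite meval_var.
by rewrite mderiv_var rmorph_nat.
Qed.

End WordPolynomials.

Section TupleEmbedding.
Variables (F : numFieldType) (h k : nat).
Local Notation n := (num_even_subsets h).
Local Notation N := #|{: 'I_k * 'I_n}|.

Definition emb (i : 'I_k) : 'M[F]_(n, N) := \matrix_(j, t) ((i, j) == enum_val t)%:R.

Lemma embE (w : 'I_k -> 'rV[F]_n) t :
  (\sum_i w i *m emb i) 0 t = w (enum_val t).1 0 (enum_val t).2.
Proof.
rewrite summxE (bigD1 (enum_val t).1) //= big1 ?addr0 => [|i ni].
  rewrite mxE (bigD1 (enum_val t).2) //= big1 ?addr0 => [|j nj].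
    by rewrite mxE -surjective_pairing eqxx mulr1.
  rewrite mxE; case: eqP => [E|_]; last by rewrite mulr0.
  by rewrite -E eqxx in nj.
rewrite mxE big1 // => j _; rewrite mxE; case: eqP => [E|_]; last by rewrite mulr0.
by rewrite -E eqxx in ni.
Qed.

(** Density is tested on tuples and not on their sums: in the defective cases the sum map has a rank
    below the number of its parameters, so the rank condition of [dense_by_rank] could never hold
    for sums. *)
Definition phi_tuple (t : 'I_N) : {mpoly F[#|par_type h k|]} :=
  scl (var F ((enum_val t).1, ord0))
    (pure h (fun p => var F (pvar h (enum_val t).1 p))) (key (enum_val t).2).

Lemma im_phi_tuple : im phi_tuple = sum_set emb (spinor_cone F h).
Proof.
have E a : param_at phi_tuple a = \sum_i rv h (scl (a (enum_rank (i, ord0)))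
    (pure h (fun p => a (enum_rank (pvar h i p))))) *m emb i.
  apply/rowP => t; rewrite embE !mxE /phi_tuple /scl mevalM meval_var; congr (_ * _).
  have := expps_morph (meval a) (prs h) (fun p => var F (pvar h (enum_val t).1 p)) (vac _ h).
  move/(congr1 (fun g => g (key (enum_val t).2))) => /= ->; rewrite (vac_morph (meval a)).
  by congr (expps _ _ _ _); apply: funext => p; rewrite meval_var.
apply/seteqP; split=> [_ [a _ <-]|v [w Cw ->]].
  rewrite E; exists (fun i => rv h (scl (a (enum_rank (i, ord0)))
    (pure h (fun p => a (enum_rank (pvar h i p)))))) => // i.
  by exists (a (enum_rank (i, ord0)), fun p => a (enum_rank (pvar h i p))).
have [a Ea] := spinor_cone_params Cw; exists a => //.
by rewrite E; apply: eq_bigr => i _; rewrite Ea.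
Qed.

End TupleEmbedding.

Section OrbitBound.
Variables (F : numFieldType) (h k e l r : nat).
Local Notation n := (num_even_subsets h).
Local Notation N := #|{: 'I_k * 'I_n}|.
Variables (gw : seq (seq (bool * nat))) (ext : 'I_k -> seq ('I_e * seq (bool * nat))).
Variables (v : 'I_k -> spin F) (L : 'I_l -> spin F).

Definition lsum (z : 'I_l -> F) : spin F := \sum_m scl (z m) (L m).

(** The motions of a tuple: one for each group generator, acting on all points at once, and [e] for
    moving the points within the normal form. *)
Definition dir : finType := ('I_(size gw) + 'I_e)%type.

Definition tangent_tuple (s : dir) (i : 'I_k) : spin F :=
  match s with
  | inl a => op (nth [::] gw a) (v i)
  | inr b => \sum_(tq <- ext i | tq.1 == b) op tq.2 (v i)
  end.

Definition tangent_mx : 'M[F]_(#|dir|, N) :=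
  \matrix_(s, t) tangent_tuple (enum_val s) (enum_val t).1 (key (enum_val t).2).

Hypothesis gw_nil : all (nilquad h) gw.
Hypothesis ext_ok : forall i, all (fun tq => okq h tq.2) (ext i).
Hypothesis v_cone : forall i, acl (spinor_cone F h) (rv h (v i)).
Hypothesis tuple_rank : (#|par_type h k| <= \rank tangent_mx)%N.
Hypothesis sum_in_L : forall y : 'I_e -> F, exists z : 'I_l -> F,
  rv h (\sum_i actw (ext i) y (v i)) = rv h (lsum z).
Hypothesis orbit_rank : forall z : 'I_l -> F, exists X : 'M[F]_(r, n),
  (forall m, (rv h (L m) <= X)%MS) /\
  (forall x y, (x.2 < h)%N -> (y.2 < h)%N ->
     (rv h (op [:: x; y] (lsum z)) <= X)%MS).

Let gW (T : Type) (f : 'I_(size gw) -> T) : seq (T * seq (bool * nat)) :=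
  [seq (f a, nth [::] gw a) | a <- enum 'I_(size gw)].

Let gW_nil (T : Type) (f : 'I_(size gw) -> T) : all (fun tq => nilquad h tq.2) (gW f).
Proof.
rewrite /gW all_map; apply/allP => a _ /=.
by apply: (allP gw_nil); rewrite mem_nth.
Qed.

Definition psi_tuple (t : 'I_N) : {mpoly F[#|dir|]} :=
  actw (gW inl ++ [seq (inr tq.1, tq.2) | tq <- ext (enum_val t).1]) (@var F dir)
    (@cst_spin F dir (v (enum_val t).1)) (key (enum_val t).2).

Definition psi_var : finType := ('I_(size gw) + 'I_l)%type.

Definition psi (j : 'I_n) : {mpoly F[#|psi_var|]} :=
  actw (gW inl) (@var F psi_var)
    (\sum_m scl (var F (inr m : psi_var)) (@cst_spin F psi_var (L m))) (key j).

Lemma param_at_psi_tuple a : param_at psi_tuple a =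
  \sum_i rv h (actw (gW inl) (fun t => a (enum_rank t))
    (actw (ext i) (fun b => a (enum_rank (inr b : dir))) (v i))) *m emb F h i.
Proof.
apply/rowP => t; rewrite embE !mxE /psi_tuple meval_actw actw_cat.
congr (actw _ _ _ _).
have -> : (fun K => (cst_spin _ (v (enum_val t).1) K).@[a]) = v (enum_val t).1.
  by apply: funext => K; rewrite /cst_spin mevalC.
by elim: (ext _) => //= tq W ->.
Qed.

Lemma param_at_psi a : param_at psi a =
  rv h (actw (gW inl) (fun t => a (enum_rank t)) (lsum (fun m => a (enum_rank (inr m : psi_var))))).
Proof.
apply/rowP => j; rewrite !mxE /psi meval_actw; congr (actw _ _ _ _).
apply: funext => K; rewrite /lsum !spin_sumE raddf_sum; apply: eq_bigr => m _.
by rewrite /= /scl mevalM meval_var mevalC.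
Qed.

(** At the zero parameter all words are the identity, so the Jacobian there is [tangent_mx] and one
    rank computation gives density. *)
Lemma tuple_dense : im (@phi_tuple F h k) `<=` acl (im psi_tuple).
Proof.
apply: (@dense_by_rank _ _ _ _ _ _ (fun=> 0)).
  move=> _ [a _ <-]; rewrite im_phi_tuple param_at_psi_tuple; apply: acl_sum => i.
  apply: acl_actw; last exact: acl_actw.
  by apply: sub_all (gW_nil _) => tq nq; rewrite /okq nq orbT.
apply: leq_trans tuple_rank _; rewrite (_ : tangent_mx = jac psi_tuple (fun=> 0)) //.
apply/matrixP => s t; rewrite !mxE -[s in RHS]enum_valK mderiv_actw.
have -> : (fun K => (@cst_spin F dir (v (enum_val t).1) K).@[fun=> 0]) = v (enum_val t).1.
  by apply: funext => K; rewrite /cst_spin mevalC.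
have -> : (fun K => ((@cst_spin F dir (v (enum_val t).1) K)^`M(enum_rank (enum_val s))).@[fun=> 0])
    = 0.
  by apply: funext => K; rewrite /cst_spin mderivC meval0.
rewrite dact0 add0r big_cat /= !big_map /tangent_tuple.
have scl_b (b : bool) (w : spin F) : scl b%:R w = if b then w else 0.
  by case: b; rewrite ?scl1 ?scl0.
case: (enum_val s) => [a|b].
  rewrite [X in _ + X]big1 ?addr0 => [|tq _]; last by rewrite scl_b.
  rewrite (bigD1_seq a) /=; [|by rewrite -enumT mem_enum | by rewrite -enumT enum_uniq].
  rewrite scl_b eqxx big1 ?addr0 // => a' na.
  by rewrite scl_b; case: eqP => [[E]|//]; rewrite E eqxx in na.
rewrite [X in (X + _) _]big1 ?add0r => [|tq _]; last by rewrite scl_b.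
rewrite big_mkcond /= !spin_sumE; apply: eq_bigr => tq _.
by rewrite scl_b eq_sym.
Qed.

(** The group word is linear and common to all points, so the sum of a moved tuple is the moved sum,
    and [sum_in_L] places it in the image of [psi]. Density of the tuples passes to sums along the
    linear map [S]. *)
Lemma chi_sub_orbit : im (@chi F h k) `<=` acl (im psi).
Proof.
move=> _ [a _ <-] f fpsi.
pose S : 'M[F]_(N, n) := \matrix_(t, j) ((enum_val t).2 == j)%:R.
have ES (w : 'I_k -> 'rV[F]_n) : (\sum_i w i *m emb F h i) *m S = \sum_i w i.
  rewrite mulmx_suml; apply: eq_bigr => i _; rewrite -mulmxA (_ : emb F h i *m S = 1%:M) ?mulmx1 //.
  apply/matrixP => j0 j; rewrite !mxE (bigD1 (enum_rank (i, j0))) //= big1 ?addr0.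
    by rewrite !mxE !enum_rankK eqxx mul1r.
  move=> t nt; rewrite !mxE; case: eqP => [E|_]; last by rewrite mul0r.
  by rewrite E enum_valK eqxx in nt.
have [g Eg] := affine_subst S 0 f.
have im_psi : vanish_on g (im psi_tuple).
  move=> _ [b _ <-]; rewrite Eg addr0 param_at_psi_tuple ES.
  have [M EM] := actw_mat (fun t => b (enum_rank t)) (gW_nil (inl : _ -> dir)).
  have [z Ez] := sum_in_L (fun c => b (enum_rank (inr c : dir))).
  under eq_bigr do rewrite EM.
  rewrite -mulmx_suml -rv_sum Ez.
  pose b' (t : 'I_#|psi_var|) := match enum_val t with
    | inl c => b (enum_rank (inl c : dir)) | inr m => z m end.
  suff -> : rv h (lsum z) *m M = param_at psi b' by apply: fpsi; exists b'.
  rewrite param_at_psi -EM.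
  have -> : (fun m => b' (enum_rank (inr m : psi_var))) = z.
    by apply: funext => m; rewrite /b' enum_rankK.
  congr (rv h _); rewrite /gW; elim: (enum _) => //= c s ->.
  by rewrite /b' enum_rankK.
rewrite param_at_chi /secant_sum rv_sum.
pose w i := rv h (scl (a (enum_rank (i, ord0))) (pure h (fun p => a (enum_rank (pvar h i p))))).
have := tuple_dense; move=> /(_ (\sum_i w i *m emb F h i)).
rewrite im_phi_tuple => /(_ _ g im_psi); rewrite Eg ES addr0; apply.
exists w => // i.
by exists (a (enum_rank (i, ord0)), fun p => a (enum_rank (pvar h i p))).
Qed.

(** By [dact_lie] every derivative is the image, under the matrix [M] of the word, of a vector
    [Y l + dl] with [Y] in the Lie algebra and [l], [dl] in the span of [L]; all of these lie in the
    row space of [X]. *)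
Lemma rank_orbit b : (\rank (jac psi b) <= r)%N.
Proof.
pose z m := b (enum_rank (inr m : psi_var)).
have [X [LX qX]] := orbit_rank z.
have [M EM] := actw_mat (fun t => b (enum_rank t)) (gW_nil (inl : _ -> psi_var)).
suff sub : (jac psi b <= X *m M)%MS.
  apply: leq_trans (mxrankS sub) _; apply: leq_trans (mxrankM_maxl _ _) _.
  exact: rank_leq_row.
apply/row_subP => s.
pose dz := lsum (fun m => (enum_val s == inr m)%:R).
have [Y lY EY] := dact_lie (fun t => b (enum_rank t)) (fun t => (enum_val s == t)%:R)
  (gW_nil (inl : _ -> psi_var)).
have -> : row s (jac psi b) = rv h (Y (lsum z) + dz) *m M.
  rewrite -EM -EY; apply/rowP => j; rewrite !mxE -[s in LHS]enum_valK mderiv_actw.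
  congr (dact _ _ _ _ _ _); apply: funext => K; rewrite /dz /lsum !spin_sumE.
    rewrite raddf_sum; apply: eq_bigr => m _.
    by rewrite /= /scl mevalM meval_var mevalC.
  rewrite (raddf_sum (mderiv _)) (raddf_sum (meval _)); apply: eq_bigr => m _.
  by rewrite /= /scl mderivM mderivC mulr0 addr0 mevalM mevalC mderiv_var rmorph_nat.
apply: submxMr; rewrite rvD addmx_sub //.
  apply: lie_span lY => //; rewrite /lsum rv_sum.
  by apply: summx_sub => m _; rewrite rvZ scalemx_sub.
rewrite /dz /lsum rv_sum; apply: summx_sub => m _.
by rewrite rvZ scalemx_sub.
Qed.

End OrbitBound.

(** * Nondegeneracy *)

Section Nondegenerate.
Variables (F : numFieldType) (h : nat).
Local Notation n := (num_even_subsets h).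

Definition supp_lt (K : nat -> bool) : Prop := forall i, K i -> (i < h)%N.

Definition ops (ps : seq (nat * nat)) (v : spin F) : spin F :=
  foldl (fun u p => op (ee p) u) v ps.

Lemma key_inj : injective (@key h).
Proof.
move=> i j E; apply: enum_val_inj; apply: val_inj; apply/setP => t.
have := congr1 (fun K => K (val t)) E.
by rewrite /key /mem_nat valK.
Qed.

Lemma opsD ps u v : ops ps (u + v) = ops ps u + ops ps v.
Proof. by rewrite /ops; elim: ps u v => //= p ps IH u v; rewrite opD IH. Qed.

Lemma opsN ps u : ops ps (- u) = - ops ps u.
Proof. by rewrite /ops; elim: ps u => //= p ps IH u; rewrite opN IH. Qed.

Lemma crd_gt0 K : (0 < crd h K)%N -> exists2 a, (a < h)%N & K a.
Proof.
by rewrite -has_count => /hasP[a]; rewrite mem_iota => /= ah Ka; exists a.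
Qed.

(** The elements of [K] are adjoined to the empty set two at a time, which carries the vacuum to a
    multiple of the basis vector of [K]. *)
Lemma ops_delta m (K : nat -> bool) : supp_lt K -> crd h K = m.*2 ->
  exists2 ps, all (fun p => nilquad h (ee p)) ps &
    forall K', supp_lt K' -> (ops ps (vac F h) K' != 0 <-> K' = K).
Proof.
elim: m K => [|m IH] K Kh cK.
  exists [::] => // K' K'h; rewrite /= /vac; have K0 : K = fun=> false.
    apply: funext => i; apply/negbTE/negP => Ki.
    have := Kh i Ki => ih; suff : (0 < crd h K)%N by rewrite cK.
    by rewrite -has_count; apply/hasP; exists i; rewrite ?mem_iota.
  case: hasP => [[i _ K'i]|nK'].
    by rewrite eqxx; split=> // E; rewrite E K0 in K'i.
  rewrite oner_eq0 K0; split=> // _; apply: funext => i; apply/negbTE/negP => Ki.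
  by apply: nK'; exists i; rewrite ?mem_iota // K'h.
have [a ah Ka] : exists2 a, (a < h)%N & K a by apply: crd_gt0; rewrite cK.
have cKa : crd h (tog a K) = m.*2.+1.
  by have := crd_tog ah Ka; rewrite cK doubleS => -[].
have [b bh Kb] : exists2 b, (b < h)%N & tog a K b by apply: crd_gt0; rewrite cKa.
have cKab : crd h (tog b (tog a K)) = m.*2.
  by have := crd_tog bh Kb; rewrite cKa => -[].
have sub i : tog b (tog a K) i -> K i.
  rewrite /tog; have [->|nia] := eqVneq i a; first by rewrite Ka.
  have [Eib|_] := eqVneq i b; last by rewrite !addbF.
  by move: Kb; rewrite /tog -Eib (negPf nia) addbF => ->.
have [|ps psh Eps] := IH _ _ cKab; first by move=> i /sub /Kh.
exists (rcons ps (a, b)) => [|K' K'h].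
  by rewrite all_rcons psh /nilquad /= ah bh /pairing /= andbF.
rewrite /ops foldl_rcons -/(ops ps _) /op /ee /= /cl /=.
have sgn0 (s : bool) (x : F) : (sg s x != 0) = (x != 0).
  by case: s; rewrite //= oppr_eq0.
split=> [|->]; last first.
  rewrite Ka Kb /= !sgn0; apply/Eps => // i /sub; exact: Kh.
case K'a: (K' a) => /=; last by rewrite eqxx.
rewrite sgn0; case K'b: (tog a K' b) => /=; last by rewrite eqxx.
rewrite sgn0 => /Eps E; apply: (can_inj (togK a)); apply: (can_inj (togK b)).
apply: E => i; rewrite /tog.
have [->|_] := eqVneq i b; first by [].
by have [->|_] := eqVneq i a; rewrite ?addbF => //; exact: K'h.
Qed.

Lemma acl_subspace (C : set 'rV[F]_n) (H : {vspace 'rV[F]_n}) v :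
  (forall w, C w -> w \in H) -> acl C v -> v \in H.
Proof.
move=> CH Cv; pose g : 'End('rV[F]_n) := (\1 - projv H)%VF; pose M := lin1_mx g.
have EM w : w *m M = w - projv H w.
  by rewrite mul_rV_lin1 /g /= add_lfunE opp_lfunE id_lfunE.
have : v *m M = 0.
  apply/rowP => j; rewrite mxE [RHS]mxE.
  have := Cv (\sum_i M i j *: 'X_i); rewrite raddf_sum /= => H0.
  rewrite -[RHS]H0; first by apply: eq_bigr => i _; rewrite mevalZ mevalXU mulrC.
  move=> w Cw; rewrite raddf_sum /=; have := EM w.
  rewrite projv_id ?CH // subrr => /rowP/(_ j); rewrite !mxE => E; rewrite -[RHS]E.
  by apply: eq_bigr => i _; rewrite mevalZ mevalXU mulrC.
rewrite EM => /eqP; rewrite subr_eq0 => /eqP ->; exact: memv_proj.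
Qed.

Lemma cone_vac : spinor_cone F h (rv h (vac F h)).
Proof.
exists (1, fun=> 0) => //=; rewrite scl1; congr (rv h _).
by rewrite /pure; elim: (prs h) => //= p ps ->; rewrite scl0 addr0.
Qed.

Lemma rv_vac_neq0 : rv h (vac F h) != 0.
Proof.
have [//||j Ej] := @key_exists h (fun=> false).
  by rewrite /crd count_pred0.
apply/eqP => /rowP/(_ j); rewrite !mxE Ej /vac.
case: hasP => [[]//|_] /eqP; by rewrite oner_eq0.
Qed.

(** A subspace that contains the cone contains its closure, hence with [v] also [v + q v], and so
    [q v]. Starting from the vacuum this produces every basis vector, so the subspace is no
    hyperplane. *)
Lemma nondegenerate_spinor : Defs.nondegenerate (spinor_variety F h).
Proof.
rewrite spinor_variety_pz => H dH XH.
have CH w : spinor_cone F h w -> w \in H.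
  move=> Cw; have [->|nw] := eqVneq w 0; first exact: mem0v.
  have [p Ep] := line_point nw.
  by rewrite memvE -Ep; apply: XH; apply: sub_gen_smallest; exists w.
have opsH ps v : all (fun p => nilquad h (ee p)) ps ->
    acl (spinor_cone F h) (rv h v) -> rv h (ops ps v) \in H.
  elim: ps v => [|p ps IH] v /=; first by move=> _; exact: acl_subspace.
  case/andP => np nps Cv.
  have -> : op (ee p) v = (v + scl 1 (op (ee p) v)) + scl (-1) v.
    by rewrite scl1 sclNr scl1 addrAC subrr add0r.
  rewrite opsD rvD memvD //; first by apply: IH => //; exact: acl_op.
  rewrite sclNr scl1 opsN -(scl1 (- _)) sclrN -sclNr rvZ memvZ //.
  exact: IH.
have deltaH j : delta_mx 0 j \in H.
  have cj : crd h (key j) = (crd h (key j))./2.*2.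
    by rewrite -[LHS]odd_double_half (negPf (key_even j)).
  have [ps psh Eps] := ops_delta (@key_lt h j) cj.
  have Cv := sub_acl cone_vac; have := opsH ps _ psh Cv.
  set u := ops ps (vac F h) in Eps *; have nu : u (key j) != 0.
    by apply/Eps => //; exact: key_lt.
  have -> : rv h u = u (key j) *: delta_mx 0 j.
    apply/rowP => i; rewrite !mxE eqxx /=; have [->|nij] := eqVneq i j; first by rewrite mulr1.
    rewrite mulr0; apply/eqP; apply: contraNT nij => /Eps => /(_ (@key_lt h i)).
    by move/key_inj => ->.
  by move/(memvZ (u (key j))^-1); rewrite scalerK.
have : \dim H = n.
  have -> : H = fullv.
    apply/vspaceP => v; rewrite memvf [v]row_sum_delta; apply: memv_suml => j _.
    by rewrite memvZ.
  by rewrite dimvf /dim /= mul1n.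
have [j _] : exists j, rv h (vac F h) 0 j != 0 by apply/rV0Pn; exact: rv_vac_neq0.
have n0 : (0 < n)%N := leq_ltn_trans (leq0n j) (ltn_ord j).
by rewrite dH; move: n0; lia.
Qed.

End Nondegenerate.

(** * Independence and its certificates *)

Section Independence.
Variables (F : numFieldType) (k : nat) (xs : 'I_k -> nat * nat -> F).

Definition indep (h : nat) : Prop :=
  forall (c : 'I_k -> F) (y : 'I_k -> nat * nat -> F),
  (forall K, supp_lt h K -> ~~ odd (crd h K) ->
     \sum_i (c i * pure h (xs i) K +
             \sum_(p <- prs h) y i p * op (ee p) (pure h (xs i)) K) = 0) ->
  forall i, c i = 0 /\ (forall p, p \in prs h -> y i p = 0).

Definition odd_indep (h : nat) : Prop :=
  forall z : 'I_k -> nat -> F,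
  (forall K, supp_lt h K -> odd (crd h K) ->
     \sum_i \sum_(a <- iota 0 h) z i a * cl (true, a) (pure h (xs i)) K = 0) ->
  forall i a, (a < h)%N -> z i a = 0.

Section Step.
Variable h : nat.
Hypothesis xs0 : forall i a, xs i (a, h) = 0.

Lemma cl_agree (u w : spin F) a : (a < h)%N ->
  (forall K, ~~ K h -> u K = w K) -> forall K, ~~ K h -> cl (true, a) u K = cl (true, a) w K.
Proof.
move=> ah uw K Kh; rewrite /cl /=; case: ifP => // _; rewrite uw //.
by rewrite /tog eq_sym (ltn_eqF ah) addbF.
Qed.

Lemma ee_agree (u w : spin F) p : p \in prs h ->
  (forall K, ~~ K h -> u K = w K) -> forall K, ~~ K h -> op (ee p) u K = op (ee p) w K.
Proof.
case: p => a b; rewrite mem_prs => /andP[ab bh] uw; apply: cl_agree; first exact: ltn_trans bh.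
exact: cl_agree.
Qed.

Lemma pure_agree i K : ~~ K h -> pure h.+1 (xs i) K = pure h (xs i) K.
Proof.
move=> Kh; rewrite /pure prsS /expps foldr_cat.
set w := foldr _ _ [seq _ | _ <- _]; have -> : w = vac F h.+1.
  rewrite /w; elim: (iota 0 h) => //= a s ->.
  by rewrite xs0 scl0 addr0.
have : all (mem (prs h)) (prs h) by apply/allP.
elim: {2 3 4}(prs h) K Kh => [|p ps IH] K Kh /=.
  by rewrite /vac -addn1 iotaD has_cat /= add0n orbF (negPf Kh) orbF.
case/andP=> pin psin.
rewrite !fctE /scl IH //; congr (_ + _ * _); apply: ee_agree => // K' K'h.
exact: IH.
Qed.

Lemma crdS (K : nat -> bool) : crd h.+1 K = (crd h K + K h)%N.
Proof. by rewrite /crd -addn1 iotaD count_cat /= add0n addn0. Qed.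

Lemma ee_last (u : spin F) (a : nat) K : (a < h)%N -> ~~ K h -> op (ee (a, h)) u K = 0.
Proof.
move=> ah Kh; rewrite /op /ee /= /cl /=; case: ifP => // _.
by rewrite {1}/tog (gtn_eqF ah) addbF (negPf Kh) /= sg0.
Qed.

Lemma ee_last_tog (u : spin F) (a : nat) K : (a < h)%N -> ~~ K h ->
  op (ee (a, h)) u (tog h K) = - sg (par h K) (cl (true, a) u K).
Proof.
move=> ah Kh; rewrite /op /ee /= clC /pairing /= andbF sub0r.
rewrite fctE {1}/cl /= {1}/tog eqxx (negPf Kh) /= togK par_tog ltnn addbF.
by [].
Qed.

Lemma supp_lt_last (K : nat -> bool) : supp_lt h K -> ~~ K h.
Proof. by move=> Kh; apply/negP => /Kh; rewrite ltnn. Qed.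

Lemma supp_ltS (K : nat -> bool) : supp_lt h K -> supp_lt h.+1 K.
Proof. by move=> Kh i /Kh ih; apply: ltnW. Qed.

Lemma supp_lt_tog (K : nat -> bool) : supp_lt h K -> supp_lt h.+1 (tog h K).
Proof.
move=> Kh i; rewrite /tog ltnS; have [->//|_] := eqVneq i h.
by rewrite addbF => /Kh/ltnW.
Qed.

Lemma crd_tog_last (K : nat -> bool) : ~~ K h -> crd h.+1 (tog h K) = (crd h K).+1.
Proof.
move=> Kh; have := @crd_tog h.+1 h (tog h K) (ltnSn h).
by rewrite togK {1}/tog eqxx (negPf Kh) => ->; rewrite // crdS (negPf Kh) addn0.
Qed.

Lemma sg_eq0 (b : bool) (x : F) : sg b x = 0 -> x = 0.
Proof. by case: b => //= /eqP; rewrite oppr_eq0 => /eqP. Qed.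

Lemma sg_sum (b : bool) (I : Type) (r : seq I) (f : I -> F) :
  \sum_(i <- r) sg b (f i) = sg b (\sum_(i <- r) f i).
Proof. by case: b => //=; rewrite sumrN. Qed.

Lemma sg_mull (b : bool) (c x : F) : c * sg b x = sg b (c * x).
Proof. by case: b; rewrite /= ?mulrN. Qed.

Lemma iotaS : iota 0 h.+1 = iota 0 h ++ [:: h].
Proof. by rewrite -addn1 iotaD. Qed.

(** Coordinates at sets without [h] see only the old vectors, which kills [c] and the old part of
    [y]. At sets containing [h] there remain the vectors [e_a e_h v_i], which up to sign are the odd
    spinors [e_a v_i]. *)
Lemma indepS : indep h -> odd_indep h -> indep h.+1.
Proof.
move=> ih oh c y E.
have cy : forall i, c i = 0 /\ (forall p, p \in prs h -> y i p = 0).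
  apply: ih => K Kh ev; have Kn := supp_lt_last Kh.
  rewrite -[RHS](E K (supp_ltS Kh)); last by rewrite crdS (negPf Kn) addn0.
  apply: eq_bigr => i _; rewrite pure_agree // prsS big_cat /= big_map.
  rewrite [X in _ + (_ + X)]big1_seq ?addr0 => [|a]; last first.
    by rewrite mem_iota => /= ah; rewrite ee_last ?mulr0.
  congr (_ + _); rewrite big_seq [RHS]big_seq; apply: eq_bigr => p pin; congr (_ * _).
  by apply: ee_agree => // K' K'h; rewrite pure_agree.
have z0 : forall i a, (a < h)%N -> y i (a, h) = 0.
  apply: (oh (fun i a => y i (a, h))) => K Kh od; have Kn := supp_lt_last Kh.
  have := E (tog h K) (supp_lt_tog Kh); rewrite crd_tog_last //= od => /(_ isT) E'.
  apply: (@sg_eq0 (~~ par h K)); rewrite -[RHS]E' -sg_sum; apply: eq_bigr => i _.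
  have [-> yp] := cy i; rewrite mul0r add0r prsS big_cat /= big_map.
  rewrite [X in _ = X + _]big1_seq ?add0r => [|p /andP[_ pin]]; last by rewrite yp ?mul0r.
  rewrite -sg_sum big_seq [RHS]big_seq; apply: eq_bigr => a; rewrite mem_iota => /= ah.
  rewrite ee_last_tog // -sgN -sg_mull; congr (_ * sg _ _).
  by apply: cl_agree => // K' K'h; rewrite pure_agree.
move=> i; have [c0 yp] := cy i; split=> // -[a b]; rewrite prsS mem_cat => /orP[/yp //|].
by case/mapP => a'; rewrite mem_iota => /= ah [-> ->]; apply: z0.
Qed.

(** Sets without [h] give the old odd relation. At sets containing [h] only the terms [e_h v_i] are
    left, a relation between the [v_i] alone, to which [indep h] applies with zero coefficients on
    the pairs. *)
Lemma odd_indepS : indep h -> odd_indep h -> odd_indep h.+1.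
Proof.
move=> ih oh z E.
have z0 : forall i a, (a < h)%N -> z i a = 0.
  apply: oh => K Kh od; have Kn := supp_lt_last Kh.
  rewrite -[RHS](E K (supp_ltS Kh)); last by rewrite crdS (negPf Kn) addn0.
  apply: eq_bigr => i _; rewrite iotaS big_cat /= big_seq1.
  rewrite [X in _ = _ + z i h * X]/cl /= (negPf Kn) /= mulr0 addr0.
  rewrite big_seq [RHS]big_seq; apply: eq_bigr => a; rewrite mem_iota => /= ah.
  by congr (_ * _); apply: cl_agree => // K' K'h; rewrite pure_agree.
have zh : forall i, z i h = 0 /\ (forall p, p \in prs h -> (0 : F) = 0).
  apply: (ih (fun i => z i h) (fun _ _ => 0)) => K Kh ev; have Kn := supp_lt_last Kh.
  have odK : odd (crd h.+1 (tog h K)) by rewrite crd_tog_last.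
  have E' := E (tog h K) (supp_lt_tog Kh) odK.
  apply: (@sg_eq0 (par h K)); rewrite -[RHS]E' -sg_sum; apply: eq_bigr => i _.
  rewrite [X in _ + X]big1 ?addr0 => [|p _]; last by rewrite mul0r.
  rewrite iotaS big_cat /= big_seq1 big1_seq ?add0r => [|a].
    rewrite -sg_mull /cl /= {1}/tog eqxx (negPf Kn) /= togK par_tog ltnn addbF.
    by rewrite pure_agree.
  by rewrite mem_iota => /= ah; rewrite z0 ?mul0r.
move=> i a; rewrite ltnS leq_eqVlt => /predU1P[->|]; last exact: z0.
by case: (zh i).
Qed.

End Step.

Lemma indep_pad h0 : (forall i a b, (h0 <= b)%N -> xs i (a, b) = 0) ->
  indep h0 -> odd_indep h0 -> forall h, (h0 <= h)%N -> indep h /\ odd_indep h.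
Proof.
move=> xs0 i0 o0; elim=> [|h IH]; first by rewrite leqn0 => /eqP <-.
rewrite leq_eqVlt => /predU1P[<- //|]; rewrite ltnS => h0h.
have [ih oh] := IH h0h; have z i a : xs i (a, h) = 0 by apply: xs0.
by split; [exact: indepS | exact: odd_indepS].
Qed.

Definition base_at (h : nat) (t : 'I_#|par_type h k|) : F :=
  let: (i, s) := enum_val t in
  if s == ord0 then 1 else xs i (nth (0, 0)%N (prs h) s.-1).
Arguments base_at : clear implicits.

Lemma base_pure h i :
  pure h (fun p => base_at h (enum_rank (pvar h i p))) = pure h (xs i).
Proof.
apply: expps_ext => p pin; rewrite /base_at enum_rankK /pvar.
have := pvar_in i pin; rewrite xpair_eqE eqxx /= => /negPf ->.
by rewrite inordK ?ltnS -?(size_prs h) ?index_mem //= nth_index.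
Qed.

Lemma tangent_base h i (s : 'I_('C(h, 2)).+1) :
  tangent (fun t => base_at h (enum_rank t)) (i, s) =
  if s == ord0 then pure h (xs i)
  else op (ee (nth (0, 0)%N (prs h) s.-1)) (pure h (xs i)).
Proof.
rewrite /tangent /= base_pure; case: eqP => // _.
by rewrite /base_at enum_rankK eqxx scl1.
Qed.

Lemma param_base h : (0 < k)%N -> param_at (@chi F h k) (base_at h) != 0.
Proof.
move=> k0; have [//||j Ej] := @key_exists h (fun=> false).
  by rewrite /crd count_pred0.
apply/rV0Pn; exists j; rewrite param_at_chi mxE Ej /secant_sum spin_sumE.
under eq_bigr do rewrite /scl base_pure pure_vac /base_at enum_rankK eqxx mulr1.
by rewrite sumr_const card_ord pnatr_eq0 -lt0n.
Qed.

Lemma indep_rank h : indep h -> \rank (jac (@chi F h k) (base_at h)) = #|par_type h k|.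
Proof.
move=> ih; apply/eqP; rewrite -[_ == _]/(row_free _) -kermx_eq0; apply/rowV0P => u.
move/sub_kermxP => uJ; pose c i := u 0 (enum_rank (i, ord0) : 'I_#|par_type h k|).
pose y i p := u 0 (enum_rank (pvar h i p)).
have cy : forall i, c i = 0 /\ (forall p, p \in prs h -> y i p = 0).
  apply: ih => K Kh ev; have [j Ej] := key_exists Kh ev.
  move/rowP/(_ j): uJ; rewrite !mxE => E; rewrite -[RHS]E.
  transitivity (\sum_i \sum_s u 0 (enum_rank (i, s)) *
      tangent (fun t => base_at h (enum_rank t)) (i, s) K); last first.
    rewrite pair_bigA [RHS](reindex (enum_rank : par_type h k -> _)) /=; last first.
      exact: onW_bij (enum_rank_bij _).
    by apply: eq_bigr => -[i s] _; rewrite jac_chi Ej.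
  apply: eq_bigr => i _; rewrite big_ord_recl tangent_base eqxx; congr (_ + _).
  rewrite (big_nth (0, 0)%N) size_prs big_mkord; apply: eq_bigr => t _.
  rewrite tangent_base /=; congr (_ * _); rewrite /y /pvar; congr (u 0 (enum_rank (_, _))).
  apply: val_inj; rewrite /= index_uniq ?uniq_prs ?size_prs // inordK //.
  by rewrite ltnS.
apply/rowP => t; rewrite mxE -[t]enum_valK; case: (enum_val t) => i s.
have [c0 y0] := cy i; have [->|ns] := eqVneq s ord0; first exact: c0.
rewrite -(pvar_nth i ns); apply: y0; apply: mem_nth; rewrite size_prs.
by move: ns; rewrite -val_eqE; case: s => [[|s]].
Qed.

End Independence.

(** * Triangular certificates over the integers *)

Section Certificates.
Variable F : numFieldType.

Section Check.
Variables (R B : Type) (ev : R -> B -> int) (okR : pred R) (okB : pred B).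
Implicit Types (cert : seq (R * seq (B * int))).

Definition valf (r : R) (phi : seq (B * int)) : int :=
  foldr (fun bz acc => bz.2 * ev r bz.1 + acc) 0 phi.

(** Triangular pairing: each functional is nonzero on its own row and zero on all later rows.
    Nonzero integers stay nonzero in [F], so an integer computation proves independence over [F]. *)
Definition check cert : bool :=
  all (fun c => [&& okR c.1, all (fun bz => okB bz.1) c.2 & valf c.1 c.2 != 0]) cert &&
  pairwise (fun c d => valf d.1 c.2 == 0) cert.

Lemma check_rank m n (J : 'M[F]_(m, n)) (row_of : R -> 'I_m) (col_of : B -> 'I_n) cert :
  (forall r b, okR r -> okB b -> J (row_of r) (col_of b) = (ev r b)%:~R) ->
  check cert -> (size cert <= \rank J)%N.
Proof.
move=> JE /andP[ok pw].
pose fn (phi : seq (B * int)) : 'cV[F]_n := \sum_(bz <- phi) (bz.2)%:~R *: delta_mx (col_of bz.1) 0.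
have fnE r phi : okR r -> all (fun bz => okB bz.1) phi ->
    row (row_of r) J *m fn phi = ((valf r phi)%:~R)%:M.
  move=> rok; rewrite /fn; elim: phi => [_|[b z] phi IH /= /andP[bok /IH E]].
    by rewrite big_nil mulmx0 /valf /= raddf0.
  rewrite big_cons mulmxDr E /= rmorphD rmorphM /= raddfD /= -scalemxAr; congr (_ + _).
  apply/matrixP => i j; rewrite !ord1 !mxE eqxx mulr1n (bigD1 (col_of b)) //= big1 ?addr0.
    by rewrite !mxE !eqxx mulr1 JE.
  by move=> l nl; rewrite !mxE (negPf nl) mulr0.
suff [M [Mfree MJ _]] : exists M : 'M[F]_(size cert, n), [/\ row_free M, (M <= J)%MS &
    forall phi, all (fun bz => okB bz.1) phi ->
      all (fun c => valf c.1 phi == 0) cert -> M *m fn phi = 0].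
  by move/eqP: Mfree <-; exact: mxrankS.
elim: cert ok pw => [_ _|[r phi] cert IH /= /andP[/and3P[rok pok nz] ok] /andP[pw1 pw]].
  exists 0; split; rewrite ?sub0mx // /row_free ?mxrank0 //.
  by move=> *; rewrite mul0mx.
have [M [Mfree MJ Mphi]] := IH ok pw.
have free : row_free (col_mx (row (row_of r) J) M).
  rewrite -kermx_eq0; apply/rowV0P => u /sub_kermxP.
  rewrite -[u](@hsubmxK _ 1 1) mul_row_col => E.
  have E1 := congr1 (mulmx^~ (fn phi)) E.
  have u1 : lsubmx u = 0.
    move: E1; rewrite mulmxDl -!mulmxA Mphi // mulmx0 addr0 fnE // mul0mx.
    move/matrixP => E1; apply/rowP => i; have := E1 0 0; rewrite !ord1 !mxE big_ord1 !mxE.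
    by rewrite mulr1n => /eqP; rewrite mulf_eq0 intr_eq0 (negPf nz) orbF => /eqP.
  move: E; rewrite u1 mul0mx add0r => E2.
  have /row_freeP[X MX] := Mfree.
  have u2 : rsubmx u = 0.
    by have := congr1 (mulmx^~ X) E2; rewrite -mulmxA MX mulmx1 mul0mx.
  by rewrite u2 row_mx0.
have sub : (col_mx (row (row_of r) J) M <= J)%MS by rewrite col_mx_sub row_sub.
exists (col_mx (row (row_of r) J) M); split=> // psi psiok /andP[/eqP r0 c0].
have -> : col_mx (row (row_of r) J) M *m fn psi = 0; last by [].
by rewrite mul_col_mx fnE // r0 /= Mphi // raddf0 col_mx0.
Qed.

End Check.

Lemma check_indep (R : eqType) (B : Type) (ev : R -> B -> int) (okR : pred R) (okB : pred B)
    (cert : seq (R * seq (B * int))) (rows : seq R) (c : R -> F) :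
  check ev okR okB cert -> perm_eq rows (map fst cert) ->
  (forall b, okB b -> \sum_(r <- rows) c r * (ev r b)%:~R = 0) ->
  forall r, r \in rows -> c r = 0.
Proof.
move=> /andP[ok pw] prm c0 r; rewrite (perm_mem prm).
have {prm rows}c0 b : okB b -> \sum_(r <- map fst cert) c r * (ev r b)%:~R = 0.
  by move/c0; rewrite (perm_big _ prm).
have c0phi phi : all (fun bz => okB bz.1) phi ->
    \sum_(r <- map fst cert) c r * (valf ev r phi)%:~R = 0.
  elim: phi => [_|[b z] phi IH /= /andP[/c0 Eb /IH E]].
    by rewrite big1 // => r' _; rewrite mulr0.
  transitivity (z%:~R * \sum_(r0 <- map fst cert) c r0 * (ev r0 b)%:~R +
     \sum_(r0 <- map fst cert) c r0 * (valf ev r0 phi)%:~R); last by rewrite Eb E mulr0 addr0.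
  rewrite mulr_sumr -big_split; apply: eq_bigr => r0 _ /=.
  by rewrite rmorphD rmorphM /=; ring.
elim: cert ok pw {c0} c0phi => //= -[r' phi] cert IH /= /andP[/and3P[_ pok nz] ok] /andP[pw1 pw] c0.
have cr' : c r' = 0.
  have s0 : \sum_(d <- cert) c d.1 * (valf ev d.1 phi)%:~R = 0 :> F.
    elim: (cert) pw1 => [|d s IHs] /=; first by rewrite big_nil.
    by case/andP => /eqP Ed /IHs E; rewrite big_cons Ed E mulr0 addr0.
  have := c0 phi pok; rewrite big_cons big_map s0 addr0 => /eqP.
  by rewrite mulf_eq0 intr_eq0 (negPf nz) orbF => /eqP.
rewrite inE => /predU1P[->//|]; apply: IH => // psi psiok.
by have := c0 psi psiok; rewrite big_cons cr' mul0r add0r.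
Qed.

End Certificates.

Definition xE (E : seq (nat * nat * int)) (p : nat * nat) : int :=
  foldr (fun e acc => if e.1 == p then e.2 else acc) 0 E.

(** Each factor of the exponential can double the cost of evaluating a coordinate; dropping those
    with zero coefficient keeps the computation feasible. *)
Definition eZ (h : nat) (E : seq (nat * nat * int)) : spin int :=
  let ps := [seq p <- prs h | xE E p != 0] in expps ps (xE E) (vac int h).

Definition okb (h : nat) (b : bitseq) : bool := (size b == h) && ~~ odd (count id b).

Fixpoint bits (h : nat) : seq bitseq :=
  if h is h'.+1 then map (cons true) (bits h') ++ map (cons false) (bits h') else [:: [::]].

Definition even_bits (h : nat) : seq bitseq := [seq b <- bits h | ~~ odd (count id b)].

Lemma mem_bits b : b \in bits (size b).
Proof.
by elim: b => //= x b IH; rewrite mem_cat; case: x; rewrite map_f ?orbT.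
Qed.

Section Bits.
Variables (F : numFieldType) (h : nat).
Local Notation n := (num_even_subsets h).

Lemma crd_bits (b : bitseq) : size b = h -> crd h (nth false b) = count id b.
Proof.
by move=> <-; rewrite /crd -[b in RHS](mkseq_nth false) /mkseq count_map.
Qed.

Lemma supp_bits (b : bitseq) : size b = h -> supp_lt h (nth false b).
Proof.
by move=> <- i; case: ltnP => // /(nth_default false) ->.
Qed.

Lemma key_bits (j : 'I_n) : exists2 b, b \in even_bits h & key j = nth false b.
Proof.
pose b := mkseq (key j) h; have sb : size b = h by rewrite size_mkseq.
have Eb : key j = nth false b.
  apply: funext => i; case: (ltnP i h) => ih; first by rewrite nth_mkseq.
  rewrite nth_default ?sb //; apply/negP => /key_lt; by rewrite ltnNge ih.
exists b => //; rewrite mem_filter; have := mem_bits b; rewrite sb => ->.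
by rewrite andbT -(crd_bits sb) -Eb key_even.
Qed.

Lemma bcol_exists (b : bitseq) : exists j : 'I_n, okb h b -> key j = nth false b.
Proof.
have [bok|_] := boolP (okb h b).
  have /andP[/eqP sb ev] := bok.
  have [|j Ej] := key_exists (@supp_bits b sb); first by rewrite crd_bits.
  by exists j.
by have [//||j Ej] := @key_exists h (fun=> false); [rewrite /crd count_pred0|exists j].
Qed.

Definition bcol b : 'I_n := projT1 (cid (bcol_exists b)).

Lemma key_bcol b : okb h b -> key (bcol b) = nth false b.
Proof. exact: (projT2 (cid (bcol_exists b))). Qed.

Definition toF (v : spin int) : spin F := fun K => (v K)%:~R.

Lemma op_toF q v : op q (toF v) = toF (op q v).
Proof. by rewrite /toF -(op_morph (intmul (1 : F))). Qed.

Definition xF (E : seq (nat * nat * int)) (p : nat * nat) : F := (xE E p)%:~R.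

Lemma pure_xF E : pure h (xF E) = toF (eZ h E).
Proof.
rewrite /toF /eZ (expps_morph (intmul (1 : F))) (vac_morph (intmul (1 : F))) /pure.
elim: (prs h) => //= p ps ->; rewrite /xF; case: eqP => [->|_] //=.
by rewrite scl0 addr0.
Qed.

Lemma cone_toF E : spinor_cone F h (rv h (toF (eZ h E))).
Proof. by rewrite -pure_xF; exists (1, xF E) => //=; rewrite scl1. Qed.

Definition evT (vs : seq (spin int)) (r : nat * option (nat * nat)) (b : bitseq) : int :=
  let v := nth 0 vs r.1 in
  if r.2 is Some p then op (ee p) v (nth false b) else v (nth false b).

Definition okT (k : nat) (r : nat * option (nat * nat)) : bool :=
  (r.1 < k)%N && (if r.2 is Some p then (p.1 < p.2 < h)%N else true).

Lemma xs_toF (Es : seq (seq (nat * nat * int))) i : (i < size Es)%N ->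
  pure h (xF (nth [::] Es i)) = toF (nth 0 (map (eZ h) Es) i).
Proof. by move=> iE; rewrite pure_xF (nth_map [::]). Qed.

Lemma secant_rank_ge (Es : seq (seq (nat * nat * int))) k cert : size Es = k ->
  (0 < k)%N -> check (evT (map (eZ h) Es)) (okT k) (okb h) cert ->
  (size cert <= \rank (jac (@chi F h k) (base_at (h := h) (fun i : 'I_k => xF (nth [::] Es i)))))%N.
Proof.
move=> sE; case: k sE => // k sE _.
pose row_of (r : nat * option (nat * nat)) := enum_rank
  ((inord r.1, if r.2 is Some p then inord (index p (prs h)).+1 else ord0) : par_type h k.+1).
apply: (check_rank (row_of := row_of) (col_of := bcol)).
move=> [i o] b /andP[/= ik oko] bok.
rewrite jac_chi key_bcol // tangent_base inordK // xs_toF ?sE // /evT /=.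
case: o oko => [[a c] pin|_]; last by rewrite eqxx.
have {}pin : (a, c) \in prs h by rewrite mem_prs.
have := pvar_in (inord i : 'I_k.+1) pin; rewrite xpair_eqE eqxx /= => /negPf ->.
rewrite inordK ?ltnS -?(size_prs h) ?index_mem //= nth_index //.
by rewrite op_toF.
Qed.

Definition rowsT (k : nat) : seq (nat * option (nat * nat)) :=
  flatten [seq (i, None) :: [seq (i, Some p) | p <- prs h] | i <- iota 0 k].

Lemma indep_check (Es : seq (seq (nat * nat * int))) k cert : size Es = k ->
  check (evT (map (eZ h) Es)) predT (okb h) cert -> perm_eq (rowsT k) (map fst cert) ->
  indep (fun i : 'I_k => xF (nth [::] Es i)) h.
Proof.
move=> sE chk prm c y E.
pose C (r : nat * option (nat * nat)) : F :=
  if insub r.1 is Some i then (if r.2 is Some p then y i p else c i) else 0.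
have C0 : forall r, r \in rowsT k -> C r = 0.
  apply: (check_indep chk prm) => b /andP[/eqP sb ev].
  have := E _ (supp_bits sb); rewrite crd_bits // => /(_ ev) E0; rewrite -[RHS]E0.
  transitivity (\sum_(0 <= i < k) (C (i, None) * (evT (map (eZ h) Es) (i, None) b)%:~R +
      \sum_(p <- prs h) C (i, Some p) * (evT (map (eZ h) Es) (i, Some p) b)%:~R)).
    rewrite /rowsT big_flatten big_map /index_iota subn0; apply: eq_bigr => i _.
    by rewrite big_cons big_map.
  rewrite big_mkord; apply: eq_bigr => i _.
  rewrite /C /= valK xs_toF ?sE //; congr (_ + _).
  by apply: eq_bigr => p _; rewrite op_toF.
move=> i; have rows_in r :
    r \in [seq (val i, Some p) | p <- prs h] \/ r = (val i, None) -> r \in rowsT k.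
  move=> H; apply/flattenP; exists ((val i, None) :: [seq (val i, Some p) | p <- prs h]).
    by apply/mapP; exists (val i) => //; rewrite mem_iota /=.
  by rewrite inE; case: H => [->|->]; rewrite ?orbT ?eqxx.
split=> [|p pin].
  by have := C0 (val i, None) (rows_in _ (or_intror erefl)); rewrite /C /= valK.
have := C0 (val i, Some p); rewrite /C /= valK; apply; apply: rows_in; left.
by apply/mapP; exists p.
Qed.

Definition evO (vs : seq (spin int)) (r : nat * nat) (b : bitseq) : int :=
  cl (true, r.2) (nth 0 vs r.1) (nth false b).

Definition okb_odd (b : bitseq) : bool := (size b == h) && odd (count id b).

Definition rowsO (k : nat) : seq (nat * nat) := [seq (i, a) | i <- iota 0 k, a <- iota 0 h].

Lemma odd_indep_check (Es : seq (seq (nat * nat * int))) k cert : size Es = k ->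
  check (evO (map (eZ h) Es)) predT okb_odd cert ->
  perm_eq (rowsO k) (map fst cert) ->
  odd_indep (fun i : 'I_k => xF (nth [::] Es i)) h.
Proof.
move=> sE chk prm z E.
pose C (r : nat * nat) : F := if insub r.1 is Some i then z i r.2 else 0.
have C0 : forall r, r \in rowsO k -> C r = 0.
  apply: (check_indep chk prm) => b /andP[/eqP sb od].
  have := E _ (supp_bits sb); rewrite crd_bits // => /(_ od) E0; rewrite -[RHS]E0.
  rewrite /rowsO big_allpairs -[iota 0 k in LHS](congr1 (iota 0) (subn0 k)).
  rewrite -/(index_iota 0 k) big_mkord.
  apply: eq_bigr => i _; apply: eq_bigr => a _.
  rewrite /C /= valK xs_toF ?sE //; congr (_ * _).
  by rewrite -[cl _ _]/(op [:: (true, a)] _) op_toF.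
move=> i a ah; have := C0 (val i, a); rewrite /C /= valK; apply.
by apply/allpairsP; exists (val i, a); rewrite /= !mem_iota !add0n /= ltn_ord ah.
Qed.

End Bits.

Definition evG (gw : seq (seq (bool * nat))) (ext : seq (seq (nat * seq (bool * nat))))
    (vs : seq (spin int)) (s : bool * nat) (ib : nat * bitseq) : int :=
  let v := nth 0 vs ib.1 in let K := nth false ib.2 in
  if s.1 then
    foldr (fun tq acc => (if tq.1 == s.2 then op tq.2 v K else 0) + acc) 0 (nth [::] ext ib.1)
  else op (nth [::] gw s.2) v K.

Definition okG (gw : seq (seq (bool * nat))) (e : nat) (s : bool * nat) : bool :=
  if s.1 then (s.2 < e)%N else (s.2 < size gw)%N.

Definition quad_gens (q : (bool * nat) * (bool * nat)) : seq (bool * nat) := [:: q.1; q.2].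

(** One representative for each unordered pair of generators; reversing the order changes an
    operator by a sign and possibly a scalar, and the repeated ones act as zero. *)
Definition quads (h : nat) : seq ((bool * nat) * (bool * nat)) :=
  [seq ((true, p.1), (true, p.2)) | p <- prs h] ++
  [seq ((false, p.1), (false, p.2)) | p <- prs h] ++
  [seq ((true, a), (false, b)) | a <- iota 0 h, b <- iota 0 h].

(* [(q, cs, es)] stands for [q l_m = \sum_((c, q') <- cs) c q' l_m +
   \sum_((z, m') <- es_m) z l_m'] for all [m], where [Ls = l_0, l_1, ...]. *)
Definition relation : Type :=
  (((bool * nat) * (bool * nat)) * seq (int * ((bool * nat) * (bool * nat))) *
   seq (seq (int * nat)))%type.

Definition lin_sum (T : Type) (f : T -> int) (cs : seq (int * T)) : int :=
  foldr (fun ct acc => ct.1 * f ct.2 + acc) 0 cs.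

Definition check_relation (h : nat) (Ls : seq (spin int))
    (Bq : seq ((bool * nat) * (bool * nat))) (rl : relation) : bool :=
  let: (q, cs, es) := rl in
  [&& all (fun c => c.2 \in Bq) cs, all (all (fun z => (z.2 < size Ls)%N)) es &
    all (fun m => all (fun b =>
      op (quad_gens q) (nth 0 Ls m) (nth false b) ==
      lin_sum (fun q' => op (quad_gens q') (nth 0 Ls m) (nth false b)) cs +
      lin_sum (fun m' => nth 0 Ls m' (nth false b)) (nth [::] es m))
      (even_bits h)) (iota 0 (size Ls))].

Definition check_orbit (h : nat) (Ls : seq (spin int))
    (Bq : seq ((bool * nat) * (bool * nat))) (rels : seq relation) : bool :=
  all (check_relation h Ls Bq) rels &&
  all (fun q => (q \in Bq) || (q \in [seq rl.1.1 | rl <- rels])) (quads h).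

Section Orbit.
Variables (F : numFieldType) (h : nat).
Local Notation n := (num_even_subsets h).

Lemma lin_sumE (T : Type) (f : T -> int) cs :
  (lin_sum f cs)%:~R = \sum_(ct <- cs) ct.1%:~R * (f ct.2)%:~R :> F.
Proof.
elim: cs => [|ct cs IH]; first by rewrite big_nil.
by rewrite big_cons -IH /= rmorphD rmorphM.
Qed.

Lemma quads_span m (X : 'M[F]_(m, n)) (v : spin F) :
  (rv h v <= X)%MS ->
  (forall q, q \in quads h -> (rv h (op (quad_gens q) v) <= X)%MS) ->
  forall x y, (x.2 < h)%N -> (y.2 < h)%N -> (rv h (op [:: x; y] v) <= X)%MS.
Proof.
move=> vX qX.
have rvN u : rv h (- u) = - rv h u by apply/rowP => j; rewrite !mxE.
have subN u : (rv h u <= X)%MS -> (rv h (- u) <= X)%MS by rewrite rvN eqmx_opp.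
have rv0 : (rv h (0 : spin F) <= X)%MS.
  by rewrite (_ : rv h 0 = 0) ?sub0mx //; apply/rowP => j; rewrite !mxE.
have same d a b : (a < h)%N -> (b < h)%N -> (rv h (op [:: (d, a); (d, b)] v) <= X)%MS.
  move=> ah bh; have lt c e : (c < e < h)%N -> (rv h (op [:: (d, c); (d, e)] v) <= X)%MS.
    move=> ce; apply: (qX ((d, c), (d, e))); rewrite /quads !mem_cat.
    have cin : (c, e) \in prs h by rewrite mem_prs.
    by case: d; apply/orP; [left|right; apply/orP; left]; apply/mapP; exists (c, e).
  case: (ltngtP a b) => [ab|ba|->].
  - by apply: lt; rewrite ab.
  - rewrite /op /= clC /pairing /= eqxx andbF sub0r; apply: subN.
    by apply: (lt b a); rewrite ba.
  - by rewrite /op /= cl_sq.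
have ei a b : (a < h)%N -> (b < h)%N -> (rv h (op [:: (true, a); (false, b)] v) <= X)%MS.
  move=> ah bh; apply: (qX ((true, a), (false, b))); rewrite /quads !mem_cat.
  by apply/orP; right; apply/orP; right; apply/allpairsP; exists (a, b); rewrite !mem_iota.
move=> [d a] [d' b] /= ah bh; case: (eqVneq d d') => [->|]; first exact: same.
case: d d' => [] [] // _; first exact: ei.
rewrite /op /= clC rvD addmx_sub //; first by case: ifP.
by apply: subN; exact: ei.
Qed.

(** The coefficients [cs] of a relation do not depend on [m], so the relation extends to all
    combinations of the [l_m]. The same quadratics are therefore redundant at every point of the
    span, and only [Bq] and the [l_m] have to be counted. *)
Lemma check_orbit_span (Ls : seq (spin int)) Bq rels :
  check_orbit h Ls Bq rels -> forall z : 'I_(size Ls) -> F,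
  let L (m : 'I_(size Ls)) := toF F (nth 0 Ls m) in
  exists X : 'M[F]_(size Ls + size Bq, n), (forall m, (rv h (L m) <= X)%MS) /\
  (forall x y, (x.2 < h)%N -> (y.2 < h)%N -> (rv h (op [:: x; y] (lsum L z)) <= X)%MS).
Proof.
move=> /andP[/allP rok /allP qok] z L.
pose w := lsum L z.
pose bq (s : 'I_(size Bq)) := rv h (op (quad_gens (nth ((true, 0), (true, 0))%N Bq s)) w).
pose X : 'M[F]_(size Ls + size Bq, n) := col_mx (\matrix_m rv h (L m)) (\matrix_s bq s).
have LX m : (rv h (L m) <= X)%MS.
  rewrite -addsmxE; apply: submx_trans (addsmxSl _ _).
  by rewrite -(rowK (fun m => rv h (L m)) m) row_sub.
have BX q : q \in Bq -> (rv h (op (quad_gens q) w) <= X)%MS.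
  move=> qB; rewrite -addsmxE; apply: submx_trans (addsmxSr _ _).
  have qs : (index q Bq < size Bq)%N by rewrite index_mem.
  rewrite -[q in X in (X <= _)%MS](nth_index ((true, 0), (true, 0))%N qB).
  by rewrite -[rv _ _]/(bq (Ordinal qs)) -(rowK bq) row_sub.
have wX : (rv h w <= X)%MS.
  by rewrite rv_sum; apply: summx_sub => m _; rewrite rvZ scalemx_sub.
exists X; split=> //; apply: quads_span => // q /qok /orP[/BX //|].
case/mapP => -[[q' cs] es] rin /= Eq; subst q'.
have /and3P[/allP csB /allP esok /allP relok] := rok _ rin.
have key_rel (m : 'I_(size Ls)) (j : 'I_n) :
    op (quad_gens q) (L m) (key j) =
    \sum_(ct <- cs) ct.1%:~R * op (quad_gens ct.2) (L m) (key j) +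
    \sum_(ct <- nth [::] es m) ct.1%:~R * toF F (nth 0 Ls ct.2) (key j).
  have [b bin ->] := key_bits j.
  have mi : val m \in iota 0 (size Ls) by rewrite mem_iota /=.
  have /eqP := allP (relok _ mi) b bin; move/(congr1 (intmul (1 : F))).
  rewrite rmorphD /= !lin_sumE => E.
  by rewrite op_toF [LHS]E; congr (_ + _); apply: eq_bigr => ct _; rewrite ?op_toF.
have rel_w : rv h (op (quad_gens q) w) =
    \sum_(ct <- cs) ct.1%:~R *: rv h (op (quad_gens ct.2) w) +
    \sum_m z m *: \sum_(ct <- nth [::] es m) ct.1%:~R *: rv h (toF F (nth 0 Ls ct.2)).
  apply/rowP => j; rewrite !mxE !summxE /w /lsum op_sum spin_sumE.
  under [X in _ = X + _]eq_bigr do rewrite !mxE op_sum spin_sumE mulr_sumr.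
  rewrite exchange_big -big_split /=; apply: eq_bigr => m _.
  rewrite opZ /scl key_rel mulrDr !mxE summxE; congr (_ + _).
    by rewrite mulr_sumr; apply: eq_bigr => ct _; rewrite opZ /scl mulrCA.
  by congr (_ * _); apply: eq_bigr => ct _; rewrite !mxE.
rewrite rel_w addmx_sub //.
  rewrite big_seq; apply: summx_sub => ct cin; rewrite scalemx_sub //.
  by apply: BX; exact: csB.
apply: summx_sub => m _; rewrite scalemx_sub // big_seq; apply: summx_sub => ct cin.
rewrite scalemx_sub //; have [ms|ms] := ltnP m (size es); last first.
  by rewrite nth_default in cin.
have /allP/(_ _ cin) := esok _ (mem_nth [::] ms) => ctL.
exact: (LX (Ordinal ctL)).
Qed.

Section Density.
Variables (k e : nat) (Es : seq (seq (nat * nat * int))).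
Variables (gw : seq (seq (bool * nat))) (ext : seq (seq (nat * seq (bool * nat)))).

Definition vF (i : 'I_k) : spin F := toF F (nth 0 (map (eZ h) Es) i).

Definition extF (i : 'I_k) : seq ('I_e.+1 * seq (bool * nat)) :=
  [seq (inord tq.1, tq.2) | tq <- nth [::] ext i].

Lemma tangent_rank_ge cert : (0 < k)%N ->
  all (all (fun tq => (tq.1 < e.+1)%N)) ext ->
  check (evG gw ext (map (eZ h) Es)) (okG gw e.+1) (fun ib => (ib.1 < k)%N && okb h ib.2) cert ->
  (size cert <= \rank (tangent_mx h gw extF vF))%N.
Proof.
move=> k0 extok.
pose row_of (s : bool * nat) : 'I_#|dir e.+1 gw| := enum_rank
  (if s.1 then inr (inord s.2) else
   if insub s.2 is Some a then inl a else inr ord0 : dir e.+1 gw).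
pose i0 := Ordinal k0.
pose col_of (ib : nat * bitseq) : 'I_#|{: 'I_k * 'I_n}| :=
  enum_rank (odflt i0 (insub ib.1), bcol h ib.2).
apply: (check_rank (row_of := row_of) (col_of := col_of)) => -[t s] [i b] /= sok /andP[ik bok].
rewrite mxE /row_of /col_of !enum_rankK /= key_bcol //.
have -> : odflt i0 (insub i) = Ordinal ik by rewrite insubT.
rewrite /evG /=; case: t sok => /= sok; last first.
  by rewrite insubT /= op_toF.
rewrite spin_sumE /extF big_map /=.
have : all (fun tq => (tq.1 < e.+1)%N) (nth [::] ext i).
  by have [ie|ie] := ltnP i (size ext); [exact: (allP extok) (mem_nth _ ie) | rewrite nth_default].
elim: (nth [::] ext i) => [_|tq W IH /= /andP[tqe /IH E]].
  by rewrite big_nil.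
rewrite big_cons E rmorphD /= -val_eqE /= !inordK //.
by case: ifP => _; rewrite ?add0r // op_toF.
Qed.

End Density.

Section Span.
Variable Ls : seq (spin int).
Let L (m : 'I_(size Ls)) := toF F (nth 0 Ls m).

Definition in_span (u : spin F) : Prop := exists z, rv h u = rv h (lsum L z).

Lemma in_spanD u v : in_span u -> in_span v -> in_span (u + v).
Proof.
move=> [y Ey] [z Ez]; exists (fun m => y m + z m); rewrite rvD Ey Ez /lsum !rv_sum -big_split.
by apply: eq_bigr => m _; rewrite /= !rvZ scalerDl.
Qed.

Lemma in_spanZ c u : in_span u -> in_span (scl c u).
Proof.
move=> [y Ey]; exists (fun m => c * y m); rewrite rvZ Ey /lsum !rv_sum scaler_sumr.
by apply: eq_bigr => m _; rewrite /= !rvZ scalerA.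
Qed.

Lemma in_span_sum (I : finType) (f : I -> spin F) :
  (forall i, in_span (f i)) -> in_span (\sum_i f i).
Proof.
move=> fi; elim/big_ind: _ => //; last exact: in_spanD.
exists (fun=> 0); congr (rv h _); rewrite /lsum big1 // => m _; exact: scl0.
Qed.

Lemma in_span_bits (u : spin int) (zs : seq (int * nat)) :
  all (fun z => (z.2 < size Ls)%N) zs ->
  all (fun b => u (nth false b) == lin_sum (fun m => nth 0 Ls m (nth false b)) zs) (even_bits h) ->
  in_span (toF F u).
Proof.
move=> zok /allP ub; exists (fun m : 'I_(size Ls) => \sum_(z <- zs | z.2 == m :> nat) z.1%:~R).
apply/rowP => j; rewrite !mxE /lsum spin_sumE; have [b bin ->] := key_bits j.
rewrite /toF (eqP (ub b bin)) lin_sumE /scl.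
under [RHS]eq_bigr do rewrite mulr_suml big_mkcond.
rewrite exchange_big /= big_seq [RHS]big_seq; apply: eq_bigr => z zin.
have zs_lt := allP zok z zin.
rewrite (bigD1 (Ordinal zs_lt)) //= eqxx big1 ?addr0 // => m nm.
by case: eqP => // E; case/eqP: nm; apply: val_inj; rewrite /= E.
Qed.

Definition check_stable (q : seq (bool * nat)) (es : seq (seq (int * nat))) : bool :=
  [&& nilquad h q, all (all (fun z => (z.2 < size Ls)%N)) es &
   all (fun m => all (fun b => op q (nth 0 Ls m) (nth false b) ==
      lin_sum (fun m' => nth 0 Ls m' (nth false b)) (nth [::] es m)) (even_bits h))
    (iota 0 (size Ls))].

Lemma in_span_op q es u : check_stable q es -> in_span u -> in_span (op q u).
Proof.
case/and3P => nq esok /allP qm [z Ez].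
have [M EM] : exists M : 'M[F]_n, forall u, rv h (op q u) = rv h u *m M.
  by case: q nq {qm} => [|x [|y [|? ?]]] //= /and3P[xh yh _]; exact: quad_mat.
have [y Ey] : in_span (op q (lsum L z)).
  rewrite /lsum op_sum; apply: in_span_sum => m; rewrite opZ; apply: in_spanZ.
  rewrite op_toF; apply: (@in_span_bits _ (nth [::] es m)).
    by have [ie|ie] := ltnP m (size es); [exact: (allP esok) (mem_nth _ ie) | rewrite nth_default].
  by apply: qm; rewrite mem_iota /=.
by exists y; rewrite EM Ez -EM.
Qed.

End Span.

End Orbit.

Section SecantDimension.
Variables (F : numFieldType) (h k : nat).
Hypothesis k_gt0 : (0 < k)%N.
Local Notation n := (num_even_subsets h).

Lemma has_dim_secant (xs : 'I_k -> nat * nat -> F) m2 (chi2 : 'I_n -> {mpoly F[m2]}) r :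
  (r < \rank (jac (@chi F h k) (base_at (h := h) xs)))%N ->
  im (@chi F h k) `<=` acl (im chi2) -> (forall b, (\rank (jac chi2 b) <= r.+1)%N) ->
  has_dim (secant_variety k (spinor_variety F h)) r.
Proof.
move=> rk sub rk2; have nzC : exists2 v, spinor_cone F h v & v != 0.
  by exists (rv h (vac F h)); [exact: cone_vac | exact: rv_vac_neq0].
rewrite spinor_variety_pz secant_pz //; last exact: scaling_spinor_cone.
rewrite -im_chi; apply: has_dim_pz rk sub rk2; last exact: param_base.
  move=> c _ [a _ <-]; exists (fun t => if (enum_val t).2 == ord0 then c * a t else a t) => //.
  rewrite !param_at_chi -rvZ /secant_sum scl_sum; congr (rv h _); apply: eq_bigr => i _.
  rewrite enum_rankK eqxx -sclA; congr (scl _ (scl _ _)); apply: expps_ext => p pin.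
  by have := pvar_in i pin; rewrite enum_rankK xpair_eqE eqxx /= => /negPf ->.
exact: sub_acl.
Qed.

Lemma has_dim_secant_full (xs : 'I_k -> nat * nat -> F) :
  (minn #|par_type h k| n <= \rank (jac (@chi F h k) (base_at (h := h) xs)))%N ->
  has_dim (secant_variety k (spinor_variety F h)) (minn #|par_type h k| n).-1.
Proof.
move=> rk; have n0 : (0 < minn #|par_type h k| n)%N.
  have [j _] : exists j, rv h (vac F h) 0 j != 0 by apply/rV0Pn; exact: rv_vac_neq0.
  rewrite leq_min (leq_ltn_trans (leq0n j) (ltn_ord j)) andbT card_prod !card_ord.
  by rewrite muln_gt0 k_gt0.
apply: (has_dim_secant (xs := xs) (chi2 := @chi F h k)); rewrite ?prednK //.
  exact: sub_acl.
by move=> b; rewrite leq_min rank_leq_row rank_leq_col.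
Qed.

End SecantDimension.

(** A single point with zero two-form: the induction on [h] can start at [h = 0], where the only
    vector is the vacuum. *)
Lemma has_dim_spinor (F : numFieldType) (h : nat) :
  has_dim (spinor_variety F h) 'C(h, 2).
Proof.
pose xs (_ : 'I_1) (_ : nat * nat) : F := 0.
have [ih _] : indep xs h /\ odd_indep xs h.
  apply: (@indep_pad _ _ _ 0%N) => // c y E i; rewrite ord1; split=> //.
  have sp : supp_lt 0 (fun=> false) by [].
  have := E _ sp isT; rewrite big_ord1 big_nil addr0 /pure /= /vac /= mulr1.
  by [].
have rk := indep_rank ih.
have E : spinor_cone F h = im (@chi F h 1).
  rewrite im_chi; apply/seteqP; split=> [v Cv|v [w Cw ->]]; last by rewrite big_ord1.
  by exists (fun=> v) => //; rewrite big_ord1.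
have card1 : #|par_type h 1| = ('C(h, 2)).+1 by rewrite card_prod !card_ord mul1n.
rewrite spinor_variety_pz.
apply: (has_dim_pz (chi1 := @chi F h 1) (a := base_at (h := h) xs) (chi2 := @chi F h 1)).
- exact: scaling_spinor_cone.
- by rewrite E; exact: sub_acl.
- exact: param_base.
- by rewrite rk card1.
- by rewrite E; exact: sub_acl.
- by move=> b; rewrite -card1 rank_leq_row.
Qed.

(** * Certificates *)

(* In [(rs, js, fs)], the row number [rs_t] is paired with the functional number
   [js_t]: first come the coordinates, then the entries [(ps, ms)] of [fs], which
   add the coordinates in [ps] and subtract those in [ms], with repetition. *)
Definition certificate : Type := (seq nat * seq nat * seq (seq nat * seq nat))%type.

Definition decode (R B : Type) (r0 : R) (b0 : B) (rows : seq R) (cols : seq B)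
    (cert : certificate) : seq (R * seq (B * int)) :=
  let: (rs, js, fs) := cert in
  let fs' := [seq ([:: j], [::]) | j <- iota 0 (size cols)] ++ fs in
  [seq (nth r0 rows ij.1,
     let f := nth ([::], [::]) fs' ij.2 in
     [seq (nth b0 cols j, 1) | j <- f.1] ++ [seq (nth b0 cols j, -1) | j <- f.2])
     | ij <- zip rs js].

(** All coefficients are [1] or [-1], with repetition for larger ones. A pair [(m, m')] in the last
    two lists adds or subtracts [l_m'] in the relation for [l_m]. *)
Definition decode_rels (h l : nat)
    (rels : seq (nat * seq nat * seq nat * seq (nat * nat) * seq (nat * nat))) :
    seq relation :=
  let q := nth ((true, 0), (true, 0))%N (quads h) in
  [seq let: (i, ps, ms, eps, ems) := rl in
    (q i, [seq (1, q j) | j <- ps] ++ [seq (-1, q j) | j <- ms],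
     [seq [seq (1, z.2) | z <- eps & z.1 == m] ++ [seq (-1, z.2) | z <- ems & z.1 == m]
       | m <- iota 0 l]) | rl <- rels].

(** An entry [(a, b, z)] is the coefficient [z] of [e_a e_b], so [[::]] stands for the vacuum. The
    points for the lower bounds only have to reach the required tangent rank; they may coincide. *)
Definition Es_h4 : seq (seq (nat * nat * int)) :=
    [:: [::]; [:: (1, 3, 1%Z)]; [::]]%N.

Definition Es_h5 : seq (seq (nat * nat * int)) :=
    [:: [::]; [:: (1, 3, 1%Z); (1, 4, 1%Z)]; [:: (1, 3, 1%Z); (2, 4, 1%Z)]]%N.

Definition Es_h6 : seq (seq (nat * nat * int)) :=
    [:: [::]; [:: (1, 4, 1%Z); (2, 5, 1%Z)]; [:: (0, 3, 1%Z); (1, 5, 1%Z)]]%N.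

Definition Es_h7 : seq (seq (nat * nat * int)) :=
    [:: [::]; [:: (0, 6, 1%Z); (2, 3, 1%Z); (2, 6, 1%Z); (4, 5, 1%Z)]; [:: (1, 3, 1%Z); (2, 4,
    1%Z); (5, 6, 1%Z)]]%N.

Definition Es_h8 : seq (seq (nat * nat * int)) :=
    [:: [::]; [:: (1, 3, 1%Z); (2, 4, 1%Z); (6, 7, 1%Z)]; [:: (0, 5, 1%Z); (1, 6, 1%Z); (3, 7,
    1%Z); (6, 7, 1%Z)]]%N.

Definition Es_h8k4 : seq (seq (nat * nat * int)) :=
    [:: [::]; [:: (0, 5, 1%Z); (2, 3, 1%Z); (2, 5, 1%Z); (3, 4, 1%Z); (3, 6, 1%Z); (4, 5, 1%Z);
    (4, 6, 1%Z)]; [:: (0, 2, 1%Z); (0, 4, 1%Z); (1, 7, 1%Z); (5, 6, 1%Z)]; [:: (0, 4, 1%Z); (1, 7,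
    1%Z); (3, 4, 1%Z); (3, 5, 1%Z); (4, 5, 1%Z)]]%N.

Definition Es_h9 : seq (seq (nat * nat * int)) :=
    [:: [::]; [:: (3, 7, 1%Z); (4, 8, 1%Z); (5, 6, 1%Z)]; [:: (0, 2, 1%Z); (0, 4, 1%Z); (1, 8,
    1%Z); (2, 3, 1%Z)]]%N.

Definition cert_h1 : certificate :=
  ([:: 0],
   [:: 0],
   [::])%N.

Definition cert_h2 : certificate :=
  ([:: 1; 0],
   [:: 0; 1],
   [::])%N.

Definition cert_h3 : certificate :=
  ([:: 3; 2; 1; 0],
   [:: 2; 1; 0; 3],
   [::])%N.

Definition cert_h4 : certificate :=
  ([:: 9; 2; 6; 5; 3; 4; 1; 0],
   [:: 0; 2; 6; 5; 4; 3; 1; 7],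
   [::])%N.

Definition cert_h5 : certificate :=
  ([:: 26; 24; 2; 23; 1; 17; 6; 15; 4; 10; 9; 8; 5; 3; 7; 0],
   [:: 4; 0; 5; 1; 3; 8; 12; 2; 6; 14; 13; 11; 10; 9; 7; 15],
   [::])%N.

Definition cert_h6 : certificate :=
  ([:: 41; 20; 45; 13; 40; 24; 8; 9; 47; 15; 35; 3; 36; 4; 30; 14; 26; 10; 22; 6; 21; 5; 27; 11;
     23; 7; 18; 2; 17; 1; 12; 0],
   [:: 8; 0; 9; 27; 4; 18; 22; 26; 12; 30; 1; 19; 5; 13; 20; 29; 24; 28; 16; 25; 17; 21; 6; 15;
     10; 14; 2; 11; 3; 7; 23; 31],
   [::])%N.

Definition cert_h7 : certificate :=
  ([:: 23; 55; 24; 25; 45; 34; 47; 3; 46; 2; 57; 1; 56; 12; 30; 61; 60; 27; 51; 38; 16; 59; 15;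
     49; 53; 39; 52; 8; 62; 17; 40; 18; 5; 26; 28; 48; 36; 43; 21; 29; 31; 9; 7; 4; 58; 14; 6;
     32; 42; 10; 33; 35; 13; 11; 64; 20; 41; 19; 0],
   [:: 12; 0; 20; 7; 4; 14; 38; 39; 2; 23; 34; 15; 36; 46; 13; 37; 1; 11; 8; 28; 31; 40; 60; 42;
     33; 32; 44; 45; 35; 47; 52; 55; 43; 24; 19; 16; 26; 50; 62; 17; 21; 53; 29; 27; 48; 58; 51;
     25; 49; 57; 18; 22; 54; 30; 41; 61; 56; 59; 63],
   [::])%N.

Definition cert_h8 : certificate :=
  ([:: 67; 40; 63; 54; 46; 68; 78; 39; 10; 49; 20; 64; 76; 35; 6; 47; 18; 66; 84; 37; 8; 55; 26;
     61; 82; 32; 3; 53; 24; 73; 44; 15; 71; 42; 13; 65; 36; 7; 60; 31; 2; 56; 70; 50; 72; 43; 79;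
     21; 14; 41; 85; 27; 12; 51; 59; 45; 62; 33; 74; 16; 4; 30; 80; 22; 1; 77; 81; 48; 19; 52;
     23; 34; 83; 69; 75; 38; 29; 57; 86; 28; 25; 9; 17; 5; 11; 0],
   [:: 33; 40; 21; 99; 74; 16; 48; 114; 115; 82; 122; 4; 36; 102; 103; 70; 110; 17; 24; 90; 91;
     83; 123; 5; 12; 78; 79; 71; 111; 113; 120; 121; 101; 108; 109; 51; 58; 59; 39; 46; 47; 65;
     85; 64; 84; 96; 116; 124; 117; 72; 92; 125; 93; 3; 23; 2; 22; 34; 54; 62; 55; 10; 30; 63;
     31; 52; 29; 98; 118; 75; 95; 128; 129; 53; 28; 130; 67; 106; 60; 126; 119; 107; 94; 87; 61;
     127],
      [:: ([:: 66; 106], [::]); ([:: 20], [:: 28]); ([:: 86], [:: 106])])%N.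

Definition cert_h8k4 : certificate :=
  ([:: 105; 67; 96; 64; 68; 97; 93; 100; 71; 89; 73; 102; 72; 101; 76; 78; 107; 31; 36; 38; 9;
     51; 83; 30; 63; 53; 57; 82; 84; 111; 55; 24; 80; 85; 32; 46; 61; 66; 90; 37; 3; 59; 70; 77;
     106; 108; 103; 62; 91; 74; 45; 33; 4; 16; 86; 115; 56; 54; 109; 114; 27; 112; 113; 26; 25;
     22; 28; 75; 104; 41; 34; 88; 99; 12; 92; 95; 8; 5; 1; 17; 79; 49; 47; 40; 35; 81; 58; 60;
     65; 94; 98; 48; 42; 50; 39; 44; 69; 43; 21; 20; 15; 19; 14; 10; 18; 13; 6; 23; 11; 7; 2; 0],
   [:: 66; 72; 75; 68; 0; 83; 71; 65; 77; 3; 9; 89; 5; 85; 78; 10; 90; 42; 35; 41; 107; 34; 39;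
     2; 7; 106; 36; 108; 40; 43; 105; 111; 60; 45; 74; 4; 76; 8; 11; 73; 79; 28; 13; 6; 86; 80;
     18; 20; 23; 30; 38; 50; 55; 62; 46; 58; 120; 96; 53; 57; 125; 51; 113; 123; 119; 63; 126;
     14; 26; 88; 64; 21; 25; 93; 19; 81; 91; 87; 31; 94; 128; 129; 130; 131; 37; 132; 92; 15; 24;
     27; 17; 52; 104; 100; 49; 97; 29; 112; 124; 122; 121; 118; 117; 115; 110; 109; 103; 95; 61;
     59; 47; 127],
      [:: ([:: 12], [:: 15]); ([:: 56; 24; 37], [:: 44; 15; 98]); ([:: 32; 37], [::]); ([:: 98],
     [:: 37]); ([:: 44; 15], [::])])%N.

Definition cert_h9 : certificate :=
  ([:: 102; 55; 101; 50; 95; 43; 107; 38; 99; 96; 39; 110; 68; 59; 22; 105; 31; 67; 44; 40; 100;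
     46; 98; 60; 83; 9; 97; 23; 94; 92; 18; 54; 89; 87; 13; 49; 93; 90; 88; 85; 109; 53; 16; 108;
     48; 11; 91; 17; 86; 12; 61; 24; 45; 42; 84; 66; 41; 106; 103; 29; 82; 77; 3; 8; 79; 75; 1;
     5; 78; 4; 73; 36; 72; 35; 65; 28; 71; 34; 64; 27; 63; 26; 57; 20; 52; 15; 69; 32; 56; 19;
     51; 14; 47; 10; 58; 70; 37; 80; 104; 74; 81; 62; 21; 33; 25; 76; 6; 30; 7; 2; 0],
   [:: 4; 204; 2; 202; 1; 201; 199; 49; 38; 14; 78; 70; 206; 118; 126; 87; 223; 174; 102; 128;
     134; 198; 22; 182; 151; 215; 142; 190; 133; 21; 221; 181; 131; 19; 219; 179; 37; 13; 35; 11;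
     69; 117; 125; 67; 115; 123; 5; 189; 3; 187; 208; 222; 160; 161; 167; 104; 97; 103; 79; 127;
     135; 23; 159; 183; 39; 15; 63; 175; 47; 111; 248; 254; 236; 253; 244; 252; 234; 251; 242;
     250; 240; 246; 228; 245; 226; 243; 233; 239; 229; 237; 227; 235; 225; 231; 256; 257; 241;
     258; 259; 143; 55; 230; 249; 247; 238; 31; 207; 191; 119; 95; 255],
      [:: ([:: 224], [:: 230]); ([:: 232; 230], [::]); ([:: 7], [:: 55]); ([:: 71; 55], [::])])%N.

Definition cert_odd_h9 : certificate :=
  ([:: 26; 9; 25; 11; 24; 23; 22; 20; 2; 10; 21; 18; 0; 19; 1; 17; 8; 16; 7; 15; 6; 14; 5; 13; 4;
     12; 3],
   [:: 71; 119; 6; 206; 5; 3; 135; 23; 223; 183; 39; 15; 127; 7; 191; 232; 255; 240; 254; 228;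
     253; 226; 251; 224; 247; 225; 239],
   [::])%N.

(** The triple has to be general enough for the [84] generators of square zero and one common scale
    to reach the full rank [66 = 3 * 22] of the triples. *)
Definition Es_d7 : seq (seq (nat * nat * int)) :=
    [:: [:: (0, 1, 1%Z); (1, 4, 1%Z); (3, 5, 1%Z)]; [:: (1, 3, 1%Z); (1, 4, 1%Z); (2, 4, 1%Z); (4,
    5, 1%Z)]; [:: (0, 1, 1%Z); (0, 4, 1%Z); (2, 6, 1%Z)]]%N.

Definition Es_d8k4 : seq (seq (nat * nat * int)) :=
    [:: [::]; [:: (0, 1, 1%Z); (2, 3, 1%Z); (4, 5, 1%Z); (6, 7, 1%Z)]; [:: (0, 1, (-1)%Z); (2, 3,
    (-1)%Z); (4, 5, (-1)%Z); (6, 7, (-1)%Z)]; [:: (0, 1, 1%Z); (2, 3, 2%Z); (4, 5, (-1)%Z)]]%N.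

Definition cert_d7 : certificate :=
  ([:: 28; 40; 74; 82; 81; 20; 78; 3; 32; 10; 38; 68; 79; 34; 62; 83; 80; 8; 45; 55; 73; 76; 57;
     21; 54; 17; 24; 53; 11; 58; 56; 77; 65; 29; 33; 84; 44; 0; 15; 42; 4; 14; 30; 36; 18; 72;
     67; 60; 61; 66; 51; 1; 69; 43; 31; 25; 19; 75; 70; 48; 7; 13; 64; 23; 9; 5],
   [:: 32; 96; 156; 106; 44; 108; 42; 175; 144; 72; 8; 141; 56; 120; 153; 41; 105; 64; 74; 18;
     112; 150; 98; 151; 34; 122; 48; 133; 167; 33; 36; 148; 145; 192; 193; 194; 195; 79; 30; 196;
     91; 97; 137; 124; 140; 174; 29; 171; 155; 40; 135; 58; 60; 93; 103; 127; 27; 100; 9; 173;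
     183; 159; 121; 109; 43; 46],
      [:: ([:: 191], [:: 183]); ([:: 63], [:: 58]); ([:: 15; 117], [:: 79; 30]); ([:: 117], [::
     30]); ([:: 149; 29], [::])])%N.

Definition cert_d8 : certificate :=
  ([:: 12; 48; 34; 8; 4; 42; 6; 52; 30; 24; 10; 2; 40; 38; 32; 28; 20; 18; 46; 22; 16; 112; 69;
     88; 39; 43; 29; 7; 68; 62; 17; 47; 33; 21; 19; 15; 54; 61; 23; 0; 44; 26; 110; 51; 55; 116;
     73; 45; 94; 37; 57; 1; 27; 113; 92; 41; 89; 78; 75; 85; 82; 36; 31; 81; 96; 56; 97; 50; 49;
     25; 11; 65; 14; 5; 91; 9; 84; 35; 83; 80; 76; 72; 53; 13; 64; 3; 115],
   [:: 63; 123; 111; 61; 55; 119; 59; 125; 109; 95; 62; 47; 118; 117; 110; 107; 93; 91; 122; 94;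
     87; 127; 384; 385; 386; 387; 388; 389; 390; 391; 392; 393; 394; 395; 396; 397; 398; 399;
     191; 400; 401; 256; 402; 403; 404; 405; 406; 263; 407; 140; 408; 409; 376; 128; 188; 410;
     251; 183; 239; 187; 247; 411; 412; 371; 253; 175; 413; 414; 260; 190; 223; 415; 416; 328;
     220; 417; 219; 418; 246; 244; 142; 139; 250; 222; 419; 208; 31],
      [:: ([:: 350], [:: 222]); ([:: 378], [:: 250]); ([:: 267], [:: 139]); ([:: 270], [:: 142]);
     ([:: 372], [:: 244]); ([:: 348], [:: 220]); ([:: 351], [:: 223]); ([:: 318], [:: 190]); ([::
     303; 175], [::]); ([:: 381; 253], [::]); ([:: 375; 247], [::]); ([:: 315; 187], [::]); ([::
     316], [:: 188]); ([:: 311; 183], [::]); ([:: 103; 31; 256; 121], [:: 126; 126; 126]); ([::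
     319], [:: 191]); ([:: 126], [:: 31]); ([:: 121], [:: 31]); ([:: 255; 376; 263; 242; 242; 242;
     242; 370; 370; 370; 370; 371; 371; 371; 371], [:: 128; 268; 243; 243; 243; 243]); ([:: 355],
     [:: 239; 251]); ([:: 370; 371], [::]); ([:: 242], [:: 243]); ([:: 135; 263], [:: 128]); ([::
     268], [:: 140]); ([:: 147; 275; 371], [:: 243]); ([:: 275; 371], [::]); ([:: 367; 239],
     [::]); ([:: 115], [:: 31]); ([:: 243; 371], [::]); ([:: 132], [:: 260]); ([:: 124], [:: 31]);
     ([:: 200], [:: 328]); ([:: 79], [:: 31]); ([:: 347; 219], [::]); ([:: 374; 246], [::]); ([::
     336], [:: 208])])%N.

Definition cert_d8k4 : certificate :=
  ([:: 55; 126; 127; 125; 124; 113; 123; 122; 121; 120; 52; 109; 50; 102; 48; 110; 46; 103; 42;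
     107; 40; 100; 34; 108; 32; 101; 24; 105; 22; 98; 12; 106; 10; 99; 38; 36; 30; 28; 20; 18;
     16; 14; 8; 6; 4; 2; 131; 115; 130; 129; 128; 119; 118; 117; 116; 112; 68; 69; 61; 62; 82;
     83; 75; 76; 96; 97; 89; 90; 77; 64; 70; 65; 91; 66; 84; 67; 78; 57; 71; 58; 92; 59; 85; 60;
     93; 86; 94; 87; 74; 39; 73; 37; 81; 31; 80; 29; 21; 19; 17; 15; 9; 7; 5; 3; 53; 51; 49; 47;
     43; 41; 35; 33; 25; 23; 13; 11],
   [:: 383; 377; 376; 352; 256; 255; 254; 248; 224; 128; 125; 389; 124; 388; 123; 387; 122; 386;
     119; 401; 118; 400; 111; 393; 110; 392; 95; 449; 94; 448; 63; 417; 62; 416; 117; 115; 109;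
     107; 93; 91; 87; 79; 61; 59; 55; 47; 384; 511; 505; 481; 385; 126; 121; 103; 31; 127; 512;
     513; 514; 515; 516; 517; 518; 519; 520; 521; 522; 523; 524; 525; 526; 527; 528; 529; 530;
     531; 532; 533; 534; 535; 536; 537; 538; 539; 540; 541; 542; 543; 544; 235; 545; 237; 546;
     243; 547; 245; 187; 189; 175; 183; 219; 221; 207; 215; 250; 251; 252; 253; 238; 239; 246;
     247; 190; 191; 222; 223],
      [:: ([:: 351], [:: 223]); ([:: 350], [:: 222]); ([:: 319], [:: 191]); ([:: 318], [:: 190]);
     ([:: 375], [:: 247]); ([:: 374], [:: 246]); ([:: 367], [:: 239]); ([:: 366], [:: 238]); ([::
     381], [:: 253]); ([:: 380], [:: 252]); ([:: 379], [:: 251]); ([:: 378], [:: 250]); ([:: 471],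
     [:: 215; 215]); ([:: 343], [:: 215]); ([:: 463], [:: 207; 207]); ([:: 335], [:: 207]); ([::
     477; 221], [::]); ([:: 349], [:: 221]); ([:: 475; 219], [::]); ([:: 347], [:: 219]); ([::
     439], [:: 183; 183]); ([:: 311], [:: 183]); ([:: 431], [:: 175; 175]); ([:: 303], [:: 175]);
     ([:: 445; 189], [::]); ([:: 317], [:: 189]); ([:: 443; 187], [::]); ([:: 315], [:: 187]);
     ([:: 501; 501; 245; 245; 245; 373], [::]); ([:: 499; 499; 243; 243; 243; 371], [::]); ([::
     493; 493; 237; 237; 237; 365], [::]); ([:: 491; 491; 235; 235; 235; 363], [::]); ([:: 363],
     [:: 235]); ([:: 365], [:: 237]); ([:: 371], [:: 243]); ([:: 373], [:: 245])])%N.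

Definition rels_d7 : seq (nat * seq nat * seq nat * seq (nat * nat) * seq (nat * nat)) :=
    [:: (33, [::], [::], [::], [::]); (39, [::], [::], [::], [::]); (41, [::], [::], [::], [::]);
    (62, [::], [::], [::], [::]); (40, [:: 37], [::], [::], [::]); (48, [::], [:: 37], [::],
    [::]); (52, [:: 24], [::], [::], [::]); (54, [:: 31], [:: 26], [::], [::]); (76, [:: 36], [::
    55], [::], [::]); (29, [:: 31; 35], [:: 23; 68], [::], [::]); (38, [:: 34; 47; 32], [::],
    [::], [::]); (44, [:: 75], [:: 23; 47; 32], [::], [::]); (45, [:: 55; 34], [:: 25; 36], [::],
    [::]); (51, [:: 26; 22], [:: 72], [::], [::]); (69, [::], [:: 61; 36; 30; 43; 32; 47; 47],
    [::], [::]); (70, [:: 26], [:: 7], [::], [::]); (2, [:: 30; 36; 80], [:: 56; 24; 55], [::],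
    [::]); (46, [:: 34; 34; 35], [:: 37; 61; 28; 36; 36; 30; 30; 25], [::], [::]); (71, [:: 6; 47;
    32], [:: 75], [::], [::]); (0, [:: 82; 21; 73; 30; 30; 66; 66; 36; 36; 26; 26; 26; 53; 90;
    90], [:: 35; 55; 47; 47; 32; 32; 34; 34; 34; 34; 34; 34; 27; 24], [::], [:: (0, 0); (0, 0)]);
    (1, [:: 37; 55; 55; 57; 61; 59], [:: 36; 83], [::], [::]); (3, [:: 68; 43; 64; 24; 90; 27],
    [:: 32; 75; 47; 6; 53; 30; 34], [::], [::]); (12, [:: 59; 60; 24; 24; 56; 83], [:: 30; 30; 37;
    80; 80; 36], [::], [::]); (14, [:: 73; 47; 32; 34; 34; 35; 49; 80], [:: 26; 66; 36; 30; 90; 7;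
    11; 77], [:: (0, 0)], [::]); (42, [:: 82; 21; 26; 26; 90; 90; 66; 36; 30], [:: 47; 47; 32; 32;
    34; 34; 34; 34; 35], [::], [:: (0, 0)]); (58, [:: 47; 32; 34; 34; 31; 35], [:: 26; 26; 82],
    [:: (0, 0)], [::]); (67, [:: 28; 27; 64; 68; 68], [:: 31; 31; 35; 21; 32], [::], [::]); (81,
    [:: 24; 24; 56; 25; 78; 27; 28; 82; 82; 60], [:: 36; 36; 30; 30; 35; 35; 21; 5; 61; 61; 47;
    47; 32; 31; 31; 43; 66; 66; 37], [::], [::]); (10, [:: 26; 26; 73; 73; 90; 90; 59; 8; 55; 55;
    78; 82; 82; 66], [:: 25; 36; 36; 30; 47; 47; 34; 34; 34; 34; 83; 31; 32; 32; 35], [::], [::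
    (0, 0); (0, 0)]); (4, [:: 47; 32; 34; 34; 49; 68; 9; 35], [:: 36; 30; 7; 75; 63; 82; 90], [::
    (0, 0)], [::]); (50, [:: 26; 26; 66; 21; 30; 53], [:: 34; 24; 27], [::], [::]); (74, [:: 31;
    35; 35; 27; 24; 47; 32; 34; 34; 34], [:: 26; 26; 82; 53; 30; 30; 66; 36; 90], [:: (0, 0); (0,
    0)], [::]); (15, [:: 85; 75; 75; 53; 34; 34; 34; 79; 87; 47; 32; 35; 89; 49; 49; 72; 72], [::
    23; 68; 68; 22; 26; 9; 24; 90; 90; 27; 7; 66; 36], [:: (0, 0)], [::])]%N.

Definition rels_d8 : seq (nat * seq nat * seq nat * seq (nat * nat) * seq (nat * nat)) :=
    [:: (64, [::], [::], [::], [::]); (111, [::], [::], [::], [::]); (80, [::], [:: 66], [::],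
    [::]); (82, [:: 66], [::], [::], [::]); (95, [::], [:: 93], [::], [::]); (104, [:: 71], [::],
    [::], [::]); (109, [:: 93], [::], [::], [::]); (91, [:: 75], [::], [::], [::]); (100, [:: 84],
    [::], [::], [::]); (68, [::], [:: 66; 96], [::], [::]); (69, [:: 88], [:: 71], [::], [::]);
    (106, [:: 87], [:: 71], [::], [::]); (107, [::], [:: 79; 93], [::], [::]); (72, [:: 67; 88],
    [::], [::], [::]); (73, [:: 57], [::], [::], [::]); (77, [::], [:: 75; 79], [::], [::]); (98,
    [::], [:: 96; 84], [::], [::]); (105, [:: 79], [:: 63], [::], [::]); (108, [:: 103], [:: 87],
    [::], [::]); (112, [:: 96], [:: 70], [::], [::]); (118, [:: 102], [::], [::], [::]); (90, [::
    85; 87], [:: 88], [::], [::]); (59, [:: 89; 75], [:: 57], [::], [::]); (61, [::], [:: 89; 75;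
    63], [::], [::]); (114, [:: 70], [:: 96; 86; 84], [::], [::]); (116, [:: 86; 84], [:: 102],
    [::], [::]); (60, [:: 76; 97], [:: 81], [::], [::]); (115, [:: 99; 78], [:: 94], [::], [::]);
    (27, [::], [:: 0; 2; 5; 9; 14; 20], [:: (0, 1); (1, 2); (1, 2); (2, 3); (2, 3); (2, 3); (3,
    4); (3, 4); (3, 4); (3, 4)], [::]); (55, [::], [:: 53; 51; 49; 42; 40; 38; 33; 31; 28], [::],
    [:: (1, 0); (1, 0); (1, 0); (1, 0); (2, 1); (2, 1); (2, 1); (3, 2); (3, 2); (4, 3)]); (113,
    [:: 62; 97], [:: 78], [::], [::]); (117, [:: 56; 56; 56; 56; 76; 76; 94; 58; 58; 58], [:: 67;
    88; 85; 87; 103; 99; 99; 81; 81; 81], [::], [:: (1, 1); (2, 2); (2, 2); (3, 3); (3, 3); (3,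
    3); (4, 4); (4, 4); (4, 4); (4, 4)]); (119, [:: 81; 81; 99; 67; 88; 85; 87; 103], [:: 58; 58;
    76; 56; 56; 56], [:: (1, 1); (2, 2); (2, 2); (3, 3); (3, 3); (3, 3); (4, 4); (4, 4); (4, 4);
    (4, 4)], [::]); (74, [:: 56; 58], [:: 67; 88; 81], [::], [::]); (101, [:: 56; 76; 58], [::
    103; 99; 81], [::], [::]); (83, [:: 56; 58], [:: 85; 87; 81], [::], [::]); (92, [:: 56; 76;
    58], [:: 85; 87; 99; 81], [::], [::]); (65, [:: 56], [:: 67; 88], [::], [::]); (110, [:: 81;
    81; 99; 67; 88; 85; 87], [:: 58; 58; 76; 56; 56; 56], [:: (1, 1); (2, 2); (2, 2); (3, 3); (3,
    3); (3, 3); (4, 4); (4, 4); (4, 4); (4, 4)], [::])]%N.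

Definition rels_d8k4 : seq (nat * seq nat * seq nat * seq (nat * nat) * seq (nat * nat)) :=
    [:: (57, [::], [::], [::], [::]); (64, [::], [::], [::], [::]); (75, [::], [::], [::], [::]);
    (82, [::], [::], [::], [::]); (93, [::], [::], [::], [::]); (100, [::], [::], [::], [::]);
    (111, [::], [::], [::], [::]); (118, [::], [::], [::], [::]); (0, [::], [::], [:: (0, 1); (2,
    3); (4, 5); (6, 7); (8, 9); (10, 11); (12, 13); (14, 15)], [::]); (28, [::], [::], [::], [::
    (1, 0); (3, 2); (5, 4); (7, 6); (9, 8); (11, 10); (13, 12); (15, 14)]); (5, [::], [::], [::
    (0, 2); (1, 3); (4, 6); (5, 7); (8, 10); (9, 11); (12, 14); (13, 15)], [::]); (33, [::], [::],
    [::], [:: (2, 0); (3, 1); (6, 4); (7, 5); (10, 8); (11, 9); (14, 12); (15, 13)]); (14, [::],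
    [::], [:: (0, 4); (1, 5); (2, 6); (3, 7); (8, 12); (9, 13); (10, 14); (11, 15)], [::]); (42,
    [::], [::], [::], [:: (4, 0); (5, 1); (6, 2); (7, 3); (12, 8); (13, 9); (14, 10); (15, 11)]);
    (27, [::], [::], [:: (0, 8); (1, 9); (2, 10); (3, 11); (4, 12); (5, 13); (6, 14); (7, 15)],
    [::]); (55, [::], [::], [::], [:: (8, 0); (9, 1); (10, 2); (11, 3); (12, 4); (13, 5); (14, 6);
    (15, 7)]); (56, [::], [::], [:: (1, 1); (3, 3); (5, 5); (7, 7); (9, 9); (11, 11); (13, 13);
    (15, 15)], [::]); (65, [::], [::], [:: (1, 1); (3, 3); (5, 5); (7, 7); (9, 9); (11, 11); (13,
    13); (15, 15)], [::]); (74, [::], [::], [:: (2, 2); (3, 3); (6, 6); (7, 7); (10, 10); (11,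
    11); (14, 14); (15, 15)], [::]); (83, [::], [::], [:: (2, 2); (3, 3); (6, 6); (7, 7); (10,
    10); (11, 11); (14, 14); (15, 15)], [::]); (92, [::], [::], [:: (4, 4); (5, 5); (6, 6); (7,
    7); (12, 12); (13, 13); (14, 14); (15, 15)], [::]); (101, [::], [::], [:: (4, 4); (5, 5); (6,
    6); (7, 7); (12, 12); (13, 13); (14, 14); (15, 15)], [::]); (110, [::], [::], [:: (8, 8); (9,
    9); (10, 10); (11, 11); (12, 12); (13, 13); (14, 14); (15, 15)], [::]); (119, [::], [::], [::
    (8, 8); (9, 9); (10, 10); (11, 11); (12, 12); (13, 13); (14, 14); (15, 15)], [::])]%N.

Definition secant_check (h k r : nat) Es cert : bool :=
  let cert' := decode (0, None)%N [::] (rowsT h k) (even_bits h) cert in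
  [&& size Es == k, size cert' == r & check (evT (map (eZ h) Es)) (okT h k) (okb h) cert'].

Lemma secant_check1 : secant_check 1 3 1 (nseq 3 [::]) cert_h1. Proof. by vm_compute. Qed.
Lemma secant_check2 : secant_check 2 3 2 (nseq 3 [::]) cert_h2. Proof. by vm_compute. Qed.
Lemma secant_check3 : secant_check 3 3 4 (nseq 3 [::]) cert_h3. Proof. by vm_compute. Qed.
Lemma secant_check4 : secant_check 4 3 8 Es_h4 cert_h4. Proof. by vm_compute. Qed.
Lemma secant_check5 : secant_check 5 3 16 Es_h5 cert_h5. Proof. by vm_compute. Qed.
Lemma secant_check6 : secant_check 6 3 32 Es_h6 cert_h6. Proof. by vm_compute. Qed.
Lemma secant_check7 : secant_check 7 3 59 Es_h7 cert_h7. Proof. by vm_compute. Qed.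
Lemma secant_check8 : secant_check 8 3 86 Es_h8 cert_h8. Proof. by vm_compute. Qed.
Lemma secant_check8k4 : secant_check 8 4 112 Es_h8k4 cert_h8k4. Proof. by vm_compute. Qed.

Definition full_cert_h9 := decode (0, None)%N [::] (rowsT 9 3) (even_bits 9) cert_h9.

Lemma indep_check9 : check (evT (map (eZ 9) Es_h9)) predT (okb 9) full_cert_h9 &&
  perm_eq (rowsT 9 3) (map fst full_cert_h9).
Proof. by vm_compute. Qed.

Definition full_cert_odd_h9 :=
  decode (0, 0)%N [::] (rowsO 9 3) [seq b <- bits 9 | odd (count id b)] cert_odd_h9.

Lemma odd_indep_check9 :
  check (evO (map (eZ 9) Es_h9)) predT (okb_odd 9) full_cert_odd_h9 &&
  perm_eq (rowsO 9 3) (map fst full_cert_odd_h9).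
Proof. by vm_compute. Qed.

(** The products of [e_a] with its own contraction are left out: their square is not zero, so they
    do not give elements [1 + t q] with inverse [1 - t q]. *)
Definition nil_quads (h : nat) : seq (seq (bool * nat)) :=
  let ij := [seq (i, j) | i <- iota 0 h, j <- iota 0 h] in
  flatten [seq [:: ee p; [:: (false, p.1); (false, p.2)]] | p <- ij & (p.1 < p.2)%N] ++
  [seq [:: (true, p.1); (false, p.2)] | p <- ij & p.1 != p.2].

Definition density_check (h k e r : nat) Es ext cert : bool :=
  let gw := nil_quads h in
  let rows := [seq (false, a) | a <- iota 0 (size gw)] ++ [seq (true, t) | t <- iota 0 e] in
  let cert' := decode (false, 0%N) (0%N, [::]) rows
    [seq (i, b) | i <- iota 0 k, b <- even_bits h] cert in
  [&& size Es == k, size cert' == r, all (nilquad h) gw,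
   all (all (fun tq : nat * seq (bool * nat) => (tq.1 < e)%N && okq h tq.2)) ext &
   check (evG gw ext (map (eZ h) Es)) (okG gw e)
     (fun ib => (ib.1 < k)%N && okb h ib.2) cert'].

(** The label [0] is shared by the three points, so their only extra motion is a common scaling, and
    the sum stays on one line. *)
Definition ext_d7 : seq (seq (nat * seq (bool * nat))) := nseq 3 [:: (0%N, [::])].

(** The two-form [omega] with these pairs is nondegenerate. Up to scale, three general pure spinors
    can be moved to the exponentials of [0], [omega] and [- omega]; in [ext_d8] the labels [0] to
    [2] scale them and [3] to [5] let each slide along the curve of exponentials of [c omega]. *)
Definition path8 : seq (nat * nat) := [seq (i, i.+1) | i <- iota 0 7].

Definition Es_d8 : seq (seq (nat * nat * int)) :=
  [:: [::]; [seq (p, 1) | p <- path8]; [seq (p, -1) | p <- path8]].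

Definition ext_d8 : seq (seq (nat * seq (bool * nat))) :=
  [seq (i, [::]) :: [seq ((3 + i)%N, ee p) | p <- path8] | i <- iota 0 3].

(** A fourth point brings a second two-form, and a general pair of two-forms in dimension eight
    splits into four common blocks of size two. Besides its scale, each of the four points thus gets
    four parameters in [ext_d8k4], one per block. *)
Definition blocks8 : seq (nat * nat) := [seq (i.*2, i.*2.+1) | i <- iota 0 4].

Definition ext_d8k4 : seq (seq (nat * seq (bool * nat))) :=
  [seq (i, [::]) :: [seq ((4 * i.+1 + p.1./2)%N, ee p) | p <- blocks8] | i <- iota 0 4].

Lemma density_check7 : density_check 7 3 1 66 Es_d7 ext_d7 cert_d7. Proof. by vm_compute. Qed.
Lemma density_check8 : density_check 8 3 6 87 Es_d8 ext_d8 cert_d8. Proof. by vm_compute. Qed.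
Lemma density_check8k4 : density_check 8 4 20 116 Es_d8k4 ext_d8k4 cert_d8k4.
Proof. by vm_compute. Qed.

Definition Ls7 : seq (spin int) :=
  [:: foldr (fun E acc => let v := eZ 7 E in fun K => v K + acc K) (fun=> 0) Es_d7].

(** The homogeneous parts of the exponential of [omega], in degrees [0], [2], ..., [8]; the
    exponential of [c omega] is their combination with coefficients [c ^+ m]. *)
Definition Ls8 : seq (spin int) :=
  [seq (fun K => if crd 8 K == m.*2 then expps path8 (fun=> 1) (vac int 8) K else 0)
    | m <- iota 0 5].

(** The products of blocks in binary order: bit [j] of the index tells whether block [j] occurs.
    Their span is a tensor product of four planes. *)
Definition Ls8k4 : seq (spin int) :=
  foldl (fun Ls p => Ls ++ [seq op (ee p) l | l <- Ls]) [:: vac int 8] blocks8.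

Definition orbit_basis (h : nat) (rels : seq relation) :=
  [seq q <- quads h | q \notin [seq rl.1.1 | rl <- rels]].

Definition orbit_case (h r : nat) Ls rels : bool :=
  let rels' := decode_rels h (size Ls) rels in
  (size Ls + size (orbit_basis h rels') == r)%N &&
  check_orbit h Ls (orbit_basis h rels') rels'.

Lemma orbit_check7 : orbit_case 7 59 Ls7 rels_d7. Proof. by vm_compute. Qed.
Lemma orbit_check8 : orbit_case 8 86 Ls8 rels_d8. Proof. by vm_compute. Qed.
Lemma orbit_check8k4 : orbit_case 8 112 Ls8k4 rels_d8k4. Proof. by vm_compute. Qed.

(** * Dimensions *)

Section Upper.
Variables (F : numFieldType) (h k e : nat).
Variables (Es Es' : seq (seq (nat * nat * int))) (ext : seq (seq (nat * seq (bool * nat)))).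
Variables (Ls : seq (spin int)).

(** Two tuples serve two purposes: [Es'] gives the rank of the sum map for the lower bound, and [Es]
    is the tuple in normal form at which density is tested for the upper bound. *)
Lemma has_dim_secant_orbit r cert cert' rels : (0 < k)%N -> (0 < size Ls)%N ->
  secant_check h k r Es' cert' ->
  density_check h k e.+1 (k * ('C(h, 2)).+1) Es ext cert ->
  orbit_case h r Ls rels ->
  (forall y : 'I_e.+1 -> F,
     in_span h Ls (\sum_(i < k) actw (extF e ext i) y (vF F h Es i))) ->
  has_dim (secant_variety k (spinor_variety F h)) r.-1.
Proof.
move=> k0 Ls0 + + /andP[/eqP Er orb] sum_in; rewrite -{}Er.
move=> /and3P[/eqP sE' /eqP sc' chk'] /and5P[/eqP sE /eqP sc nq extq chk].
have := secant_rank_ge F sE' k0 chk'; rewrite sc' => rk.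
have exte : all (all (fun tq => (tq.1 < e.+1)%N)) ext.
  by apply: sub_all extq => W; apply: sub_all => tq /andP[].
have trk : (#|par_type h k| <=
    \rank (tangent_mx h (nil_quads h) (extF e ext) (vF F h Es (k := k))))%N.
  by apply: leq_trans (tangent_rank_ge F k0 exte chk); rewrite sc card_prod !card_ord.
have extok (i : 'I_k) : all (fun tq => okq h tq.2) (extF e ext i).
  rewrite all_map; have [ie|ie] := ltnP i (size ext); last by rewrite nth_default.
  by apply: sub_all (allP extq _ (mem_nth _ ie)) => tq /andP[].
have r0 : (0 < size Ls + size (orbit_basis h (decode_rels h (size Ls) rels)))%N.
  by rewrite addn_gt0 Ls0.
pose L (m : 'I_(size Ls)) := toF F (nth 0 Ls m).
apply: (has_dim_secant k0 (chi2 := psi (nil_quads h) L)).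
- by rewrite prednK //; exact: rk.
- apply: chi_sub_orbit nq extok _ trk sum_in => i.
  apply: sub_acl; rewrite /vF (nth_map [::]) ?sE //; exact: cone_toF.
- move=> b; rewrite prednK //; apply: rank_orbit nq _ b => z.
  exact: check_orbit_span orb z.
Qed.

End Upper.

Section Sums.
Variable F : numFieldType.
Implicit Types (ps : seq (nat * nat)) (v : spin F).

Lemma expps_actw ps (x : nat * nat -> F) v :
  expps ps x v = actw [seq (p, ee p) | p <- ps] x v.
Proof. by elim: ps => //= p ps ->. Qed.

Lemma expps0 ps v : expps ps (fun=> 0) v = v.
Proof. by elim: ps => //= p ps ->; rewrite scl0 addr0. Qed.

Lemma expps_merge ps (a b : F) v :
  expps ps (fun=> a) (expps ps (fun=> b) v) = expps ps (fun=> a + b) v.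
Proof.
elim: ps => //= p ps <-; set u := expps ps (fun=> b) v.
rewrite [expps ps _ (_ + _)]expps_actw actwD actwZ -!expps_actw -ee_expps.
rewrite opD opZ ee_sq sclr0 addr0 -addrA -scl_addl; congr (_ + scl _ _).
by rewrite addrC.
Qed.

(** The divided power of degree [m] is homogeneous of degree [m] in the two-form. *)
Lemma expps_graded h ps (c : F) K m : all (fun p => (p.1 < h)%N && (p.2 < h)%N) ps ->
  crd h K = m.*2 ->
  expps ps (fun=> c) (vac F h) K = c ^+ m * expps ps (fun=> 1) (vac F h) K.
Proof.
move=> psh Km; have nz : m`!%:R != 0 :> F by rewrite pnatr_eq0 -lt0n fact_gt0.
apply: (mulfI nz); rewrite mulrCA !(expps_om _ psh Km).
have omc v : om ps (fun=> c) v = scl c (om ps (fun=> 1) v).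
  by rewrite /om scl_sum; apply: eq_bigr => p _; rewrite scl1.
rewrite -[RHS]/(scl (c ^+ m) (iter m (om ps (fun=> 1)) (vac F h)) K); congr (_ K).
elim: m {Km nz} => [|m IH]; first by rewrite scl1.
by rewrite !iterS IH omc omZ sclA exprS.
Qed.

Lemma in_span_actw h (Ls : seq (spin int)) (T : Type) (W : seq (T * seq (bool * nat))) y v :
  (forall tq (u : spin F), List.In tq W -> in_span h Ls u -> in_span h Ls (op tq.2 u)) ->
  in_span h Ls v -> in_span h Ls (actw W y v).
Proof.
move=> + Lv; elim: W => //= tq W IH opW.
have LW : in_span h Ls (actw W y v) by apply: IH => tq' u Wt; apply: opW; right.
by apply: in_spanD => //; apply: in_spanZ; apply: opW LW; left.
Qed.

Lemma in_span_nth h (Ls : seq (spin int)) m : (m < size Ls)%N ->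
  in_span h Ls (toF F (nth 0 Ls m)).
Proof.
move=> mL; apply: (@in_span_bits _ _ _ _ [:: (1, m)]); first by rewrite /= mL.
by apply/allP => b _; rewrite /= mul1r addr0.
Qed.

Lemma toF_expps ps (x : nat * nat -> int) h :
  toF F (expps ps x (vac int h)) = expps ps (fun p => (x p)%:~R) (vac F h).
Proof. by rewrite /toF (expps_morph (intmul (1 : F))) (vac_morph (intmul (1 : F))). Qed.

Lemma sum_in_span7 (y : 'I_1 -> F) :
  in_span 7 Ls7 (\sum_(i < 3) actw (extF 0 ext_d7 i) y (vF F 7 Es_d7 i)).
Proof.
have E (i : 'I_3) : actw (extF 0 ext_d7 i) y (vF F 7 Es_d7 i) =
    scl (1 + y (inord 0)) (vF F 7 Es_d7 i).
  rewrite scl_addl scl1; move: (vF F 7 Es_d7 i) => v; case: i => -[|[|[|//]]] i3; reflexivity.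
under eq_bigr do rewrite E.
rewrite -scl_sum; apply: in_spanZ.
have -> : \sum_(i < 3) vF F 7 Es_d7 i = toF F (nth 0 Ls7 0).
  apply: funext => K; rewrite spin_sumE !big_ord_recl big_ord0.
  pose v j : spin int := nth 0 (map (eZ 7) Es_d7) j.
  have add (a b c : int) : a%:~R + (b%:~R + (c%:~R + 0)) = (a + (b + (c + 0)))%:~R :> F.
    by rewrite !rmorphD.
  exact: (add (v 0%N K) (v 1%N K) (v 2%N K)).
exact: in_span_nth.
Qed.

Lemma nth_Ls8 (m : 'I_(size Ls8)) : nth 0 Ls8 m =
  fun K => if crd 8 K == m.*2 then expps path8 (fun=> 1) (vac int 8) K else 0.
Proof. by case: m => m; rewrite size_map => mi; rewrite (nth_map 0%N) // nth_iota. Qed.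

Lemma expps_in_span8 (c : F) : in_span 8 Ls8 (expps path8 (fun=> c) (vac F 8)).
Proof.
exists (fun m => c ^+ m); apply/rowP => j; rewrite !mxE /lsum spin_sumE.
have ev := key_even j; have := count_size (key j) (iota 0 8); rewrite -/(crd 8 _) size_iota => c8.
have cK : crd 8 (key j) = (crd 8 (key j))./2.*2.
  by rewrite -[LHS]odd_double_half (negPf ev).
have m5 : ((crd 8 (key j))./2 < size Ls8)%N.
  by rewrite size_map size_iota ltnS; have := half_leq c8.
have path8_lt : all (fun p => (p.1 < 8)%N && (p.2 < 8)%N) path8 by [].
rewrite (expps_graded _ path8_lt cK) (bigD1 (Ordinal m5)) // big1 => [|m nm].
  have -> : expps path8 (fun=> 1) (vac F 8) = toF F (expps path8 (fun=> 1) (vac int 8)).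
    by rewrite toF_expps.
  rewrite /scl /toF nth_Ls8 -cK eqxx; exact: esym (addr0 _).
rewrite /scl /toF nth_Ls8; case: eqP => [E|_]; last by rewrite mulr0.
by case/eqP: nm; apply: val_inj; rewrite [RHS]/= E doubleK.
Qed.

Lemma sum_in_span8 (y : 'I_6 -> F) :
  in_span 8 Ls8 (\sum_(i < 3) actw (extF 5 ext_d8 i) y (vF F 8 Es_d8 i)).
Proof.
apply: in_span_sum => i; pose c : F := (nth 0 [:: 0; 1; -1 : int] i)%:~R.
have Ev : vF F 8 Es_d8 i = expps path8 (fun=> c) (vac F 8).
  have eZ0 (E : seq (nat * nat * int)) (z : int) :
      [seq p <- prs 8 | xE E p != 0] = path8 -> all (fun p => xE E p == z) path8 ->
      toF F (eZ 8 E) = expps path8 (fun=> z%:~R) (vac F 8).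
    move=> Eps /allP Ez; rewrite /eZ Eps toF_expps; apply: expps_ext => p /Ez /eqP -> //.
  rewrite /c; case: i {c} => -[|[|[|//]]] i3.
  - rewrite [RHS]expps0 -[LHS]/(toF F (expps [::] (xE [::]) (vac int 8))).
    exact: toF_expps.
  - by apply: eZ0; vm_compute.
  - by apply: eZ0; vm_compute.
(* The letters labelled [3 + i] share one parameter and assemble to an exponential, which
   [expps_merge] then adds to the exponent of the point. *)
have -> : actw (extF 5 ext_d8 i) y (vF F 8 Es_d8 i) =
    scl (1 + y (inord i)) (expps path8 (fun=> y (inord (3 + i))) (vF F 8 Es_d8 i)).
  by rewrite scl_addl scl1; case: i {c Ev} => -[|[|[|//]]].
apply: in_spanZ; rewrite Ev expps_merge; exact: expps_in_span8.
Qed.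

(** Multiplication by block [j] sets bit [j] of the index, and gives zero if the bit is already
    set. *)
Definition block_es (j : nat) : seq (seq (int * nat)) :=
  [seq if odd (m %/ 2 ^ j) then [::] else [:: (1, (m + 2 ^ j)%N)] | m <- iota 0 16].

Lemma stable_blocks8 :
  all (fun j => check_stable 8 Ls8k4 (ee (nth (0, 0)%N blocks8 j)) (block_es j)) (iota 0 4).
Proof. by vm_compute. Qed.

Lemma in_span_ee8 p (u : spin F) : p \in blocks8 -> in_span 8 Ls8k4 u ->
  in_span 8 Ls8k4 (op (ee p) u).
Proof.
move=> /(nthP (0, 0)%N)[j js <-].
by apply: (in_span_op (es := block_es j)); apply: (allP stable_blocks8); rewrite mem_iota.
Qed.

Lemma sum_in_span8k4 (y : 'I_20 -> F) :
  in_span 8 Ls8k4 (\sum_(i < 4) actw (extF 19 ext_d8k4 i) y (vF F 8 Es_d8k4 i)).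
Proof.
apply: in_span_sum => i; apply: in_span_actw => [tq u|].
  move=> tqi Lu; have : (tq.2 == [::]) || (tq.2 \in map ee blocks8).
    by move: tqi; case: i => -[|[|[|[|//]]]] i4 /=; intuition; subst tq.
  by case/orP => [/eqP -> //|/mapP[p pin ->]]; exact: in_span_ee8.
have vacL : in_span 8 Ls8k4 (vac F 8).
  rewrite -(vac_morph (intmul (1 : F))); exact: (@in_span_nth 8 Ls8k4 0).
have eps (E : seq (nat * nat * int)) : all (mem blocks8) [seq p <- prs 8 | xE E p != 0] ->
    in_span 8 Ls8k4 (toF F (eZ 8 E)).
  rewrite /eZ; move: [seq _ <- _ | _] => ps psB; rewrite toF_expps.
  elim: ps psB => //= p ps IH /andP[pB /IH Lu]; apply: in_spanD => //.
  by apply: in_spanZ; exact: in_span_ee8.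
rewrite /vF (nth_map [::]) //; apply: eps.
by case: i => -[|[|[|[|//]]]] i4; vm_compute.
Qed.

End Sums.

Section Dimensions.
Variable F : numFieldType.

Lemma has_dim_secant_min h k (xs : 'I_k -> nat * nat -> F) : (0 < h)%N -> (0 < k)%N ->
  (minn (k * ('C(h, 2)).+1) (2 ^ (h - 1)) <=
     \rank (jac (@chi F h k) (base_at (h := h) xs)))%N ->
  has_dim (secant_variety k (spinor_variety F h))
    (minn (k * 'C(h, 2) + k - 1) (2 ^ (h - 1) - 1)).
Proof.
move=> h0 k0 rk; have cp : #|par_type h k| = (k * ('C(h, 2)).+1)%N by rewrite card_prod !card_ord.
have {}cp : minn #|par_type h k| (num_even_subsets h) = minn (k * ('C(h, 2)).+1) (2 ^ (h - 1)).
  by rewrite cp num_even_subsetsE.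
have := @has_dim_secant_full F h k k0 xs; rewrite cp => /(_ rk).
have -> : minn (k * 'C(h, 2) + k - 1) (2 ^ (h - 1) - 1) =
    (minn (k * ('C(h, 2)).+1) (2 ^ (h - 1))).-1.
  by rewrite mulnS; lia.
by [].
Qed.

Lemma secant_dim_cert h k r Es cert : (0 < h)%N -> (0 < k)%N ->
  secant_check h k r Es cert -> minn (k * ('C(h, 2)).+1) (2 ^ (h - 1)) = r ->
  has_dim (secant_variety k (spinor_variety F h))
    (minn (k * 'C(h, 2) + k - 1) (2 ^ (h - 1) - 1)).
Proof.
move=> h0 k0 /and3P[/eqP sE /eqP sc chk] Er.
apply: (has_dim_secant_min (xs := fun i : 'I_k => xF F (nth [::] Es i))) => //.
by apply: leq_trans (secant_rank_ge F sE k0 chk); rewrite sc Er.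
Qed.

Lemma secant_dim_ge9 h : (9 <= h)%N ->
  has_dim (secant_variety 3 (spinor_variety F h))
    (minn (3 * 'C(h, 2) + 3 - 1) (2 ^ (h - 1) - 1)).
Proof.
move=> h9; apply: (has_dim_secant_min (xs := fun i : 'I_3 => xF F (nth [::] Es_h9 i))) => //.
  exact: leq_trans h9.
have xs0 (i : 'I_3) a b : (9 <= b)%N -> xF F (nth [::] Es_h9 i) (a, b) = 0.
  move=> b9; have /allP/(_ (nth [::] Es_h9 i)) : all (all (fun e => e.1.2 < 9)%N) Es_h9 by [].
  rewrite mem_nth // => /(_ isT); rewrite /xF; elim: (nth _ _ _) => //= e E IH /andP[e9 /IH].
  by case: eqP e9 => // ->; rewrite /= ltnNge b9.
have /andP[chk prm] := indep_check9; have /andP[ochk oprm] := odd_indep_check9.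
have ih9 := @indep_check F 9 Es_h9 3 full_cert_h9 erefl chk prm.
have oh9 := @odd_indep_check F 9 Es_h9 3 full_cert_odd_h9 erefl ochk oprm.
have [ih _] := indep_pad xs0 ih9 oh9 h9.
by rewrite (indep_rank ih) card_prod !card_ord geq_minl.
Qed.

Lemma secant3_dim h : (1 <= h)%N -> h <> 7%N -> h <> 8%N ->
  has_dim (secant_variety 3 (spinor_variety F h))
    (minn (3 * 'C(h, 2) + 3 - 1) (2 ^ (h - 1) - 1)).
Proof.
move=> h1 h7 h8; have [h9|] := leqP 9 h; first exact: secant_dim_ge9.
(* For [h] up to [6] the minimum is attained by the ambient space, so the certificates only have to
   reach the rank [2 ^ (h - 1)]. *)
case: h h1 h7 h8 => [|[|[|[|[|[|[|[|[|h]]]]]]]]] // _ _ _ _.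
- exact: secant_dim_cert secant_check1 _.
- exact: secant_dim_cert secant_check2 _.
- exact: secant_dim_cert secant_check3 _.
- exact: secant_dim_cert secant_check4 _.
- exact: secant_dim_cert secant_check5 _.
- exact: secant_dim_cert secant_check6 _.
Qed.

Lemma secant3_dim7 : has_dim (secant_variety 3 (spinor_variety F 7)) 58.
Proof.
apply: (@has_dim_secant_orbit F 7 3 0 _ _ _ Ls7 59 _ _ _ isT isT).
- exact: secant_check7.
- exact: density_check7.
- exact: orbit_check7.
- exact: sum_in_span7.
Qed.

Lemma secant3_dim8 : has_dim (secant_variety 3 (spinor_variety F 8)) 85.
Proof.
apply: (@has_dim_secant_orbit F 8 3 5 _ _ _ Ls8 86 _ _ _ isT isT).
- exact: secant_check8.
- exact: density_check8.
- exact: orbit_check8.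
- exact: sum_in_span8.
Qed.

Lemma secant4_dim8 : has_dim (secant_variety 4 (spinor_variety F 8)) 111.
Proof.
apply: (@has_dim_secant_orbit F 8 4 19 _ _ _ Ls8k4 112 _ _ _ isT isT).
- exact: secant_check8k4.
- exact: density_check8k4.
- exact: orbit_check8k4.
- exact: sum_in_span8k4.
Qed.

Lemma defective_spinor h k r : (0 < h)%N -> has_dim (secant_variety k (spinor_variety F h)) r ->
  (r < minn (k * 'C(h, 2) + k - 1) (2 ^ (h - 1) - 1))%N ->
  defective_secant k (spinor_variety F h).
Proof.
move=> h0 dr lt; split; first exact: nondegenerate_spinor.
exists 'C(h, 2), r; split=> //; first exact: has_dim_spinor.
by rewrite /expected_secant_dim num_even_subsetsE // -subn1.
Qed.

End Dimensions.

Theorem theorem1p1 (R : realType) :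
  (forall h : nat, (1 <= h)%N ->
     has_dim (spinor_variety R[i]%C h) ((h * (h - 1)) %/ 2)%N)
  /\
  (forall h : nat, (1 <= h)%N -> h <> 7%N -> h <> 8%N ->
     has_expected_secant_dim 3 (spinor_variety R[i]%C h) /\
     has_dim (secant_variety 3 (spinor_variety R[i]%C h))
       (minn (3 * ((h * (h - 1)) %/ 2) + 2) (2 ^ (h - 1) - 1))%N)
  /\
  (defective_secant 3 (spinor_variety R[i]%C 7) /\
   defective_secant 3 (spinor_variety R[i]%C 8) /\
   defective_secant 4 (spinor_variety R[i]%C 8) /\
   has_dim (secant_variety 3 (spinor_variety R[i]%C 7)) 58 /\
   has_dim (secant_variety 3 (spinor_variety R[i]%C 8)) 85 /\
   has_dim (secant_variety 4 (spinor_variety R[i]%C 8)) 111).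
Proof.
have binE h : ((h * (h - 1)) %/ 2)%N = 'C(h, 2) by rewrite bin2 divn2 subn1.
split=> [h _|]; first by rewrite binE; exact: has_dim_spinor.
split=> [h h1 h7 h8|].
  have dim3 := secant3_dim R[i]%C h1 h7 h8.
  rewrite binE -[2%N in X in _ /\ X]/(3 - 1)%N; split; last by move: dim3; rewrite -addnBA.
  split; first exact: nondegenerate_spinor.
  exists 'C(h, 2); first exact: has_dim_spinor.
  have -> : expected_secant_dim (num_even_subsets h) 3 'C(h, 2) =
      minn (3 * 'C(h, 2) + 3 - 1) (2 ^ (h - 1) - 1).
    by rewrite /expected_secant_dim num_even_subsetsE // -subn1.
  exact: dim3.
have d7 := secant3_dim7 R[i]%C; have d8 := secant3_dim8 R[i]%C; have d84 := secant4_dim8 R[i]%C.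
(* The expected dimensions to compare with [58], [85] and [111] are [63], [86] and [115]; the first
   is that of the ambient space. *)
split; first exact: defective_spinor d7 _.
split; first exact: defective_spinor d8 _.
by split; first exact: defective_spinor d84 _.
Qed.
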